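(* Let $\gamma:\mathrm{Sh}(\mathbb{R}^2)\to\mathrm{Sh}(\mathbb{R})$ be the geometric morphism induced by a projection $\mathbb{R}^2\to\mathbb{R}$. Then $\mathrm{Sh}(\mathbb{R}^2)$ is $1$-dimensional (without boundary) over the base topos $\mathrm{Sh}(\mathbb{R})$, via $\gamma$.
   Context: For a Grothendieck topos $\mathcal{E}$, let $\mathsf{s}\mathcal{E}$ be the category of simplicial objects in $\mathcal{E}$ with the injective model structure: cofibrations are the monomorphisms, weak equivalences are the maps inducing isomorphisms on the sheaves $\pi_0$ and on all higher homotopy sheaves at all base points. Homotopy sheaves are the sheafifications of the sectionwise homotopy groups. For a geometric morphism $\rho$, $\mathsf{s}\rho$ is the induced geometric morphism on simplicial objects, computed degreewise. For an object $A$ of $\mathcal{E}$ (a group object if $m\ge 1$, abelian if $m\geq 2$), $K(A,m)$ denotes a fibrant object of $\mathsf{s}\mathcal{E}$ with $\pi_m\cong A$ and all other homotopy sheaves trivial; it is unique up to homotopy equivalence. For a topos $e:\mathcal{E}\to\mathcal{T}$ over a base topos $\mathcal{T}$ put $\mathrm{H}^m_{\mathcal{T}}(\mathcal{E},A)=\pi_0(\mathsf{s}e_*K(A,m))$, an object of $\mathcal{T}$. A geometric morphism $\rho:\mathcal{F}\to\mathcal{E}$ over $\mathcal{T}$ induces $\mathrm{H}^m_{\mathcal{T}}(\mathcal{E},A)\to\mathrm{H}^m_{\mathcal{T}}(\mathcal{F},\rho^*A)$: apply $\pi_0\circ\mathsf{s}e_*$ to $K(A,m)\to\mathsf{s}\rho_*\mathsf{s}\rho^*K(A,m)\to\mathsf{s}\rho_*K$,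 with $\mathsf{s}\rho^*K(A,m)\to K$ a fibrant replacement (so $K$ is a $K(\rho^*A,m)$). For $n\geq 0$, $\rho$ is $n$-pure over $\mathcal{T}$ if for every object $X$ of $\mathcal{E}$, every $0\le m\le n$ and every $B$ in $\mathcal{T}$ (a group object if $m\ge1$, abelian if $m\ge2$), the map $\mathrm{H}^m_{\mathcal{T}}(\mathcal{E}/X,e^*B)\to\mathrm{H}^m_{\mathcal{T}}(\mathcal{F}/\rho^*X,\rho^*e^*B)$ is an isomorphism (coefficients are pulled back to the slices). It is $(-1)$-pure if for $m=0$ these maps are monomorphisms for all $X$ and $B$. Every geometric morphism is $(-2)$-pure. A monomorphism $V\hookrightarrow U$ in $\mathcal{E}$ is $n$-pure if $\mathcal{E}/V\to\mathcal{E}/U$ is $n$-pure over $\mathcal{T}$. The $(n-1)$-pure monomorphisms are the dense monomorphisms of a Lawvere--Tierney topology on $\mathcal{E}$; $\mathcal{E}_{\leq n}$ is the corresponding subtopos ($n\ge-1$). Put $\mathcal{E}_{<\infty}=\bigcup_n\mathcal{E}_{\leq n}$ (union of subtoposes). $\mathcal{E}$ is $n$-dimensional over $\mathcal{T}$ if $n$ is the smallest integer $\geq-1$ with $\mathcal{E}_{\leq n}=\mathcal{E}_{<\infty}$, and without boundary if $\mathcal{E}_{<\infty}=\mathcal{E}$. *)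

(* Defs.v *)
From mathcomp Require Import all_boot all_order all_algebra.
From mathcomp Require Import all_classical all_reals topology normedtype.

Set Implicit Arguments.
Unset Strict Implicit.
Unset Printing Implicit Defensive.

Import numFieldNormedType.Exports.
Local Open Scope classical_set_scope.

Declare Scope cat_scope.
Delimit Scope cat_scope with cat.
Local Open Scope cat_scope.

Record category := Category {
  ob :> Type;
  mor : ob -> ob -> Type;
  idm : forall X, mor X X;
  cmp : forall X Y Z, mor Y Z -> mor X Y -> mor X Z;
  cmp1m : forall X Y (f : mor X Y), cmp (idm Y) f = f;
  cmpm1 : forall X Y (f : mor X Y), cmp f (idm X) = f;
  cmpA : forall X Y Z W (h : mor Z W) (g : mor Y Z) (f : mor X Y),
    cmp h (cmp g f) = cmp (cmp h g) f
}.
Arguments mor {c}.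
Arguments idm {c}.
Arguments cmp {c X Y Z}.

Notation "g ** f" := (cmp g f) (at level 40, left associativity) : cat_scope.

Definition is_mono (C : category) (X Y : C) (f : mor X Y) : Prop :=
  forall Z (u v : mor Z X), f ** u = f ** v -> u = v.

Definition is_iso (C : category) (X Y : C) (f : mor X Y) : Prop :=
  exists g : mor Y X, g ** f = idm X /\ f ** g = idm Y.

Definition is_terminal (C : category) (I : C) : Prop :=
  forall Z, exists! u : mor Z I, True.

Definition is_product (C : category) (A B P : C) (p : mor P A) (q : mor P B) :
    Prop :=
  forall Z (a : mor Z A) (b : mor Z B),
    exists! u : mor Z P, p ** u = a /\ q ** u = b.

Definition is_pullback (C : category) (A B D P : C)
    (f : mor A D) (g : mor B D) (p : mor P A) (q : mor P B) : Prop :=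
  f ** p = g ** q /\
  forall Z (a : mor Z A) (b : mor Z B), f ** a = g ** b ->
    exists! u : mor Z P, p ** u = a /\ q ** u = b.

Record functor (C D : category) := Functor {
  fob :> C -> D;
  fmor : forall X Y, mor X Y -> mor (fob X) (fob Y);
  fmor1 : forall X, fmor (idm X) = idm (fob X);
  fmorM : forall X Y Z (g : mor Y Z) (f : mor X Y),
    fmor (g ** f) = fmor g ** fmor f
}.
Arguments fmor {C D} _ {X Y}.

Definition fully_faithful (C D : category) (F : functor C D) : Prop :=
  forall X Y (g : mor (F X) (F Y)), exists! f : mor X Y, fmor F f = g.

Definition left_exact (C D : category) (F : functor C D) : Prop :=
  (forall I, is_terminal I -> is_terminal (F I)) /\
  (forall (A B E P : C) (f : mor A E) (g : mor B E) (p : mor P A) (q : mor P B),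
    is_pullback f g p q ->
    is_pullback (fmor F f) (fmor F g) (fmor F p) (fmor F q)).

(* The adjunction between inverse and direct image is given by its unit, each
   component of which is a universal arrow to the direct image functor. *)
Record geometric_morphism (F E : category) := GeometricMorphism {
  inv : functor E F;
  dir : functor F E;
  inv_lex : left_exact inv;
  unit : forall X : E, mor X (dir (inv X));
  unit_nat : forall (X Y : E) (f : mor X Y),
    fmor dir (fmor inv f) ** unit X = unit Y ** f;
  unit_univ : forall (X : E) (A : F) (f : mor X (dir A)),
    exists! g : mor (inv X) A, fmor dir g ** unit X = f
}.

Section Slice.
Variables (C : category) (X : C).

Record slice_ob := SliceOb { dom : C; str : mor dom X }.

Record slice_mor (Y Z : slice_ob) := SliceMor {
  under :> mor (dom Y) (dom Z);
  underP : str Z ** under = str Y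
}.

Lemma slice_morP Y Z (f g : slice_mor Y Z) : under f = under g -> f = g.
Proof.
case: f g => f fP [g gP] /= e; case: g / e gP => gP.
by rewrite (Prop_irrelevance fP gP).
Qed.

Definition slice_id Y : slice_mor Y Y := SliceMor (cmpm1 (str Y)).

Lemma slice_cmp_subproof Y Z W (g : slice_mor Z W) (f : slice_mor Y Z) :
  str W ** (under g ** under f) = str Y.
Proof. by rewrite cmpA !underP. Qed.

Definition slice_cmp Y Z W (g : slice_mor Z W) (f : slice_mor Y Z) :=
  SliceMor (slice_cmp_subproof g f).

Definition slice : category.
Proof.
refine (@Category slice_ob slice_mor slice_id slice_cmp _ _ _) => *;
  apply: slice_morP => /=; [exact: cmp1m|exact: cmpm1|exact: cmpA].
Defined.

End Slice.
Arguments slice : clear implicits.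

Section SliceFunctor.
Variables (C D : category) (F : functor C D) (X : C).

Definition slice_fob (Y : slice C X) : slice D (F X) := SliceOb (fmor F (str Y)).

Lemma slice_fmor_subproof (Y Z : slice C X) (f : mor Y Z) :
  fmor F (str Z) ** fmor F (under f) = fmor F (str Y).
Proof. by rewrite -fmorM underP. Qed.

Definition slice_fmor (Y Z : slice C X) (f : mor Y Z) :
  mor (slice_fob Y) (slice_fob Z) :=
  @SliceMor D (F X) (slice_fob Y) (slice_fob Z) (fmor F (under f))
    (slice_fmor_subproof f).

Definition slice_functor : functor (slice C X) (slice D (F X)).
Proof.
refine (@Functor _ _ slice_fob slice_fmor _ _) => *; apply: slice_morP => /=;
  [exact: fmor1|exact: fmorM].
Defined.

End SliceFunctor.

(* The structure morphism of [E/X] over [T]: its inverse image functor is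
   [B |-> (e^* B * X -> X)].  As geometric morphisms are determined up to unique
   isomorphism by their inverse image, so is [eX]. *)
Definition is_slice_structure (E T : category) (e : geometric_morphism E T)
    (X : E) (eX : geometric_morphism (slice E X) T) : Prop :=
  exists q : forall B : T, mor (dom (inv eX B)) (inv e B),
    (forall (B B' : T) (b : mor B B'),
       q B' ** under (fmor (inv eX) b) = fmor (inv e) b ** q B) /\
    (forall B, is_product (q B) (str (inv eX B))).

(* The geometric morphism [E/V -> E/U] induced by [i : V -> U]: its inverse
   image functor is the pullback along [i]. *)
Definition is_slice_change (E : category) (V U : E) (i : mor V U)
    (r : geometric_morphism (slice E V) (slice E U)) : Prop :=
  exists q : forall Y : slice E U, mor (dom (inv r Y)) (dom Y),
    (forall (Y Y' : slice E U) (f : mor Y Y'),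
       q Y' ** under (fmor (inv r) f) = under f ** q Y) /\
    (forall Y, is_pullback (str Y) i (q Y) (str (inv r Y))).

(* The geometric morphism [F/r^*X -> E/X] induced by [r : F -> E]: its inverse
   image functor is [r^*] applied to morphisms with codomain [X]. *)
Definition is_localisation (F E : category) (r : geometric_morphism F E) (X : E)
    (rX : geometric_morphism (slice F (inv r X)) (slice E X)) : Prop :=
  inv rX = slice_functor (inv r) X.

(* Morphisms [p] -> [n] of the simplex category. *)
Record delta (p n : nat) := Delta {
  dfun :> 'I_p.+1 -> 'I_n.+1;
  deltaP : forall i j : 'I_p.+1, i <= j -> dfun i <= dfun j
}.

Lemma delta_eq p n (f g : delta p n) : f =1 g -> f = g.
Proof.
case: f g => f fP [g gP] /= /funext e; case: g / e gP => gP.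
by rewrite (Prop_irrelevance fP gP).
Qed.

Definition delta_id n : delta n n := @Delta n n id (fun _ _ => id).

Definition delta_cmp p n m (g : delta n m) (f : delta p n) : delta p m :=
  @Delta p m (fun i => g (f i)) (fun i j h => deltaP g (deltaP f h)).

Lemma coface_subproof n (i : 'I_n.+2) (j k : 'I_n.+1) :
  j <= k -> lift i j <= lift i k.
Proof. by rewrite /= leq_bump2. Qed.

Definition coface n (i : 'I_n.+2) : delta n n.+1 := Delta (@coface_subproof n i).

Definition collapse n : delta n 0 := @Delta n 0 (fun=> ord0) (fun _ _ _ => leqnn 0).

Record simplicial (C : category) := Simplicial {
  sob :> nat -> C;
  smor : forall p n, delta p n -> mor (sob n) (sob p);
  smor1 : forall n, smor (delta_id n) = idm (sob n);
  smorM : forall p n m (g : delta n m) (f : delta p n),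
    smor (delta_cmp g f) = smor f ** smor g
}.
Arguments smor {C} _ {p n}.

Record simplicial_map (C : category) (K L : simplicial C) := SimplicialMap {
  smap :> forall n, mor (K n) (L n);
  smap_nat : forall p n (f : delta p n), smor L f ** smap n = smap p ** smor K f
}.

Lemma simplicial_mapP (C : category) (K L : simplicial C)
  (f g : simplicial_map K L) : (forall n, f n = g n) -> f = g.
Proof.
case: f g => f fP [g gP] /= h.
have e : f = g := functional_extensionality_dep h.
by case: g / e gP {h} => gP; rewrite (Prop_irrelevance fP gP).
Qed.

Section SimplicialCategory.
Variable C : category.

Definition smap_id (K : simplicial C) : simplicial_map K K.
Proof.
refine (@SimplicialMap C K K (fun n => idm (K n)) _) => p n f.
by rewrite cmp1m cmpm1.
Defined.

Definition smap_cmp (K L M : simplicial C) (g : simplicial_map L M)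
  (f : simplicial_map K L) : simplicial_map K M.
Proof.
refine (@SimplicialMap C K M (fun n => g n ** f n) _) => p n h.
by rewrite cmpA smap_nat -cmpA smap_nat cmpA.
Defined.

Definition simplicial_cat : category.
Proof.
refine (@Category (simplicial C) (@simplicial_map C) smap_id smap_cmp _ _ _) => *;
  apply: simplicial_mapP => n /=; [exact: cmp1m|exact: cmpm1|exact: cmpA].
Defined.

End SimplicialCategory.

Definition face (C : category) (K : simplicial C) n (i : 'I_n.+2) :
  mor (K n.+1) (K n) := smor K (coface i).

Section SimplicialFunctor.
Variables (C D : category) (F : functor C D).

Definition sfun (K : simplicial C) : simplicial D.
Proof.
refine (@Simplicial D (fun n => F (K n)) (fun p n f => fmor F (smor K f)) _ _) => *.
- by rewrite smor1 fmor1.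
- by rewrite smorM fmorM.
Defined.

Definition sfun_map (K L : simplicial C) (f : simplicial_map K L) :
  simplicial_map (sfun K) (sfun L).
Proof.
refine (@SimplicialMap D (sfun K) (sfun L) (fun n => fmor F (f n)) _) => p n h /=.
by rewrite -!fmorM smap_nat.
Defined.

End SimplicialFunctor.

(* The composite [K -> s r_* (s r^* K) -> s r_* L] for [j : s r^* K -> L]. *)
Definition transpose (F E : category) (r : geometric_morphism F E)
  (K : simplicial E) (L : simplicial F) (j : simplicial_map (sfun (inv r) K) L) :
  simplicial_map K (sfun (dir r) L).
Proof.
refine (@SimplicialMap E K (sfun (dir r) L)
  (fun n => fmor (dir r) (j n) ** unit r (K n)) _) => p n h /=.
by rewrite cmpA -fmorM (smap_nat j h) fmorM -cmpA unit_nat cmpA.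
Defined.

Definition TypeCat : category.
Proof.
by refine (@Category Type (fun A B => A -> B) (fun A x => x)
  (fun A B D g f x => g (f x)) _ _ _).
Defined.

Definition sset := simplicial TypeCat.
Definition sset_map (S T : sset) := simplicial_map S T.

(* [sd n] is the barycentric subdivision of the standard [n]-simplex: the nerve
   of the poset of nonempty subsets of {0, ..., n}. *)
Record chain (n p : nat) := Chain {
  chn :> 'I_p.+1 -> {set 'I_n.+1};
  chain_neq0 : forall i, chn i != finset.set0;
  chain_sub : forall i j : 'I_p.+1, i <= j -> chn i \subset chn j
}.

Lemma chain_eq n p (c d : chain n p) : c =1 d -> c = d.
Proof.
case: c d => c c1 c2 [d d1 d2] /= /funext e; case: d / e d1 d2 => d1 d2.
by rewrite (Prop_irrelevance c1 d1) (Prop_irrelevance c2 d2).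
Qed.

Definition chain_res n p q (f : delta q p) (c : chain n p) : chain n q :=
  @Chain n q (fun i => c (f i)) (fun i => chain_neq0 c (f i))
    (fun i j h => chain_sub c (deltaP f h)).

Definition sd (n : nat) : sset.
Proof.
by refine (@Simplicial TypeCat (chain n) (fun q p f => chain_res f) _ _) => *;
  apply/funext => c; apply: chain_eq.
Defined.

Lemma chain_push_neq0 n m (t : delta n m) p (c : chain n p) (i : 'I_p.+1) :
  [set t x | x in c i]%SET != finset.set0.
Proof.
have /set0Pn[x xc] := chain_neq0 c i.
by apply/set0Pn; exists (t x); apply/imsetP; exists x.
Qed.

Definition chain_push n m (t : delta n m) p (c : chain n p) : chain m p :=
  @Chain m p (fun i => [set t x | x in c i]%SET) (chain_push_neq0 t c)
    (fun i j h => imsetS t (chain_sub c h)).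

Definition sd_map n m (t : delta n m) : sset_map (sd n) (sd m).
Proof.
by refine (@SimplicialMap TypeCat (sd n) (sd m) (chain_push t) _) => q p f;
  apply/funext => c; apply: chain_eq.
Defined.

(* Last vertex map from [sd n] to the standard [n]-simplex. *)
Definition last_vertex n (A : {set 'I_n.+1}) : 'I_n.+1 :=
  inord (\max_(x in A) (x : nat)).

Lemma last_vertexE n (A : {set 'I_n.+1}) :
  last_vertex A = \max_(x in A) (x : nat) :> nat.
Proof. by rewrite inordK // ltnS; apply/bigmax_leqP => x _; rewrite -ltnS. Qed.

Lemma last_vertex_mono n p (c : chain n p) (i j : 'I_p.+1) :
  i <= j -> last_vertex (c i) <= last_vertex (c j).
Proof.
move=> ij; rewrite !last_vertexE; apply/bigmax_leqP => x xc.
by apply: leq_bigmax_cond; exact: (fintype.subsetP (chain_sub c ij)).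
Qed.

Definition chain_last n p (c : chain n p) : delta p n :=
  Delta (@last_vertex_mono n p c).

Lemma last_vertex_push n m (t : delta n m) (A : {set 'I_n.+1}) :
  A != finset.set0 -> last_vertex [set t x | x in A]%SET = t (last_vertex A).
Proof.
move=> /set0Pn[a aA]; apply: val_inj; apply/eqP.
have [b bA bE] : exists2 b, b \in A & last_vertex A = b.
  have /(eq_bigmax_cond (fun x : 'I_n.+1 => x : nat)) [b bA bE] : (0 < #|A|)%N.
    by apply/card_gt0P; exists a.
  by exists b => //; apply: val_inj; rewrite /= last_vertexE.
have bmax x : x \in A -> x <= b.
  by move=> xA; rewrite -bE last_vertexE; apply: leq_bigmax_cond.
rewrite /= last_vertexE bE eqn_leq; apply/andP; split.
- by apply/bigmax_leqP => y /imsetP[x xA ->]; apply: deltaP; exact: bmax.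
- by apply: leq_bigmax_cond; apply/imsetP; exists b.
Qed.

(* Kan's functor Ex, and the natural map from [S] to [Ex S]. *)
Definition ex (S : sset) : sset.
Proof.
refine (@Simplicial TypeCat (fun n => sset_map (sd n) S)
  (fun p n t c => smap_cmp c (sd_map t)) _ _) => *;
  apply/funext => c; apply: simplicial_mapP => p; apply/funext => d /=;
  congr (smap c p _); apply: chain_eq => i /=.
- by rewrite imset_id.
- by rewrite -imset_comp.
Defined.

Definition ex_map (S T : sset) (f : sset_map S T) : sset_map (ex S) (ex T).
Proof.
refine (@SimplicialMap TypeCat (ex S) (ex T) (fun n c => smap_cmp f c) _) => p n t.
by apply/funext => c; apply: simplicial_mapP.
Defined.

Definition to_ex_fun (S : sset) n (s : S n) : ex S n.
Proof.
refine (@SimplicialMap TypeCat (sd n) S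
  (fun p c => smor S (chain_last c) s) _) => q p t.
apply/funext => c /=; have /(congr1 (@^~ s)) /= <- := smorM S (chain_last c) t.
by congr (smor S _ s); apply: delta_eq.
Defined.

Definition to_ex (S : sset) : sset_map S (ex S).
Proof.
refine (@SimplicialMap TypeCat S (ex S) (@to_ex_fun S) _) => p n t.
apply/funext => s; apply: simplicial_mapP => q; apply/funext => c /=.
have /(congr1 (@^~ s)) /= <- := smorM S t (chain_last c).
congr (smor S _ s); apply: delta_eq => i /=.
by rewrite last_vertex_push // chain_neq0.
Defined.

Fixpoint exk (k : nat) (S : sset) : sset :=
  if k is k'.+1 then ex (exk k' S) else S.

Fixpoint exk_map (k : nat) (S T : sset) (f : sset_map S T) :
    sset_map (exk k S) (exk k T) :=
  match k with 0 => f | k'.+1 => ex_map (exk_map k' f) end.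

Fixpoint exk_point (k : nat) (S : sset) (x : S 0) : exk k S 0 :=
  match k return exk k S 0 with
  | 0 => x
  | k'.+1 => to_ex (exk k' S) 0 (exk_point k' x)
  end.

(* The degenerate [n]-simplex of [Ex^k S] at the vertex [x] of [S]. *)
Definition const_simplex k (S : sset) (x : S 0) n : exk k S n :=
  smor (exk k S) (collapse n) (exk_point k x).

(* The homotopy group of degree [m.+1] of [S] at [x] is that of the Kan complex
   [Ex^oo S = colim_k Ex^k S].  A [sphere] represents an element of it by an
   [m.+1]-simplex of some [Ex^k S] whose faces are all at the base point. *)
Record sphere (S : sset) (x : S 0) (m : nat) := Sphere {
  level : nat;
  simplex : exk level S m.+1;
  sphereP : forall i, face (exk level S) i simplex = const_simplex level x m
}.
Arguments Sphere {S x m}.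

(* There is an [m.+2]-simplex of [Ex^k S] whose last three faces are [a], [b],
   [c], and whose other faces are at the base point; in [Ex^oo S], this means
   that the class of [b] is the product of the classes of [a] and [c]. *)
Definition spans (S : sset) (x : S 0) m k (a b c : exk k S m.+1) : Prop :=
  exists w : exk k S m.+2, forall i : 'I_m.+3,
    face (exk k S) i w =
      if (i == m :> nat) then a
      else if (i == m.+1 :> nat) then b
      else if (i == m.+2 :> nat) then c
      else const_simplex k x m.+1.

(* Generates equality of the classes in the homotopy group. *)
Inductive homotopic (S : sset) (x : S 0) (m : nat) :
    sphere x m -> sphere x m -> Prop :=
| homotopic_level k (a : exk k S m.+1) aP bP :
    homotopic (Sphere k a aP) (Sphere k.+1 (to_ex (exk k S) m.+1 a) bP)
| homotopic_htpy k (a b : exk k S m.+1) aP bP :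
    spans x (const_simplex k x m.+1) a b ->
    homotopic (Sphere k a aP) (Sphere k b bP).

Lemma to_ex_nat (S T : sset) (f : sset_map S T) n (s : S n) :
  ex_map f n (to_ex S n s) = to_ex T n (f n s).
Proof.
apply: simplicial_mapP => p; apply/funext => c /=.
by have /(congr1 (@^~ s)) := smap_nat f (chain_last c).
Qed.

Lemma exk_map_point k (S T : sset) (f : sset_map S T) (x : S 0) :
  exk_map k f 0 (exk_point k x) = exk_point k (f 0 x).
Proof. by elim: k => [//|k IHk]; rewrite [LHS]to_ex_nat IHk. Qed.

Lemma exk_map_sphere (S T : sset) (f : sset_map S T) (x : S 0) (y : T 0) m
  (fx : f 0 x = y) (s : sphere x m) i :
  face (exk (level s) T) i (exk_map (level s) f m.+1 (simplex s)) =
  const_simplex (level s) y m.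
Proof.
case: s => k a aP /=.
have /(congr1 (@^~ a)) /= e := smap_nat (exk_map k f) (coface i).
apply: (etrans e); rewrite -/(face (exk k S) i) aP.
have /(congr1 (@^~ (exk_point k x))) /= <- := smap_nat (exk_map k f) (collapse m).
by rewrite exk_map_point fx.
Qed.

Definition sphere_map (S T : sset) (f : sset_map S T) (x : S 0) (y : T 0) m
    (fx : f 0 x = y) (s : sphere x m) : sphere y m :=
  Sphere (level s) (exk_map (level s) f m.+1 (simplex s)) (exk_map_sphere fx s).

(* A presheaf of sets on [C], given on each object by generators subject to the
   equivalence relation generated by [rel]. *)
Record presheaf (C : category) := Presheaf {
  gen : C -> Type;
  res : forall Z' Z, mor Z' Z -> gen Z -> gen Z';
  rel : forall Z, gen Z -> gen Z -> Prop
}.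
Arguments gen {C}.
Arguments res {C} p {Z' Z}.
Arguments rel {C} p {Z}.

(* Maps from a presheaf to the presheaf represented by [A]. *)
Record presheaf_map (C : category) (P : presheaf C) (A : C) := PresheafMap {
  pmap :> forall Z, gen P Z -> mor Z A;
  pmap_nat : forall Z' Z (f : mor Z' Z) s, pmap (res P f s) = pmap s ** f;
  pmap_rel : forall Z (s t : gen P Z), rel P s t -> pmap s = pmap t
}.

(* When [C] is a Grothendieck topos, the representable presheaves are the
   sheaves for its canonical topology, so that this is the universal property
   of the associated sheaf. *)
Definition is_sheafification (C : category) (P : presheaf C) (A : C)
    (eta : presheaf_map P A) : Prop :=
  forall B (theta : presheaf_map P B),
    exists! g : mor A B, forall Z (s : gen P Z), theta Z s = g ** eta Z s.

(* The morphism induced by [phi] between associated sheaves satisfies [Q]. *)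
Definition sheafified (C : category)
    (Q : forall A B : C, mor A B -> Prop) (P P' : presheaf C)
    (phi : forall Z, gen P Z -> gen P' Z) : Prop :=
  forall (A B : C) (eta : presheaf_map P A) (theta : presheaf_map P' B),
    is_sheafification eta -> is_sheafification theta ->
    forall g : mor A B,
      (forall Z (s : gen P Z), g ** eta Z s = theta Z (phi Z s)) -> Q A B g.

Definition trivial_sheaf (C : category) (P : presheaf C) : Prop :=
  exists (A : C) (eta : presheaf_map P A), is_sheafification eta /\ is_terminal A.

Section HomotopySheaves.
Variable C : category.

Definition sections (Z : C) (K : simplicial C) : sset.
Proof.
refine (@Simplicial TypeCat (fun n => mor Z (K n)) (fun p n f s => smor K f ** s) _ _).
- by move=> n; apply/funext => s /=; rewrite smor1 cmp1m.
- by move=> p n m g f; apply/funext => s /=; rewrite smorM cmpA.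
Defined.

Definition sections_res (Z' Z : C) (f : mor Z' Z) (K : simplicial C) :
  sset_map (sections Z K) (sections Z' K).
Proof.
refine (@SimplicialMap TypeCat (sections Z K) (sections Z' K) (fun n s => s ** f) _).
by move=> p n g; apply/funext => s /=; rewrite cmpA.
Defined.

Definition sections_map (Z : C) (K L : simplicial C) (f : simplicial_map K L) :
  sset_map (sections Z K) (sections Z L).
Proof.
refine (@SimplicialMap TypeCat (sections Z K) (sections Z L) (fun n s => f n ** s) _).
by move=> p n g; apply/funext => s /=; rewrite !cmpA smap_nat.
Defined.

Definition pi0 (K : simplicial C) : presheaf C :=
  @Presheaf C (fun Z => mor Z (K 0)) (fun Z' Z f s => s ** f)
    (fun Z s t => exists e : mor Z (K 1),
       face K ord_max ** e = s /\ face K ord0 ** e = t).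

Definition pi0_map (K L : simplicial C) (f : simplicial_map K L) (Z : C)
  (s : gen (pi0 K) Z) : gen (pi0 L) Z := f 0 ** s.

Lemma base_res (K : simplicial C) (Y : C) (x : mor Y (K 0)) (Z' Z : slice C Y)
  (f : mor Z' Z) :
  sections_res (under f) K 0 (x ** str Z) = x ** str Z' :> mor (dom Z') (K 0).
Proof. by rewrite /= -cmpA underP. Qed.

(* The homotopy presheaf of [K] of degree [m.+1] at [x : Y -> K 0], on [C/Y]. *)
Definition piS (K : simplicial C) (Y : C) (x : mor Y (K 0)) (m : nat) :
    presheaf (slice C Y) :=
  @Presheaf (slice C Y)
    (fun Z => @sphere (sections (dom Z) K) (x ** str Z) m)
    (fun Z' Z f s =>
       @sphere_map (sections (dom Z) K) (sections (dom Z') K)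
         (sections_res (under f) K) _ _ m (base_res x f) s)
    (fun Z s t => homotopic s t).

Lemma base_map (K L : simplicial C) (f : simplicial_map K L) (Y : C)
  (x : mor Y (K 0)) (Z : slice C Y) :
  sections_map (dom Z) f 0 (x ** str Z) = (f 0 ** x) ** str Z :> mor (dom Z) (L 0).
Proof. by rewrite /= cmpA. Qed.

Definition piS_map (K L : simplicial C) (f : simplicial_map K L) (Y : C)
    (x : mor Y (K 0)) (m : nat) (Z : slice C Y) (s : gen (piS x m) Z) :
    gen (piS (f 0 ** x) m) Z :=
  @sphere_map (sections (dom Z) K) (sections (dom Z) L) (sections_map (dom Z) f)
    _ _ m (base_map f x Z) s.

Definition weak_equivalence (K L : simplicial C) (f : simplicial_map K L) : Prop :=
  sheafified (@is_iso C) (@pi0_map K L f) /\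
  forall (Y : C) (x : mor Y (K 0)) (m : nat),
    sheafified (@is_iso (slice C Y)) (@piS_map K L f Y x m).

Definition fibrant (K : simplicial C) : Prop :=
  forall (A B : simplicial_cat C) (i : mor A B), is_mono i -> weak_equivalence i ->
  forall u : mor A (K : simplicial_cat C),
    exists v : mor B (K : simplicial_cat C), v ** i = u.

Definition fibrant_replacement (K L : simplicial C) (j : simplicial_map K L) : Prop :=
  fibrant L /\ weak_equivalence j.

End HomotopySheaves.

(* An object with a binary operation.  Inverse image functors preserve the
   property of being a group object, whose laws are only required of the
   coefficients in the base topos. *)
Record operation (C : category) := Operation {
  car : C;
  sqr : C;
  pr1 : mor sqr car;
  pr2 : mor sqr car;
  mul : mor sqr car
}.

Definition operation_image (C D : category) (F : functor C D) (A : operation C) :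
    operation D :=
  Operation (fmor F (pr1 A)) (fmor F (pr2 A)) (fmor F (mul A)).

(* [c] is the product of the generalised elements [a] and [b]. *)
Definition is_mul (C : category) (A : operation C) (Z : C)
    (a b c : mor Z (car A)) : Prop :=
  exists u : mor Z (sqr A),
    [/\ pr1 A ** u = a, pr2 A ** u = b & mul A ** u = c].

(* [A] represents a presheaf of groups. *)
Definition group_object (C : category) (A : operation C) : Prop :=
  is_product (pr1 A) (pr2 A) /\
  forall Z : C,
    (forall a b c ab bc abc : mor Z (car A),
       is_mul a b ab -> is_mul b c bc -> is_mul a bc abc -> is_mul ab c abc) /\
    exists e : mor Z (car A), forall a,
      [/\ is_mul e a a, is_mul a e a & exists b, is_mul a b e /\ is_mul b a e].

Definition abelian (C : category) (A : operation C) : Prop :=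
  forall Z (a b c : mor Z (car A)), is_mul a b c -> is_mul b a c.

Definition is_K0 (C : category) (A : C) (K : simplicial C) : Prop :=
  [/\ fibrant K,
      exists eta : presheaf_map (pi0 K) A, is_sheafification eta
    & forall (Y : C) (x : mor Y (K 0)) (m : nat), trivial_sheaf (piS x m)].

(* [K] is a [K(A, m.+1)].  The isomorphism between [A] and the homotopy sheaf of
   degree [m.+1] at a global base point [x] is given as a map [eta] exhibiting
   [A] as the sheafification of the homotopy presheaf and preserving products. *)
Definition is_KS (C : category) (A : operation C) (m : nat) (K : simplicial C) :
    Prop :=
  [/\ fibrant K,
      trivial_sheaf (pi0 K),
      forall (Y : C) (x : mor Y (K 0)) (k : nat), k != m -> trivial_sheaf (piS x k)
    & exists (I : C) (x : mor I (K 0)) (t : mor (car A) I)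
             (eta : @presheaf_map (slice C I) (piS x m) (SliceOb t)),
        [/\ is_terminal I, is_sheafification eta
          & forall (Z : slice C I) k
              (a b c : exk k (sections (dom Z) K) m.+1) aP bP cP,
              spans (x ** str Z : sections (dom Z) K 0) a b c ->
              is_mul (under (eta Z (Sphere k a aP))) (under (eta Z (Sphere k c cP)))
                     (under (eta Z (Sphere k b bP)))]].

Section Pure.
Variables (F E T : category).

(* For [K] and [L] fibrant with [j : s r^* K -> L] a fibrant replacement, this
   says that the map in cohomology
     [pi_0 (s e_* K) -> pi_0 (s e_* (s r_* L))]
   satisfies [Q]. *)
Definition cohomology_map (e : geometric_morphism E T) (r : geometric_morphism F E)
    (Q : forall A B : T, mor A B -> Prop) (K : simplicial E) (L : simplicial F)
    (j : simplicial_map (sfun (inv r) K) L) : Prop :=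
  sheafified Q (@pi0_map T _ _ (sfun_map (dir e) (transpose j))).

End Pure.

Section PureT.
Variables (F E T : category) (e : geometric_morphism E T)
  (r : geometric_morphism F E).

Definition pure0 (Q : forall A B : T, mor A B -> Prop) : Prop :=
  forall (X : E) (eX : geometric_morphism (slice E X) T)
         (rX : geometric_morphism (slice F (inv r X)) (slice E X)),
    is_slice_structure e eX -> is_localisation rX ->
  forall (B : T) (K : simplicial (slice E X)) (L : simplicial (slice F (inv r X)))
         (j : simplicial_map (sfun (inv rX) K) L),
    is_K0 (inv eX B) K -> fibrant_replacement j -> cohomology_map eX Q j.

(* The condition for cohomology of degree [m.+1]. *)
Definition pureS (m : nat) : Prop :=
  forall (X : E) (eX : geometric_morphism (slice E X) T)
         (rX : geometric_morphism (slice F (inv r X)) (slice E X)),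
    is_slice_structure e eX -> is_localisation rX ->
  forall (B : operation T) (K : simplicial (slice E X))
         (L : simplicial (slice F (inv r X)))
         (j : simplicial_map (sfun (inv rX) K) L),
    group_object B -> (0 < m -> abelian B) ->
    is_KS (operation_image (inv eX) B) m K -> fibrant_replacement j ->
    cohomology_map eX (@is_iso T) j.

(* [r] is [n]-pure over [T]; [Negz 0] is -1. *)
Definition pure (n : int) : Prop :=
  match n with
  | Posz n => pure0 (@is_iso T) /\ forall m, m < n -> pureS m
  | Negz 0 => pure0 (@is_mono T)
  | Negz _.+1 => True
  end.

End PureT.

Section Dimension.
Variables (E T : category) (e : geometric_morphism E T).

Definition pure_mono (n : int) (V U : E) (i : mor V U) : Prop :=
  is_mono i /\
  forall (eU : geometric_morphism (slice E U) T)
         (r : geometric_morphism (slice E V) (slice E U)),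
    is_slice_structure e eU -> is_slice_change i r -> pure eU r n.

(* Subtoposes are given by their objects, as full replete subcategories. *)
Definition is_subtopos (S : E -> Prop) : Prop :=
  exists (D : category) (i : geometric_morphism D E),
    fully_faithful (dir i) /\
    forall X, S X <-> exists (Y : D) (h : mor (dir i Y) X), is_iso h.

(* The sheaves for the topology whose dense monomorphisms are the
   (n-1)-pure ones. *)
Definition E_le (n : int) (X : E) : Prop :=
  forall (V U : E) (i : mor V U), pure_mono (n - 1)%R i ->
  forall f : mor V X, exists! g : mor U X, g ** i = f.

(* The smallest subtopos containing all the [E_le n]. *)
Definition E_finite (X : E) : Prop :=
  forall S : E -> Prop, is_subtopos S ->
    (forall n : int, (-1 <= n)%R -> forall Y, E_le n Y -> S Y) -> S X.

Definition n_dimensional (n : int) : Prop :=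
  [/\ (-1 <= n)%R,
      (forall X, E_le n X <-> E_finite X)
    & forall m : int, (-1 <= m)%R -> (forall X, E_le m X <-> E_finite X) ->
        (n <= m)%R].

Definition without_boundary : Prop := forall X, E_finite X.

End Dimension.

Record opens (X : topologicalType) := Opens { oset :> set X; osetP : open oset }.

Definition opens_pred (X : topologicalType) (U : opens X) : X -> Prop := oset U.
Coercion opens_pred : opens >-> Funclass.

Record sheaf (X : topologicalType) := Sheaf {
  sec :> opens X -> Type;
  rst : forall U V : opens X, V `<=` U -> sec U -> sec V;
  rst_id : forall (U : opens X) (h : U `<=` U) s, rst h s = s;
  rst_rst : forall (U V W : opens X) (h : V `<=` U) (k : W `<=` V) (l : W `<=` U) s,
    rst k (rst h s) = rst l s;
  sheaf_glue : forall (U : opens X) (D : opens X -> Prop)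
      (s : forall V, D V -> sec V),
    (forall V, D V -> V `<=` U) ->
    (forall x, U x -> exists2 V, D V & V x) ->
    (forall V V' (dV : D V) (dV' : D V') (W : opens X)
       (h : W `<=` V) (h' : W `<=` V'), rst h (s V dV) = rst h' (s V' dV')) ->
    exists! t : sec U, forall V (dV : D V) (h : V `<=` U), rst h t = s V dV
}.
Arguments rst {X} s0 {U V}.

Record sheaf_map (X : topologicalType) (A B : sheaf X) := SheafMap {
  shf :> forall U, A U -> B U;
  shf_nat : forall (U V : opens X) (h : V `<=` U) (s : A U),
    rst B h (shf s) = shf (rst A h s)
}.

Lemma sheaf_mapP (X : topologicalType) (A B : sheaf X) (f g : sheaf_map A B) :
  (forall U (s : A U), f U s = g U s) -> f = g.
Proof.
case: f g => f fP [g gP] /= h.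
have e : f = g by apply: functional_extensionality_dep => U; apply/funext => s.
by case: g / e gP {h} => gP; rewrite (Prop_irrelevance fP gP).
Qed.

Definition Sh (X : topologicalType) : category.
Proof.
refine (@Category (sheaf X) (@sheaf_map X)
  (fun A => @SheafMap X A A (fun U s => s) (fun _ _ _ _ => erefl))
  (fun A B D g f => @SheafMap X A D (fun U s => g U (f U s)) _) _ _ _).
- by move=> A B f; apply: sheaf_mapP.
- by move=> A B f; apply: sheaf_mapP.
- by move=> A B D H h g f; apply: sheaf_mapP.
Unshelve.
by move=> U V h s; rewrite !shf_nat.
Defined.

Lemma sheaf_map_eq (X : topologicalType) (A B : Sh X) (m n : mor A B) (U : opens X)
  (s : (A : sheaf X) U) :
  m = n -> (m : sheaf_map A B) U s = (n : sheaf_map A B) U s.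
Proof. by move=> ->. Qed.

Section Glue.
Variables (X : topologicalType) (A : sheaf X) (U : opens X).

Lemma sheaf_local_glue (P : forall O : opens X, A O -> Prop) :
  (forall (O O' : opens X) (h : O' `<=` O) s, P O s -> P O' (rst A h s)) ->
  (forall (O : opens X) s t, P O s -> P O t -> s = t) ->
  (forall x, U x -> exists (O : opens X) s, [/\ O x, O `<=` U & P O s]) ->
  exists t : A U, forall (O : opens X) (h : O `<=` U) s, P O s -> rst A h t = s.
Proof.
move=> Pr Pu Pl.
pose D (O : opens X) := O `<=` U /\ exists s, P O s.
have ch O (d : D O) : {s | P O s} by apply: cid; case: d.
have [|||t [tP _]] := @sheaf_glue X A U D (fun O d => sval (ch O d)).
- by move=> V [].
- by move=> x /Pl[O [s [Ox OU Ps]]]; exists O => //; split=> //; exists s.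
- move=> V V' dV dV' W h h'; apply: Pu; apply: Pr.
    exact: (svalP (ch V dV)).
  exact: (svalP (ch V' dV')).
exists t => O h s Ps.
have d : D O by split=> //; exists s.
by rewrite (tP O d h); apply: Pu Ps; exact: (svalP (ch O d)).
Qed.

Lemma sheaf_separated (s t : A U) :
  (forall x, U x -> exists (O : opens X) (h : O `<=` U),
     O x /\ rst A h s = rst A h t) -> s = t.
Proof.
move=> st.
pose D (O : opens X) := exists h : O `<=` U, rst A h s = rst A h t.
have DU V : D V -> V `<=` U by case.
have [|||r [_ ru]] := @sheaf_glue X A U D (fun O d => rst A (DU O d) s).
- exact: DU.
- by move=> x /st[O [h [Ox e]]]; exists O => //; exists h.
- move=> V V' dV dV' W h h'.
  have WU : W `<=` U by move=> x /h; exact: DU.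
  by rewrite !(rst_rst _ _ WU).
have <- : r = s.
  by apply: ru => V dV h; rewrite (Prop_irrelevance h (DU V dV)).
apply: ru => V [h e] h'.
by rewrite (Prop_irrelevance h' h) -e; congr (rst A _ s); exact: Prop_irrelevance.
Qed.

End Glue.

Definition open_cap (X : topologicalType) (U V : opens X) : opens X :=
  @Opens X (U `&` V) (openI (osetP U) (osetP V)).

(* The subterminal sheaf represented by [V]. *)
Definition sheaf_of_open (X : topologicalType) (V : opens X) : sheaf X.
Proof.
refine (@Sheaf X (fun W => W `<=` V : Prop)
  (fun U W h k => subset_trans h k) _ _ _).
- by move=> *; exact: Prop_irrelevance.
- by move=> *; exact: Prop_irrelevance.
move=> U D s DU cov _.
have UV : U `<=` V by move=> x /cov[W dW Wx]; exact: (s W dW).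
exists UV; split; first by move=> *; exact: Prop_irrelevance.
by move=> *; exact: Prop_irrelevance.
Defined.

Definition sheaf_yoneda (X : topologicalType) (V : opens X) (A : sheaf X) (s : A V) :
  sheaf_map (sheaf_of_open V) A.
Proof.
refine (@SheafMap X (sheaf_of_open V) A (fun W h => rst A h s) _).
by move=> U W h k; exact: rst_rst.
Defined.

Lemma terminal_sheafP (X : topologicalType) (I : Sh X) (V : opens X) :
  is_terminal I -> exists! s : (I : sheaf X) V, True.
Proof.
move=> It; have [u [_ uu]] := It (sheaf_of_open V : Sh X).
exists ((u : sheaf_map _ _) V (@subset_refl _ V)); split=> // s _.
rewrite (uu (sheaf_yoneda s : @mor (Sh X) _ _)) //=.
exact: rst_id.
Qed.

Lemma pullback_sheafP (X : topologicalType) (A B E P : Sh X)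
  (f : mor A E) (g : mor B E) (p : mor P A) (q : mor P B) (V : opens X)
  (a : (A : sheaf X) V) (b : (B : sheaf X) V) :
  is_pullback f g p q -> (f : sheaf_map A E) V a = (g : sheaf_map B E) V b ->
  exists! s : (P : sheaf X) V,
    (p : sheaf_map P A) V s = a /\ (q : sheaf_map P B) V s = b.
Proof.
move=> [_ pb] ab.
have [|u [[pu qu] uu]] := pb (sheaf_of_open V : Sh X)
  (sheaf_yoneda a : @mor (Sh X) _ _) (sheaf_yoneda b : @mor (Sh X) _ _).
  by apply: sheaf_mapP => U h /=; rewrite -!shf_nat ab.
pose i := @subset_refl _ V.
exists ((u : sheaf_map _ _) V i); split.
  split.
  - by have /= -> := @sheaf_map_eq X (sheaf_of_open V) _ _ _ V i pu; exact: rst_id.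
  - by have /= -> := @sheaf_map_eq X (sheaf_of_open V) _ _ _ V i qu; exact: rst_id.
move=> s [ps qs].
rewrite (uu (sheaf_yoneda s : @mor (Sh X) _ _)) /=; first exact: rst_id.
by split; apply: sheaf_mapP => U h /=; rewrite -shf_nat ?ps ?qs.
Qed.

Section Germs.
Variables (Y : topologicalType) (B : sheaf Y).

Definition same_germ (y : Y) (V W : opens Y) (b : B V) (c : B W) : Prop :=
  exists (O : opens Y) (h : O `<=` V) (k : O `<=` W), O y /\ rst B h b = rst B k c.

(* A germ is the set of all sections inducing it. *)
Definition germ (y : Y) (V : opens Y) (b : B V) : set {W : opens Y & B W} :=
  [set c | same_germ y b (projT2 c)].

Lemma same_germ_refl y (V : opens Y) (b : B V) : V y -> same_germ y b b.
Proof. by move=> Vy; exists V, (@subset_refl _ V), (@subset_refl _ V). Qed.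

Lemma same_germ_sym y V W (b : B V) (c : B W) : same_germ y b c -> same_germ y c b.
Proof. by move=> [O [h [k [Oy e]]]]; exists O, k, h. Qed.

Lemma same_germ_trans y U V W (a : B U) (b : B V) (c : B W) :
  same_germ y a b -> same_germ y b c -> same_germ y a c.
Proof.
move=> [O [h [k [Oy e]]]] [O' [h' [k' [Oy' e']]]].
have l : open_cap O O' `<=` O by move=> x [].
have l' : open_cap O O' `<=` O' by move=> x [].
exists (open_cap O O'), (subset_trans l h), (subset_trans l' k'); split=> //.
rewrite -(rst_rst h l) e (rst_rst k l (subset_trans l k)).
rewrite -(rst_rst k' l') -e' (rst_rst h' l' (subset_trans l' h')).
by congr (rst B _ b); exact: Prop_irrelevance.
Qed.

Lemma germP y (V W : opens Y) (b : B V) (c : B W) :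
  W y -> germ y b = germ y c <-> same_germ y b c.
Proof.
move=> Wy; split=> [e|bc].
  have : germ y c (existT _ W c) by exact: same_germ_refl.
  by rewrite -e.
apply/seteqP; split=> d; rewrite /germ /=; last exact: same_germ_trans.
by apply: same_germ_trans; exact: same_germ_sym.
Qed.

Lemma germ_rst y (V W : opens Y) (h : W `<=` V) (b : B V) : W y -> germ y (rst B h b) = germ y b.
Proof.
move=> Wy; apply/germP; first exact: h.
by exists W, (@subset_refl _ W), h; split=> //; exact: rst_id.
Qed.

End Germs.

Lemma same_germ_map (Y : topologicalType) (A B : sheaf Y) (f : sheaf_map A B) y
  V W (b : A V) (c : A W) :
  same_germ y b c -> same_germ y (f V b) (f W c).
Proof. by move=> [O [h [k [Oy e]]]]; exists O, h, k; rewrite !shf_nat e. Qed.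

Definition germ_map (Y : topologicalType) (A B : sheaf Y) (f : sheaf_map A B) y
    (g : set {W : opens Y & A W}) : set {W : opens Y & B W} :=
  [set c | exists2 b, g b & same_germ y (f _ (projT2 b)) (projT2 c)].

Lemma germ_mapE (Y : topologicalType) (A B : sheaf Y) (f : sheaf_map A B) y
  (V : opens Y) (b : A V) : V y -> germ_map f y (germ y b) = germ y (f V b).
Proof.
move=> Vy; apply/seteqP; split=> [c [d bd dc]|c bc].
  by apply: same_germ_trans dc; exact: same_germ_map.
by exists (existT _ V b) => //; exact: same_germ_refl.
Qed.

Section Induced.
Variables (X Y : topologicalType) (f : X -> Y) (cf : continuous f).

Definition preim (V : opens Y) : opens X :=
  @Opens X (f @^-1` V) (open_comp (fun x _ => @cf x) (osetP V)).

Definition preim_sub (V W : opens Y) (h : W `<=` V) : preim W `<=` preim V :=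
  fun x => h (f x).

Definition push_ob (A : sheaf X) : sheaf Y.
Proof.
refine (@Sheaf Y (fun V => A (preim V)) (fun V W h => rst A (preim_sub h)) _ _ _).
- by move=> *; exact: rst_id.
- by move=> *; exact: rst_rst.
move=> U D s DU cov comp.
have Pr : forall (O O' : opens X) (h : O' `<=` O) s0,
   (exists V (d : D V) (k : O `<=` preim V), s0 = rst A k (s V d)) ->
   (exists V (d : D V) (k : O' `<=` preim V), rst A h s0 = rst A k (s V d)).
  move=> O O' h _ [V [d [k ->]]]; exists V, d, (subset_trans h k).
  exact: rst_rst.
have [||t tP] := sheaf_local_glue (U := preim U) Pr.
- move=> O _ _ [V [d [k ->]]] [V' [d' [k' ->]]].
  have h : open_cap V V' `<=` V by move=> x [].
  have h' : open_cap V V' `<=` V' by move=> x [].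
  have l : O `<=` preim (open_cap V V') by move=> x Ox; split; [exact: k|exact: k'].
  by have /(congr1 (rst A l)) := comp V V' d d' _ h h'; rewrite !(rst_rst _ _ k, rst_rst _ _ k').
- move=> x Ux; have [V d Vx] := cov _ Ux.
  exists (preim V), (s V d); split=> //; first exact: preim_sub (DU V d).
  by exists V, d, (@subset_refl _ _); rewrite rst_id.
exists t; split.
  move=> V d h; apply: tP; exists V, d, (@subset_refl _ _); by rewrite rst_id.
move=> t' t'P; apply: sheaf_separated => x Ux; have [V d Vx] := cov _ Ux.
exists (preim V), (preim_sub (DU V d)); split=> //.
rewrite t'P; apply: tP; exists V, d, (@subset_refl _ _); by rewrite rst_id.
Defined.

Definition push_map (A B : sheaf X) (m : sheaf_map A B) :
  sheaf_map (push_ob A) (push_ob B) :=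
  @SheafMap Y (push_ob A) (push_ob B) (fun V s => m (preim V) s)
    (fun V W h s => shf_nat m (preim_sub h) s).

Definition push : functor (Sh X) (Sh Y).
Proof.
by refine (@Functor (Sh X) (Sh Y) push_ob push_map _ _) => *; apply: sheaf_mapP.
Defined.

(* Sections over [U] of the inverse image of [B]: families of germs of [B] at the
   points [f x], for [x] in [U], which locally come from a section of [B]. *)
Record pull_sec (B : sheaf Y) (U : opens X) := PullSec {
  pval : forall x, U x -> set {W : opens Y & B W};
  pvalP : forall x, U x -> exists (V : opens Y) (b : B V) (O : opens X),
    [/\ O x, O `<=` preim V & forall z (Uz : U z), O z -> pval Uz = germ (f z) b]
}.

Lemma pull_secP (B : sheaf Y) (U : opens X) (s t : pull_sec B U) :
  (forall x (Ux : U x), pval s Ux = pval t Ux) -> s = t.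
Proof.
case: s t => s sP [t tP] /= h.
have e : s = t by apply: functional_extensionality_dep => x; apply/funext => Ux.
by case: t / e tP {h} => tP; rewrite (Prop_irrelevance sP tP).
Qed.

Definition pull_rst (B : sheaf Y) (U V : opens X) (h : V `<=` U) (s : pull_sec B U) :
  pull_sec B V.
Proof.
refine (@PullSec B V (fun x Vx => pval s (h x Vx)) _).
move=> x Vx; have [W [b [O [Ox OW e]]]] := pvalP s (h x Vx).
by exists W, b, O; split=> // z Vz; exact: e.
Defined.

Definition pull_ob (B : sheaf Y) : sheaf X.
Proof.
refine (@Sheaf X (pull_sec B) (@pull_rst B) _ _ _).
- move=> U h s; apply: pull_secP => x Ux /=; congr pval; exact: Prop_irrelevance.
- move=> U V W h k l s; apply: pull_secP => x Ux /=; congr pval.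
  exact: Prop_irrelevance.
move=> U D s DU cov comp.
have comp' V V' (d : D V) (d' : D V') x (Vx : V x) (V'x : V' x) :
    pval (s V d) Vx = pval (s V' d') V'x.
  have h : open_cap V V' `<=` V by move=> z [].
  have h' : open_cap V V' `<=` V' by move=> z [].
  have /(congr1 (fun t => pval t (conj Vx V'x : open_cap V V' x))) /= e :=
    comp V V' d d' _ h h'.
  by apply: (etrans (etrans _ e)); congr pval; exact: Prop_irrelevance.
pose v x (Ux : U x) : set {W : opens Y & B W} :=
  [set c | exists V (d : D V) (Vx : V x), pval (s V d) Vx c].
have vE V (d : D V) x (Ux : U x) (Vx : V x) : v x Ux = pval (s V d) Vx.
  apply/seteqP; split=> [c [V' [d' [V'x]]]|c sc]; last by exists V, d, Vx.
  by rewrite (comp' V' V d' d x V'x Vx).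
have vP x : U x -> exists (V : opens Y) (b : B V) (O : opens X),
    [/\ O x, O `<=` preim V & forall z (Uz : U z), O z -> v z Uz = germ (f z) b].
  move=> Ux; have [V d Vx] := cov x Ux.
  have [W [b [O [Ox OW e]]]] := pvalP (s V d) Vx.
  exists W, b, (open_cap O V); split=> //; first by move=> z [/OW].
  by move=> z Uz [Oz Vz]; rewrite (vE V d z Uz Vz) e.
exists (PullSec vP); split.
  by move=> V d h; apply: pull_secP => x Vx /=; exact: vE.
move=> t tP; apply: pull_secP => x Ux /=; have [V d Vx] := cov x Ux.
rewrite (vE V d x Ux Vx) -(tP V d (DU V d)) /=; congr pval.
exact: Prop_irrelevance.
Defined.

Lemma pull_fun_subproof (A B : sheaf Y) (m : sheaf_map A B) (U : opens X)
  (s : pull_sec A U) x : U x -> exists (V : opens Y) (b : B V) (O : opens X),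
  [/\ O x, O `<=` preim V &
      forall z (Uz : U z), O z -> germ_map m (f z) (pval s Uz) = germ (f z) b].
Proof.
move=> Ux; have [V [b [O [Ox OV e]]]] := pvalP s Ux.
exists V, (m V b), O; split=> // z Uz Oz.
by rewrite e // germ_mapE //; exact: OV.
Qed.

Definition pull_fun (A B : sheaf Y) (m : sheaf_map A B) (U : opens X)
  (s : pull_sec A U) : pull_sec B U := PullSec (pull_fun_subproof m s).

Definition pull_map (A B : sheaf Y) (m : sheaf_map A B) :
  sheaf_map (pull_ob A) (pull_ob B).
Proof.
refine (@SheafMap X (pull_ob A) (pull_ob B) (pull_fun m) _).
by move=> U V h s; apply: pull_secP.
Defined.

Definition pull : functor (Sh Y) (Sh X).
Proof.
refine (@Functor (Sh Y) (Sh X) pull_ob pull_map _ _).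
- move=> A; apply: sheaf_mapP => U s; apply: pull_secP => x Ux /=.
  have [V [b [O [Ox OV e]]]] := pvalP s Ux; rewrite e //.
  by rewrite germ_mapE //; exact: OV.
- move=> A B D g h; apply: sheaf_mapP => U s; apply: pull_secP => x Ux /=.
  have [V [b [O [Ox OV e]]]] := pvalP s Ux; have Vx : V (f x) := OV _ Ox.
  by rewrite e // !germ_mapE.
Defined.

Lemma pull_lex : left_exact pull.
Proof.
split.
  move=> I It Z.
  have [c [_ _]] := terminal_sheafP (@Opens Y setT openT) It.
  have gu y V (b : (I : sheaf Y) V) : V y -> germ y b = germ y c.
    move=> Vy; apply/germP => //.
    have h : V `<=` @Opens Y setT openT by [].
    exists V, (@subset_refl _ V), h; split=> //.
    have [d [_ du]] := terminal_sheafP V It.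
    by rewrite -(du (rst _ h c)) // -(du (rst _ _ b)).
  have su (U : opens X) (s t : pull_sec I U) : s = t.
    apply: pull_secP => x Ux.
    have [V [b [O [Ox OV ->]]]] := pvalP s Ux; rewrite //.
    have [V' [b' [O' [Ox' OV' ->]]]] := pvalP t Ux; rewrite //.
    by rewrite (gu _ _ b (OV _ Ox)) (gu _ _ b' (OV' _ Ox')).
  have cP (U : opens X) x : U x ->
      exists (V : opens Y) (b : (I : sheaf Y) V) (O : opens X),
      [/\ O x, O `<=` preim V & forall z (Uz : U z), O z -> germ (f z) c = germ (f z) b].
    by move=> Ux; exists (@Opens Y setT openT), c, U.
  have nat (U V : opens X) (h : V `<=` U) (s : (Z : sheaf X) U) :
      rst (pull_ob I) h (PullSec (cP U)) = PullSec (cP V) by exact: su.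
  exists (@SheafMap X Z (pull_ob I) (fun U _ => PullSec (cP U)) nat).
  by split=> // u _; apply: sheaf_mapP => U s; exact: su.
move=> A B E P a b p q pb.
split; first by rewrite -!fmorM pb.1.
have pbE (V : opens Y) (s : (P : sheaf Y) V) :
    (a : sheaf_map A E) V ((p : sheaf_map P A) V s) =
    (b : sheaf_map B E) V ((q : sheaf_map P B) V s).
  by have := sheaf_map_eq s pb.1.
have inj y (V W : opens Y) (s : (P : sheaf Y) V) (t : (P : sheaf Y) W) :
    V y -> W y ->
    germ y ((p : sheaf_map P A) V s) = germ y ((p : sheaf_map P A) W t) ->
    germ y ((q : sheaf_map P B) V s) = germ y ((q : sheaf_map P B) W t) ->
    germ y s = germ y t.
  move=> Vy Wy /germP -/(_ Wy) [O [h [k [Oy e]]]].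
  move=> /germP -/(_ Wy) [O' [h' [k' [Oy' e']]]].
  apply/germP => //.
  have l : open_cap O O' `<=` O by move=> x [].
  have l' : open_cap O O' `<=` O' by move=> x [].
  have lV := subset_trans l h; have lW := subset_trans l k.
  exists (open_cap O O'), lV, lW; split=> //.
  have [r [_ ru]] := pullback_sheafP pb (pbE _ (rst P lV s)).
  rewrite -(ru (rst P lV s)) // -(ru (rst P lW t)) //; split.
  - rewrite -!shf_nat; move/(congr1 (rst A l)) : e.
    by rewrite !(rst_rst _ _ lV, rst_rst _ _ lW).
  - rewrite -!shf_nat; move/(congr1 (rst B l')) : e'.
    by rewrite !(rst_rst _ _ lV, rst_rst _ _ lW).
have surj (U : opens X) (s : pull_sec A U) (t : pull_sec B U) :
    (forall x (Ux : U x), germ_map a (f x) (pval s Ux) = germ_map b (f x) (pval t Ux)) ->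
    forall x, U x -> exists (V : opens Y) (r : (P : sheaf Y) V) (O : opens X),
    [/\ O x, O `<=` preim V & forall z (Uz : U z), O z ->
        pval s Uz = germ (f z) ((p : sheaf_map P A) V r) /\
        pval t Uz = germ (f z) ((q : sheaf_map P B) V r)].
  move=> st x Ux.
  have [V [c [O [Ox OV e]]]] := pvalP s Ux.
  have [V' [c' [O' [Ox' OV' e']]]] := pvalP t Ux.
  have := st x Ux; rewrite e // e' // !germ_mapE; [|exact: OV'|exact: OV].
  move=> /germP -/(_ (OV' _ Ox')) [W [h [h' [Wx]]]]; rewrite !shf_nat => ew.
  have [r [[rp rq] _]] := pullback_sheafP pb ew.
  exists W, r, (open_cap (open_cap O O') (preim W)); split=> //.
    by move=> z [].
  move=> z Uz [[Oz O'z] Wz]; rewrite rp rq !germ_rst //.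
  by rewrite e // e'.
move=> Z u v uv.
have uvE (U : opens X) (z : (Z : sheaf X) U) x (Ux : U x) :
    germ_map a (f x) (pval ((u : sheaf_map Z (pull_ob A)) U z) Ux) =
    germ_map b (f x) (pval ((v : sheaf_map Z (pull_ob B)) U z) Ux).
  by have /(congr1 (fun t : pull_sec E U => pval t Ux)) := sheaf_map_eq z uv.
pose w (U : opens X) (z : (Z : sheaf X) U) x (Ux : U x) :
    set {W : opens Y & (P : sheaf Y) W} :=
  [set c | exists (V : opens Y) (r : (P : sheaf Y) V),
    [/\ V (f x),
        pval ((u : sheaf_map Z (pull_ob A)) U z) Ux =
          germ (f x) ((p : sheaf_map P A) V r),
        pval ((v : sheaf_map Z (pull_ob B)) U z) Ux =
          germ (f x) ((q : sheaf_map P B) V r) & germ (f x) r c]].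
have wE (U : opens X) (z : (Z : sheaf X) U) x (Ux : U x) (V : opens Y)
    (r : (P : sheaf Y) V) : V (f x) ->
    pval ((u : sheaf_map Z (pull_ob A)) U z) Ux =
      germ (f x) ((p : sheaf_map P A) V r) ->
    pval ((v : sheaf_map Z (pull_ob B)) U z) Ux =
      germ (f x) ((q : sheaf_map P B) V r) -> w U z x Ux = germ (f x) r.
  move=> Vx ur vr; apply/seteqP; split=> [c [V' [r' [V'x ur' vr']]]|c rc].
    by rewrite (inj (f x) V' V r' r) // -?ur' -?vr'.
  by exists V, r.
have wP (U : opens X) (z : (Z : sheaf X) U) x : U x ->
    exists (V : opens Y) (r : (P : sheaf Y) V) (O : opens X),
    [/\ O x, O `<=` preim V & forall y (Uy : U y), O y -> w U z y Uy = germ (f y) r].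
  move=> Ux; have [V [r [O [Ox OV e]]]] := surj U _ _ (uvE U z) x Ux.
  exists V, r, O; split=> // y Uy Oy; have [e1 e2] := e y Uy Oy.
  by apply: wE => //; exact: OV.
have wn (U V : opens X) (h : V `<=` U) (z : (Z : sheaf X) U) :
    rst (pull_ob P) h (PullSec (wP U z)) = PullSec (wP V (rst Z h z)).
  apply: pull_secP => x Vx /=.
  have [V' [r [O [Ox OV e]]]] := surj U _ _ (uvE U z) x (h x Vx).
  have [e1 e2] := e x (h x Vx) Ox.
  rewrite (wE U z x (h x Vx) V' r (OV _ Ox) e1 e2); apply/esym.
  by apply: wE; [exact: OV|rewrite -shf_nat|rewrite -shf_nat].
exists (@SheafMap X Z (pull_ob P) (fun U z => PullSec (wP U z)) wn).
split.
  split; apply: sheaf_mapP => U z; apply: pull_secP => x Ux /=;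
    have [V [r [O [Ox OV e]]]] := surj U _ _ (uvE U z) x Ux;
    have [e1 e2] := e x Ux Ox; have Vx := OV _ Ox.
  - by rewrite (wE U z x Ux V r) // germ_mapE // e1.
  - by rewrite (wE U z x Ux V r) // germ_mapE // e2.
move=> w' [pw qw]; apply: sheaf_mapP => U z; apply: pull_secP => x Ux /=.
have [V [r [O [Ox OV e]]]] := pvalP ((w' : sheaf_map Z (pull_ob P)) U z) Ux.
have Vx := OV _ Ox; rewrite e //; apply: wE => //.
- have /(congr1 (fun t : pull_sec A U => pval t Ux)) /= <- := sheaf_map_eq z pw.
  by rewrite e // germ_mapE.
- have /(congr1 (fun t : pull_sec B U => pval t Ux)) /= <- := sheaf_map_eq z qw.
  by rewrite e // germ_mapE.
Qed.

Lemma pull_unit_subproof (B : sheaf Y) (V : opens Y) (b : B V) x : preim V x ->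
  exists (W : opens Y) (c : B W) (O : opens X),
  [/\ O x, O `<=` preim W &
      forall z (Vz : preim V z), O z -> germ (f z) b = germ (f z) c].
Proof. by move=> Vx; exists V, b, (preim V); split. Qed.

Definition pull_unit (B : sheaf Y) : sheaf_map B (push_ob (pull_ob B)).
Proof.
refine (@SheafMap Y B (push_ob (pull_ob B))
  (fun V b => PullSec (pull_unit_subproof b)) _).
by move=> V W h b; apply: pull_secP => x Wx /=; rewrite germ_rst.
Defined.

Lemma pull_unit_univ (B : Sh Y) (A : Sh X) (m : mor B (push A)) :
  exists! g : mor (pull B) A, fmor push g ** (pull_unit B : @mor (Sh Y) B _) = m.
Proof.
have key (O : opens X) (V W : opens Y) (b : (B : sheaf Y) V) (c : (B : sheaf Y) W)
    (h : O `<=` preim V) (k : O `<=` preim W) :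
    (forall x, O x -> germ (f x) b = germ (f x) c) ->
    rst A h ((m : sheaf_map B (push_ob A)) V b) =
    rst A k ((m : sheaf_map B (push_ob A)) W c).
  move=> bc; apply: sheaf_separated => x Ox.
  have /germP -/(_ (k x Ox)) [Q [l [l' [Qx e]]]] := bc x Ox.
  have i : open_cap O (preim Q) `<=` O by move=> z [].
  have i' : open_cap O (preim Q) `<=` preim Q by move=> z [].
  exists (open_cap O (preim Q)), i; split=> //.
  have hh := subset_trans i h; have kk := subset_trans i k.
  rewrite (rst_rst h i hh) (rst_rst k i kk).
  rewrite -(rst_rst (preim_sub l) i' hh) -(rst_rst (preim_sub l') i' kk).
  congr (rst A i' _).
  by have := shf_nat (m : sheaf_map B (push_ob A)) l b; rewrite e -shf_nat.
pose P (U : opens X) (s : pull_sec B U) (O : opens X) (t : (A : sheaf X) O) :=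
  exists (V : opens Y) (b : (B : sheaf Y) V) (h : O `<=` preim V),
    (forall x (Ux : U x), O x -> pval s Ux = germ (f x) b) /\
    t = rst A h ((m : sheaf_map B (push_ob A)) V b).
have ex U (s : pull_sec B U) : exists t : (A : sheaf X) U,
    forall (O : opens X) (h : O `<=` U) r, P U s O r -> rst A h t = r.
  have [|||t tP] := @sheaf_local_glue X A U (fun O r => O `<=` U /\ P U s O r).
  - move=> O O' h _ [OU [V [b [k [sb ->]]]]]; split; first exact: subset_trans OU.
    exists V, b, (subset_trans h k); split; last exact: rst_rst.
    by move=> x Ux /h; exact: sb.
  - move=> O _ _ [OU [V [b [k [sb ->]]]]] [_ [W [c [k' [sc ->]]]]].
    by apply: key => x Ox; rewrite -(sb x (OU x Ox)) // -(sc x (OU x Ox)).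
  - move=> x Ux; have [V [b [O [Ox OV e]]]] := pvalP s Ux.
    have i : open_cap O U `<=` preim V by move=> z [/OV].
    exists (open_cap O U), (rst A i ((m : sheaf_map B (push_ob A)) V b)).
    split=> //; first by move=> z [].
    split; first by move=> z [].
    by exists V, b, i; split=> // z Uz [Oz _]; exact: e.
  by exists t => O h r Pr; exact: tP.
pose g U s := sval (cid (ex U s)).
have gP (U : opens X) s : forall (O : opens X) (h : O `<=` U) r, P U s O r -> rst A h (g U s) = r.
  exact: (svalP (cid (ex U s))).
have gn (U V : opens X) (h : V `<=` U) (s : pull_sec B U) :
    rst A h (g U s) = g V (pull_rst h s).
  apply: sheaf_separated => x Vx.
  have [W [b [O [Ox OW e]]]] := pvalP s (h x Vx).
  have i : open_cap O V `<=` V by move=> z [].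
  have j : open_cap O V `<=` preim W by move=> z [/OW].
  exists (open_cap O V), i; split=> //.
  rewrite (rst_rst h i (subset_trans i h)).
  rewrite (gP _ _ _ _ (rst A j ((m : sheaf_map B (push_ob A)) W b))); last first.
    by exists W, b, j; split=> // z Uz [Oz _]; exact: e.
  rewrite (gP _ _ _ _ (rst A j ((m : sheaf_map B (push_ob A)) W b))) //.
  by exists W, b, j; split=> // z Uz [Oz _] /=; exact: e.
exists (@SheafMap X (pull_ob B) A g gn); split.
  apply: sheaf_mapP => V b /=.
  rewrite -[LHS](rst_id (@subset_refl _ (preim V))); apply: gP.
  by exists V, b, (@subset_refl _ _); rewrite rst_id.
move=> g' g'm; apply: sheaf_mapP => U s /=; apply: sheaf_separated => x Ux.
have [V [b [O [Ox OV e]]]] := pvalP s Ux.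
have i : open_cap O U `<=` U by move=> z [].
have j : open_cap O U `<=` preim V by move=> z [/OV].
exists (open_cap O U), i; split=> //.
rewrite (gP _ _ _ _ (rst A j ((m : sheaf_map B (push_ob A)) V b))); last first.
  by exists V, b, j; split=> // z Uz [Oz _]; exact: e.
have /= <- := sheaf_map_eq b g'm.
rewrite !(shf_nat (g' : sheaf_map (pull_ob B) A)); congr (shf _ _).
by apply: pull_secP => z [Oz Uz] /=; rewrite -(e _ (i z (conj Oz Uz))).
Qed.

Definition Sh_map : geometric_morphism (Sh X) (Sh Y).
Proof.
refine (@GeometricMorphism (Sh X) (Sh Y) pull push pull_lex pull_unit _ pull_unit_univ).
move=> A B m; apply: sheaf_mapP => V b; apply: pull_secP => x Vx /=.
by rewrite germ_mapE.
Defined.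

End Induced.

(* Main.v *)
Require Import Defs.
From mathcomp Require Import all_boot all_order all_algebra.
From mathcomp Require Import all_classical all_reals topology normedtype.
From mathcomp Require Import zify.

Import numFieldNormedType.Exports.

(** The theorem reduces to two facts about monomorphisms of sheaves on the plane.  Every
   0-pure one is an isomorphism, so that the subtopos in degree 1 is everything and
   there is no boundary ([pure_surjective]).  The inclusion of the complement of a line
   transverse to the fibres of the projection is (-1)-pure without being an
   isomorphism, so that the subtoposes in degrees -1 and 0 are proper
   ([off_axis_pure]).

   In degree 0, cohomology with coefficients in [B] is about maps to [e^* B], which
   leads to two general statements: if a monomorphism is 0-pure, then the
   inverse images [e^* B] are sheaves for all its pullbacks ([pure_orthogonal]); if
   they are separated for all its pullbacks, then it is (-1)-pure ([separated_pure]).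

   The first one evaluates the definition of purity at constant simplicial objects,
   which are models of [K(A, 0)]; it requires the geometric morphisms between slices
   of the definition to exist, hence dependent products of sheaves.  The second one
   has to deal with an arbitrary [K(A, 0)].  The point is that two vertices of a
   fibrant [K(A, 0)] with the same image in [A] are joined by a global edge
   ([fibrant_edge]): [K] is a retract of a large simplicial object, its envelope, in
   which this is clear.  That the inclusion in the envelope is a weak equivalence rests
   on a notion of contraction of simplicial sets which passes to Kan's functor Ex
   ([ex_cone]) and makes the spheres in all its iterates null ([cone_null]).

   On the plane, sections of an inverse image along the projection [p] are locally
   constant on the fibres of [p].  Hence they are determined on a fibrewise dense open,
   such as the complement of a transverse line ([pull_dense]).  On the other hand, removing
   a point disconnects a fibre, so a section of the inverse image of a skyscraper may
   jump there, and cannot be extended; therefore an open from which all sections of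
   all inverse images extend uniquely misses no point ([extension_point]). *)

Set Implicit Arguments.
Unset Strict Implicit.
Unset Printing Implicit Defensive.

Local Open Scope classical_set_scope.
Local Open Scope cat_scope.
Local Notation inv := Defs.inv.

(** * Simplicial sets with cone contractions *)

Definition vertex n (i : 'I_n.+1) : delta 0 n :=
  @Delta 0 n (fun=> i) (fun _ _ _ => leqnn i).

Definition const_at (S : sset) (x : S 0) n : S n := smor S (collapse n) x.

Lemma sset_smorM (S : sset) p n m (g : delta n m) (f : delta p n) (s : S m) :
  smor S (delta_cmp g f) s = smor S f (smor S g s).
Proof. exact: (congr1 (@^~ s) (smorM S g f)). Qed.

Lemma sset_smor1 (S : sset) n (s : S n) : smor S (delta_id n) s = s.
Proof. exact: (congr1 (@^~ s) (smor1 S n)). Qed.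

Lemma sset_smap (S T : sset) (f : sset_map S T) p n (t : delta p n) (s : S n) :
  smor T t (f n s) = f p (smor S t s).
Proof. exact: (congr1 (@^~ s) (smap_nat f t)). Qed.

Lemma smor_const_at (S : sset) (x : S 0) p n (f : delta p n) :
  smor S f (const_at x n) = const_at x p.
Proof. by rewrite /const_at -sset_smorM; congr (smor S _ x); apply: delta_eq. Qed.

(** The simplex [J p t s] is to be thought of as obtained from [s] by moving its
   vertices where [t] is 1 to a chosen vertex of its component, which is [x] on the
   component of [x].  The last two clauses express that it depends on [s] only through
   the face where [t] is 0, or only through the component of [s] if that face is
   empty.  Unlike an extra degeneracy, this structure passes to Kan's functor Ex. *)
Definition cone_contraction (S : sset) (x : S 0)
    (J : forall p, delta p 1 -> S p -> S p) : Prop :=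
  [/\ forall p q (f : delta q p) (t : delta p 1) (s : S p),
        smor S f (J p t s) = J q (delta_cmp t f) (smor S f s),
      forall p (t : delta p 1) s, (forall i, t i = ord0) -> J p t s = s,
      forall p (t : delta p 1), J p t (const_at x p) = const_at x p,
      forall p (t : delta p 1) (r : delta p p) s,
        (forall i, t i = ord0 -> r i = i) -> t ord0 = ord0 ->
        J p t (smor S r s) = J p t s
    & forall p n (t : delta p 1) (f g : delta p n) (s : S n),
        (forall i, t i = ord_max) -> J p t (smor S f s) = J p t (smor S g s)].

Lemma ord2P (i : 'I_2) : i = ord0 \/ i = ord_max.
Proof. by case: i => [[|[|//]] h]; [left|right]; apply: val_inj. Qed.

Definition ex_app (S : sset) n (c : ex S n) p (A : chain n p) : S p :=
  @smap TypeCat (sd n) S c p A.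
Arguments ex_app {S n} c p A.

Lemma ex_appP (S : sset) n (c d : ex S n) :
  (forall p A, ex_app c p A = ex_app d p A) -> c = d.
Proof.
by move=> h; apply: simplicial_mapP => p; apply/funext => A; exact: h.
Qed.

Lemma ex_app_res (S : sset) n (c : ex S n) p q (f : delta q p) (A : chain n p) :
  smor S f (ex_app c p A) = ex_app c q (chain_res f A).
Proof. exact: (@sset_smap (sd n) S c). Qed.

Lemma ex_app_smor (S : sset) n m (f : delta n m) (c : ex S m) p (A : chain n p) :
  ex_app (smor (ex S) f c) p A = ex_app c p (chain_push f A).
Proof. by []. Qed.

Section ExCone.
Variables (S : sset) (x : S 0) (J : forall p, delta p 1 -> S p -> S p).
Hypothesis JP : cone_contraction x J.

Definition extend_chain n q (c : chain n q) (i : 'I_q.+2) : {set 'I_n.+1} :=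
  if insub (i : nat) is Some k then c k else [set: 'I_n.+1]%SET.

Lemma extend_chain_sub n q (c : chain n q) (i j : 'I_q.+2) : i <= j ->
  extend_chain c i \subset extend_chain c j.
Proof.
move=> ij; rewrite /extend_chain.
case: insubP => [k kq kE|ni]; case: insubP => [l lq lE|nj].
- by apply: chain_sub; rewrite kE lE.
- exact: finset.subsetT.
- by rewrite -leqNgt in ni; have := leq_trans lq ni; rewrite ltnNge ij.
- exact: subxx.
Qed.

Lemma extend_chain_neq0 n q (c : chain n q) (i : 'I_q.+2) :
  extend_chain c i != finset.set0.
Proof.
rewrite /extend_chain; case: insubP => [k _ _|_]; first exact: chain_neq0.
by apply/set0Pn; exists ord0; rewrite finset.in_setT.
Qed.

Definition chain_full n q (c : chain n q) : chain n q.+1 :=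
  Chain (extend_chain_neq0 c) (@extend_chain_sub n q c).

Definition chain_top n q : chain n q.
Proof.
apply: (@Chain n q (fun _ => [set: 'I_n.+1]%SET)); last by [].
by move=> i; apply/set0Pn; exists ord0; rewrite finset.in_setT.
Defined.

(** Every chain lies in the same component of the subdivision as the chain which
   is constant at the full set. *)
Lemma cone_chain_top n (c : ex S n) m (t : delta m 1) (B : chain n m) :
  (forall i, t i = ord_max) ->
  J t (ex_app c m B) = J t (ex_app c m (chain_top n m)).
Proof.
have [_ _ _ _ Jc] := JP => t1.
have -> : ex_app c m B =
    smor S (coface ord_max) (ex_app c _ (chain_full B)).
  rewrite ex_app_res; congr (ex_app _ _ _); apply: chain_eq => i /=.
  rewrite /extend_chain /= /bump leqNgt ltn_ord add0n.
  by case: insubP => [k _ kE|]; [congr (B _); apply: val_inj|rewrite ltn_ord].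
have -> : ex_app c m (chain_top n m) =
    smor S (delta_cmp (vertex ord_max) (collapse m))
      (ex_app c _ (chain_full B)).
  rewrite ex_app_res; congr (ex_app _ _ _); apply: chain_eq => i /=.
  by rewrite /extend_chain; case: insubP => [k km kE|//]; rewrite ltnn in km.
exact: Jc.
Qed.

(** A vertex of the subdivision, i.e. a set of vertices, is moved to the cone point
   as soon as one of its elements is; this is what composing [t] with the last
   vertex map expresses. *)
Definition ex_cone_fun p (t : delta p 1) (c : ex S p) : ex S p.
Proof.
refine (@SimplicialMap TypeCat (sd p) S
  (fun q (A : chain p q) => J (chain_last (chain_push t A))
     (ex_app c q A)) _) => q q' f.
apply/funext => A /=; have [Jn _ _ _ _] := JP.
rewrite Jn; congr (J _ _); first by apply: delta_eq.
exact: ex_app_res.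
Defined.

Lemma ex_coneE p (t : delta p 1) (c : ex S p) q (A : chain p q) :
  ex_app (ex_cone_fun t c) q A = J (chain_last (chain_push t A)) (ex_app c q A).
Proof. by []. Qed.

Lemma ex_cone : cone_contraction (to_ex S 0 x) ex_cone_fun.
Proof.
have [Jn J0 Jx Jr Jc] := JP.
split.
- move=> p q f t c; apply: ex_appP => m A; rewrite !(ex_coneE, ex_app_smor).
  congr (J _ _); apply: delta_eq => i /=.
  by rewrite -imset_comp.
- move=> p t c t0; apply: ex_appP => m A; rewrite !(ex_coneE, ex_app_smor).
  by rewrite J0 // => i /=; rewrite last_vertex_push ?chain_neq0 // t0.
- move=> p t; apply: ex_appP => m A; rewrite !(ex_coneE, ex_app_smor).
  have -> : @ex_app S 0 (to_ex S 0 x) m (chain_push (collapse p) A) = const_at x m.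
    rewrite /ex_app /=.
    by congr (smor S _ x); apply: delta_eq => i; rewrite [LHS]ord1 [RHS]ord1.
  exact: Jx.
- move=> p t r c rt t00; apply: ex_appP => m A; rewrite !(ex_coneE, ex_app_smor).
  set t' := chain_last _.
  have rA i : t' i = ord0 -> [set r y | y in A i]%SET = A i.
    move=> ti; rewrite -[RHS]imset_id; apply: eq_in_imset => y yA; apply: rt.
    apply: val_inj; apply/eqP; rewrite -leqn0.
    suff : val (t y) <= val (t' i) by rewrite ti.
    rewrite /= last_vertexE.
    apply: (@leq_bigmax_cond _ (fun z => z \in _) (fun z : 'I_2 => z : nat)).
    by apply/imsetP; exists y.
  case: (ord2P (t' ord0)) => t'0.
    (* collapse onto the initial segment where [t'] vanishes, on which the chains
       [A] and [r A] agree *)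
    have [k k0] : exists k : delta m m,
        (forall i, t' i = ord0 -> k i = i) /\ (forall i, t' (k i) = ord0).
      have ex0 : exists l, [pred l | [exists i : 'I_m.+1, (i == l :> nat) && (t' i == ord0)]] l.
        by exists 0%N; apply/existsP; exists ord0; rewrite t'0 !eqxx.
      have bd l : [pred l | [exists i : 'I_m.+1, (i == l :> nat) && (t' i == ord0)]] l -> l <= m.
        by move=> /existsP[i /andP[/eqP <- _]]; rewrite -ltnS.
      have [l /existsP[i0 /andP[/eqP i0l /eqP ti0]] lmax] := ex_maxnP ex0 bd.
      have mn (i : 'I_m.+1) : minn i l < m.+1 by rewrite (leq_ltn_trans (geq_minl _ _)).
      have kP (i j : 'I_m.+1) : i <= j -> Ordinal (mn i) <= Ordinal (mn j).
        move=> ij /=; rewrite leq_min geq_minr andbT.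
        exact: leq_trans (geq_minl _ _) ij.
      exists (Delta kP); split=> i.
        move=> ti; apply: val_inj; apply/minn_idPl/lmax; apply/existsP.
        by exists i; rewrite ti !eqxx.
      apply: val_inj; apply/eqP; rewrite -leqn0.
      suff : val (t' (Delta kP i)) <= val (t' i0) by rewrite ti0.
      by apply: deltaP; rewrite /= i0l geq_minr.
    have [kt tk] := k0.
    rewrite -[LHS](Jr _ _ k) // -[RHS](Jr _ _ k) //; congr (J _ _).
    rewrite !ex_app_res; congr (ex_app _ _ _); apply: chain_eq => i /=.
    exact: rA.
  have t'1 i : t' i = ord_max.
    case: (ord2P (t' i)) => // ti; have := deltaP t' (leq0n i : ord0 <= i).
    by rewrite t'0 ti.
  by rewrite (cone_chain_top _ _ t'1) [RHS](cone_chain_top _ _ t'1).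
- move=> p n t f g c t1; apply: ex_appP => m A; rewrite !(ex_coneE, ex_app_smor).
  set t' := chain_last _.
  have t'1 i : t' i = ord_max.
    by rewrite /= last_vertex_push ?chain_neq0 // t1.
  by rewrite (cone_chain_top _ _ t'1) [RHS](cone_chain_top _ _ t'1).
Qed.

End ExCone.

Lemma exk_cone (S : sset) (x : S 0) J k : cone_contraction x J ->
  exists J', @cone_contraction (exk k S) (exk_point k x) J'.
Proof.
move=> JP; elim: k => [|k [J' J'P]]; first by exists J.
by exists (@ex_cone_fun _ _ _ J'P); exact: ex_cone.
Qed.

Lemma codegeneracy_subproof m (i : 'I_m.+2) : minn i m < m.+1.
Proof. by rewrite ltnS geq_minr. Qed.

Lemma codegeneracy_mono m (i j : 'I_m.+2) : i <= j ->
  Ordinal (codegeneracy_subproof i) <= Ordinal (codegeneracy_subproof j).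
Proof. by move=> ij /=; rewrite leq_min geq_minr andbT (leq_trans (geq_minl _ _) ij). Qed.

Definition codegeneracy m : delta m.+1 m := Delta (@codegeneracy_mono m).

Lemma last_to_cone_mono m (i j : 'I_m.+2) : i <= j ->
  (if i <= m then ord0 else ord_max : 'I_2) <= (if j <= m then ord0 else ord_max : 'I_2).
Proof.
move=> ij; case: (leqP i m) => // im; case: (leqP j m) => // jm.
by have := leq_trans (leq_trans im ij) jm; rewrite ltnn.
Qed.

Definition last_to_cone m : delta m.+1 1 := Delta (@last_to_cone_mono m).

(** The simplex [w] is the join of the sphere [a] with the cone point.  Its last
   face is [a]; the preceding one only depends on the restriction of [a] to one of
   its faces, all of which lie at the base point. *)
Lemma cone_null (S : sset) (x : S 0) J m (a : S m.+1) : cone_contraction x J ->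
  (forall i, face S i a = const_at x m) ->
  exists w : S m.+2, forall i : 'I_m.+3,
    face S i w = if i == m.+2 :> nat then a else const_at x m.+1.
Proof.
move=> [Jn J0 Jx Jr Jc] aP.
have minn_last : minn m.+1 m = m by apply/minn_idPr.
exists (J _ (last_to_cone m.+1) (smor S (codegeneracy m.+1) a)) => i.
rewrite /face Jn -sset_smorM.
case: (ltngtP i m.+1) => im.
- rewrite [in RHS]ltn_eqF ?(ltn_trans im) //.
  have im2 : i < m.+2 by exact: ltn_trans im _.
  have -> : delta_cmp (codegeneracy m.+1) (coface i) =
      delta_cmp (coface (Ordinal im2)) (codegeneracy m).
    apply: delta_eq => j; apply: val_inj; rewrite /= /bump.
    by have := ltn_ord j; lia.
  by rewrite sset_smorM -/(face S _ a) aP smor_const_at.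
- have im2 : i = m.+2 :> nat.
    by apply/eqP; rewrite eqn_leq im -ltnS ltn_ord.
  rewrite im2 eqxx J0.
    rewrite -[RHS]sset_smor1; congr (smor S _ a); apply: delta_eq => j.
    by apply: val_inj; rewrite /= /bump; have := ltn_ord j; lia.
  move=> j; rewrite /= /bump; case: leqP => // h.
  by have := ltn_ord j; lia.
- rewrite im ltn_eqF //.
  have -> : delta_cmp (codegeneracy m.+1) (coface i) = delta_id m.+1.
    apply: delta_eq => j; apply: val_inj; rewrite /= /bump.
    by have := ltn_ord j; lia.
  rewrite sset_smor1; set t := delta_cmp _ _.
  have tE (j : 'I_m.+2) : t j = if j <= m then ord0 else ord_max.
    rewrite /t /= /bump; case: (leqP _ m.+1) => h; case: (leqP j m) => h' //; lia.
  rewrite -(Jr _ t (delta_cmp (coface ord_max) (codegeneracy m))).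
  + by rewrite sset_smorM -/(face S _ a) aP smor_const_at Jx.
  + move=> j; rewrite tE; case: (leqP j m) => // jm _; apply: val_inj.
    by rewrite /= /bump; lia.
  + by rewrite tE.
Qed.

Lemma cone_spans (S : sset) (x : S 0) J m k (a : exk k S m.+1) :
  cone_contraction x J ->
  (forall i, face (exk k S) i a = const_simplex k x m) ->
  spans x (const_simplex k x m.+1) (const_simplex k x m.+1) a.
Proof.
move=> /(exk_cone k)[J' J'P] aP; have [w wP] := cone_null J'P aP.
exists w => i; rewrite wP -/(const_simplex k x m.+1).
case: (i =P m.+2 :> nat) => [e|_]; last by do 2![case: eqP => // _].
by do 2![case: eqP => [e'|_]; first by exfalso; lia].
Qed.

(** * Limits and colimits in a category *)

Definition has_wide_pullbacks (C : category) : Prop :=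
  forall (I : Type) (X : C) (Y : I -> C) (f : forall i, mor (Y i) X),
  exists (P : C) (w : mor P X) (p : forall i, mor P (Y i)),
    (forall i, f i ** p i = w) /\
    forall Z (v : mor Z X) (g : forall i, mor Z (Y i)), (forall i, f i ** g i = v) ->
      exists! u : mor Z P, w ** u = v /\ forall i, p i ** u = g i.

Definition has_coequalizers (C : category) : Prop :=
  forall (X Y : C) (f g : mor X Y), exists (Q : C) (c : mor Y Q),
    c ** f = c ** g /\
    forall Z (h : mor Y Z), h ** f = h ** g -> exists! k : mor Q Z, k ** c = h.

Lemma ex_unique_eq (T : Type) (P : T -> Prop) (x y : T) :
  (exists! z, P z) -> P x -> P y -> x = y.
Proof. by move=> [z [_ zu]] /zu <- /zu <-. Qed.

Lemma terminal_eq (C : category) (I : C) (Z : C) (u v : mor Z I) :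
  is_terminal I -> u = v.
Proof. by move=> /(_ Z) It; exact: ex_unique_eq It _ _. Qed.

Lemma terminal_iso (C : category) (I J : C) (f : mor I J) :
  is_terminal I -> is_terminal J -> is_iso f.
Proof.
move=> It Jt; have [g _] := It J.
by exists g; split; exact: terminal_eq.
Qed.

Lemma iso_terminal (C : category) (I J : C) (f : mor I J) :
  is_iso f -> is_terminal J -> is_terminal I.
Proof.
move=> [g [gf fg]] Jt Z; have [u _] := Jt Z.
exists (g ** u); split=> // v _.
by rewrite (terminal_eq u (f ** v) Jt) cmpA gf cmp1m.
Qed.

Lemma under_eq (C : category) (U : C) (Y Z : slice C U) (f g : mor Y Z) :
  f = g -> under f = under g.
Proof. by move=> ->. Qed.

(** Limits are stated as wide pullbacks because these, unlike products, are
   inherited by slices. *)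
Lemma slice_wide_pullbacks (C : category) (U : C) :
  has_wide_pullbacks C -> has_wide_pullbacks (slice C U).
Proof.
move=> wp I X Y f.
have [P [w [p [fp pu]]]] := wp I (dom X) (fun i => dom (Y i)) (fun i => under (f i)).
have pP i : str (Y i) ** p i = str X ** w by rewrite -(fp i) cmpA underP.
exists (SliceOb (str X ** w)), (@SliceMor _ _ (SliceOb (str X ** w)) X w erefl),
  (fun i => @SliceMor _ _ (SliceOb (str X ** w)) (Y i) (p i) (pP i)).
split=> [i|Z v g fg]; first by apply: slice_morP; exact: fp.
have [|u [[wu pu'] uu]] := pu (dom Z) (under v) (fun i => under (g i)).
  by move=> i; rewrite -(fg i).
have uP : str X ** w ** u = str Z by rewrite -cmpA wu underP.
exists (@SliceMor _ _ Z (SliceOb (str X ** w)) u uP); split.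
  by split=> [|i]; apply: slice_morP => //=; exact: pu'.
move=> u' [wu' pu'']; apply: slice_morP => /=; apply: uu; split.
  by rewrite -wu'.
by move=> i; rewrite -(pu'' i).
Qed.

Lemma slice_coequalizers (C : category) (U : C) :
  has_coequalizers C -> has_coequalizers (slice C U).
Proof.
move=> coeq X Y f g.
have [Q [c [cfg cu]]] := coeq _ _ (under f) (under g).
have [|q [qc qu]] := cu _ (str Y); first by rewrite !underP.
exists (SliceOb q), (@SliceMor _ _ Y (SliceOb q) c qc); split.
  exact: slice_morP.
move=> Z h hfg.
have [|k [kc ku]] := cu _ (under h); first exact: (under_eq hfg).
have kP : str Z ** k = q.
  apply: (@ex_unique_eq _ (fun z => z ** c = str Y)) => //; first by exists q.
  by rewrite -cmpA kc underP.
exists (@SliceMor _ _ (SliceOb q) Z k kP); split; first exact: slice_morP.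
move=> k' k'c; apply: slice_morP => /=; apply: ku.
exact: (under_eq k'c).
Qed.

(** * Associated sheaves of presheaves *)

Lemma sheafification_eq (C : category) (P : presheaf C) (A B : C)
    (eta : presheaf_map P A) (u v : mor A B) :
  is_sheafification eta -> (forall Z (s : gen P Z), u ** eta Z s = v ** eta Z s) ->
  u = v.
Proof.
move=> etaS uv.
have nat Z' Z (f : mor Z' Z) (s : gen P Z) :
    u ** eta Z' (res P f s) = (u ** eta Z s) ** f by rewrite pmap_nat cmpA.
have rl Z (s t : gen P Z) : Defs.rel P s t -> u ** eta Z s = u ** eta Z t.
  by move=> st; rewrite (pmap_rel eta st).
exact: ex_unique_eq (etaS _ (@PresheafMap C P B (fun Z s => u ** eta Z s) nat rl)) _ _.
Qed.

(** It suffices to exhibit one object which is the associated sheaf of both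
   presheaves, compatibly with [phi]. *)
Lemma sheafified_iso (C : category) (P P' : presheaf C) (A : C)
    (phi : forall Z, gen P Z -> gen P' Z)
    (eta : presheaf_map P A) (theta : presheaf_map P' A) :
  is_sheafification eta -> is_sheafification theta ->
  (forall Z (s : gen P Z), theta Z (phi Z s) = eta Z s) ->
  sheafified (@is_iso C) phi.
Proof.
move=> etaS thetaS phiE A' B' eta' theta' etaS' thetaS' g gE.
have [a [aE _]] := etaS _ eta'.
have [b [bE _]] := thetaS _ theta'; have [b' [b'E _]] := thetaS' _ theta.
have ga : g ** a = b.
  by apply: (sheafification_eq etaS) => Z s; rewrite -cmpA -aE gE bE phiE.
exists (a ** b'); split.
  apply: (sheafification_eq etaS') => Z s; rewrite cmp1m.
  by rewrite -!cmpA gE -b'E phiE aE.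
apply: (sheafification_eq thetaS') => Z s; rewrite cmp1m.
by rewrite cmpA ga -cmpA -b'E bE.
Qed.

Lemma sheafification_unique (C : category) (P : presheaf C) (A B : C)
    (eta : presheaf_map P A) (theta : presheaf_map P B) :
  is_sheafification eta -> is_sheafification theta ->
  exists g : mor A B, is_iso g /\ forall Z (s : gen P Z), theta Z s = g ** eta Z s.
Proof.
move=> etaS thetaS; have [g [gE _]] := etaS _ theta.
have [h [hE _]] := thetaS _ eta.
exists g; split=> //; exists h; split.
- by apply: (sheafification_eq etaS) => Z s; rewrite cmp1m -cmpA -gE.
- by apply: (sheafification_eq thetaS) => Z s; rewrite cmp1m -cmpA -hE.
Qed.

Lemma sheafified_trivial (C : category) (P P' : presheaf C)
    (phi : forall Z, gen P Z -> gen P' Z) :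
  trivial_sheaf P -> trivial_sheaf P' -> sheafified (@is_iso C) phi.
Proof.
move=> [A [eta [etaS At]]] [B [theta [thetaS Bt]]] A' B' eta' theta' etaS' thetaS' g _.
have [a [ai _]] := sheafification_unique etaS' etaS.
have [b [bi _]] := sheafification_unique thetaS' thetaS.
by apply: terminal_iso; [exact: iso_terminal ai At|exact: iso_terminal bi Bt].
Qed.

(** * Connected components of simplicial objects *)

Section Pi0.
Variables (C : category) (K : simplicial C).

(** By the Yoneda lemma, a map out of the presheaf of components of [K] is a map
   out of the object of vertices which coequalizes the two faces. *)
Definition coequalizes (A : C) (c : mor (K 0) A) : Prop :=
  c ** face K ord_max = c ** face K (ord0 : 'I_2).

Definition pi0_out (A : C) (c : mor (K 0) A) (h : coequalizes c) :
  presheaf_map (pi0 K) A.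
Proof.
refine (@PresheafMap C (pi0 K) A (fun Z s => c ** s) _ _).
  by move=> Z' Z f s; rewrite /= cmpA.
by move=> Z s t [e [<- <-]]; rewrite !cmpA h.
Defined.

Lemma pi0_map_comp (A : C) (eta : presheaf_map (pi0 K) A) (Z : C) (s : mor Z (K 0)) :
  eta Z s = eta (K 0) (idm (K 0)) ** s.
Proof. by rewrite -(@pmap_nat _ _ _ eta) /= cmp1m. Qed.

Lemma pi0_coequalizes (A : C) (eta : presheaf_map (pi0 K) A) :
  coequalizes (eta (K 0) (idm (K 0))).
Proof.
rewrite /coequalizes -!pi0_map_comp; apply: (@pmap_rel _ _ _ eta).
by exists (idm (K 1)); rewrite !cmpm1.
Qed.

Lemma pi0_sheafification (A : C) (c : mor (K 0) A) (h : coequalizes c) :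
  (forall B (d : mor (K 0) B), coequalizes d -> exists! k, k ** c = d) ->
  is_sheafification (pi0_out h).
Proof.
move=> cu B theta; have [k [kc ku]] := cu _ _ (pi0_coequalizes theta).
exists k; split=> [Z s|k' k'E]; first by rewrite pi0_map_comp -kc -cmpA.
by apply: ku; rewrite (k'E _ (idm (K 0))) /= cmpm1.
Qed.

Lemma pi0_universal (A : C) (eta : presheaf_map (pi0 K) A) :
  is_sheafification eta ->
  forall B (d : mor (K 0) B), coequalizes d ->
  exists! k, k ** eta (K 0) (idm (K 0)) = d.
Proof.
move=> etaS B d h; have [k [kE ku]] := etaS _ (pi0_out h).
exists k; split=> [|k' k'd]; first by rewrite -kE /= cmpm1.
by apply: ku => Z s; rewrite (pi0_map_comp eta) /= -k'd -cmpA.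
Qed.

Lemma pi0_exists : has_coequalizers C ->
  exists (A : C) (eta : presheaf_map (pi0 K) A), is_sheafification eta.
Proof.
move=> coeq; have [Q [c [h cu]]] := coeq _ _ (face K ord_max) (face K (ord0 : 'I_2)).
by exists Q, (pi0_out h); apply: pi0_sheafification.
Qed.

(** Two vertices of a simplex are joined by one of its edges. *)
Lemma coequalizes_vertex (A : C) (c : mor (K 0) A) n (f g : delta 0 n) :
  coequalizes c -> c ** smor K f = c ** smor K g.
Proof.
move=> h.
wlog fg : f g / f ord0 <= g ord0 => [wl|].
  by case: (leqP (f ord0) (g ord0)) => [/wl//|/ltnW/wl ->].
have eP (i j : 'I_2) : i <= j ->
    (if i == ord0 then f ord0 else g ord0) <= (if j == ord0 then f ord0 else g ord0).
  by case: (ord2P i) => ->; case: (ord2P j) => ->.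
pose e := Delta eP.
have -> : f = delta_cmp e (coface ord_max).
  by apply: delta_eq => i; rewrite [i]ord1.
have -> : g = delta_cmp e (coface ord0).
  by apply: delta_eq => i; rewrite [i]ord1.
by rewrite !smorM !cmpA [c ** _]h.
Qed.

End Pi0.

(** A map to a discrete object is a map out of the sheaf of components, so that it
   extends along a weak equivalence. *)
Lemma weak_equivalence_extend (C : category) (K L : simplicial C)
    (j : simplicial_map K L) (A : C) (c : mor (K 0) A) :
  has_coequalizers C -> weak_equivalence j -> coequalizes c ->
  exists2 d : mor (L 0) A, coequalizes d & d ** j 0 = c.
Proof.
move=> coeq [j0 _] h.
have [B [eta etaS]] := pi0_exists K coeq.
have [D [theta thetaS]] := pi0_exists L coeq.
have je Z (s t : mor Z (K 0)) : Defs.rel (pi0 K) s t ->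
    theta Z (j 0 ** s) = theta Z (j 0 ** t).
  move=> [e [es et]]; apply: (@pmap_rel _ _ _ theta); exists (j 1 ** e).
  by rewrite !cmpA !smap_nat -!cmpA -es -et.
have jn Z' Z (f : mor Z' Z) (s : mor Z (K 0)) :
    theta Z' (j 0 ** (s ** f)) = theta Z (j 0 ** s) ** f.
  by rewrite cmpA (@pmap_nat _ _ _ theta _ _ f).
have [g [gE _]] := etaS _ (@PresheafMap _ (pi0 K) D (fun Z s => theta Z (j 0 ** s)) jn je).
have [g' [g'g gg']] := j0 _ _ eta theta etaS thetaS g (fun Z s => esym (gE Z s)).
have [k [kE _]] := pi0_universal etaS h.
exists (k ** g' ** theta _ (idm _)).
  by rewrite /coequalizes -!(cmpA _ (theta _ _)) (pi0_coequalizes theta).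
rewrite -!cmpA -pi0_map_comp -[in theta _ _](cmpm1 (j 0)).
by rewrite [theta _ _](gE _ (idm _)) cmpA [k ** _ ** _]cmpA -(cmpA k g' g) g'g cmpm1.
Qed.

(** * Trivial homotopy sheaves *)

Lemma const_simplexS k (S : sset) (x : S 0) n :
  to_ex (exk k S) n (const_simplex k x n) = const_simplex k.+1 x n.
Proof. by rewrite /const_simplex -[LHS]sset_smap. Qed.

Lemma const_sphereP (S : sset) (x : S 0) m k i :
  face (exk k S) i (const_simplex k x m.+1) = const_simplex k x m.
Proof. exact: (@smor_const_at (exk k S)). Qed.

Definition const_sphere (S : sset) (x : S 0) m k : sphere x m :=
  Sphere k (const_simplex k x m.+1) (@const_sphereP S x m k).

Lemma sphere_eq (S : sset) (x : S 0) m k (a b : exk k S m.+1) aP bP :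
  a = b -> Sphere (x := x) k a aP = Sphere k b bP.
Proof. by move=> e; case: b / e bP => bP; rewrite (Prop_irrelevance aP bP). Qed.

(** Null spheres may live at different stages of the iteration of Kan's functor;
   the constant spheres of consecutive stages are identified. *)
Lemma cone_sphere (S : sset) (x : S 0) J m (s : sphere x m) (Q : Type)
    (f : sphere x m -> Q) :
  cone_contraction x J -> (forall s t, homotopic s t -> f s = f t) ->
  f s = f (const_sphere x m 0).
Proof.
move=> JP fh; case: s => k a aP.
have <- : f (const_sphere x m k) = f (Sphere k a aP).
  by apply: fh; apply: homotopic_htpy; exact: (cone_spans JP aP).
elim: k {a aP} => // k <-; apply/esym/fh.
have aP i : face (exk k.+1 S) i (to_ex (exk k S) m.+1 (const_simplex k x m.+1)) =
    const_simplex k.+1 x m by rewrite const_simplexS const_sphereP.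
have -> : const_sphere x m k.+1 = Sphere k.+1 (to_ex (exk k S) m.+1 (const_simplex k x m.+1)) aP.
  by apply: sphere_eq; rewrite const_simplexS.
exact: homotopic_level.
Qed.

(** All spheres over [Z] are identified with the constant one by every map to a
   sheaf.  As this is a property of each [Z] separately, the contractions need not be
   natural in [Z]. *)
Lemma trivial_piS (C : category) (K : simplicial C) (Y : C) (x : mor Y (K 0)) m :
  (forall Z : slice C Y, exists J,
     @cone_contraction (sections (dom Z) K) (x ** str Z) J) ->
  trivial_sheaf (piS x m).
Proof.
move=> cone; pose I : slice C Y := SliceOb (idm Y).
pose tI (Z : slice C Y) : mor Z I := @SliceMor _ _ Z I (str Z) (cmp1m _).
have tIu (Z : slice C Y) (u : mor Z I) : u = tI Z.
  by apply: slice_morP => /=; rewrite -(underP u) /= cmp1m.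
have It : is_terminal I by move=> Z; exists (tI Z); split.
exists I, (@PresheafMap _ (piS x m) I (fun Z _ => tI Z)
  (fun Z' Z f s => esym (tIu Z' _)) (fun _ _ _ _ => erefl)).
split=> // B theta.
pose c Z := const_sphere (S := sections (dom Z) K) (x ** str Z) m 0.
have thetaE Z (s : gen (piS x m) Z) : theta Z s = theta Z (c Z).
  have [J JP] := cone Z.
  by apply: cone_sphere JP _ => a b ab; exact: (@pmap_rel _ _ _ theta).
exists (theta I (c I)); split=> [Z s|g gE]; last first.
  apply: (etrans (gE I (c I))); rewrite -[RHS]cmpm1; congr (_ ** _).
  exact/esym/tIu.
by rewrite -(@pmap_nat _ _ _ theta) thetaE; apply/esym/thetaE.
Qed.

(** * Discrete simplicial objects *)

(** Rather than constant objects only, so that images under functors are again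
   discrete. *)
Definition discrete (C : category) (K : simplicial C) : Prop :=
  forall p n (f : delta p n), is_iso (smor K f).

Section Discrete.
Variables (C : category) (K : simplicial C).
Hypothesis dK : discrete K.

Lemma discrete_endo n (f : delta n n) : smor K f = idm (K n).
Proof.
have [g [gf fg]] := dK (collapse n).
have e : smor K f ** smor K (collapse n) = smor K (collapse n).
  by rewrite -smorM; congr smor; apply: delta_eq => i; rewrite [RHS]ord1 [LHS]ord1.
by rewrite -[LHS]cmpm1 -fg cmpA e.
Qed.

Lemma discrete_face : face K ord_max = face K (ord0 : 'I_2) :> mor (K 1) (K 0).
Proof.
have [g [gf fg]] := dK (collapse 1).
have e (i : 'I_2) : face K i = g.
  rewrite -[LHS]cmpm1 -fg cmpA -smorM discrete_endo cmp1m //.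
by rewrite !e.
Qed.

Lemma discrete_coequalizes A (c : mor (K 0) A) : coequalizes c.
Proof. by rewrite /coequalizes discrete_face. Qed.

Lemma discrete_sheafification :
  is_sheafification (pi0_out (discrete_coequalizes (idm (K 0)))).
Proof.
apply: pi0_sheafification => B d _; exists d; split=> [|k kd]; first exact: cmpm1.
by rewrite -kd cmpm1.
Qed.

Lemma discrete_trivial (Y : C) (x : mor Y (K 0)) m : trivial_sheaf (piS x m).
Proof.
apply: trivial_piS => Z; exists (fun _ _ s => s).
have fE p n (f g : delta p n) : smor K f = smor K g.
  have [a [aK Ka]] := dK (collapse p).
  have e (h : delta p n) : smor K h ** smor K (collapse n) = smor K (collapse p).
    by rewrite -smorM; congr smor; apply: delta_eq => i; rewrite [RHS]ord1 [LHS]ord1.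
  have [b [bK Kb]] := dK (collapse n).
  by rewrite -[LHS]cmpm1 -[RHS]cmpm1 -Kb !cmpA !e.
split=> //=.
- by move=> p t r s _ _; rewrite discrete_endo cmp1m.
- by move=> p n t f g s _; rewrite (fE _ _ f g).
Qed.

(** Maps to a discrete object are determined by their value on components, and
   those extend along weak equivalences. *)
Lemma discrete_fibrant : has_coequalizers C -> fibrant K.
Proof.
move=> coeq A B i _ iw u.
have uc : coequalizes (u 0).
  by rewrite /coequalizes /face -!smap_nat; congr (_ ** _); exact: discrete_face.
have [v vc vi] := weak_equivalence_extend coeq iw uc.
have vn p n (f : delta p n) :
    smor K f ** (smor K (collapse n) ** v ** smor B (vertex ord0)) =
    (smor K (collapse p) ** v ** smor B (vertex ord0)) ** smor B f.
  rewrite !cmpA -smorM -!cmpA -smorM.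
  have -> : delta_cmp (collapse n) f = collapse p.
    by apply: delta_eq => j; rewrite [LHS]ord1 [RHS]ord1.
  by congr (_ ** _); exact: coequalizes_vertex vc.
exists (@SimplicialMap C B K (fun n => smor K (collapse n) ** v ** smor B (vertex ord0)) vn).
apply: simplicial_mapP => n /=.
rewrite -cmpA smap_nat cmpA -[_ ** v ** _]cmpA vi -cmpA -smap_nat cmpA -smorM.
by rewrite discrete_endo cmp1m.
Qed.

Lemma discrete_is_K0 : has_coequalizers C -> is_K0 (K 0) K.
Proof.
move=> coeq; split; first exact: discrete_fibrant.
- by eexists; exact: discrete_sheafification.
- by move=> Y x m; exact: discrete_trivial.
Qed.

Lemma discrete_id_weq : weak_equivalence (smap_id K).
Proof.
split=> [|Y x m].
  apply: sheafified_iso discrete_sheafification discrete_sheafification _ => Z s /=.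
  by rewrite /pi0_map /= cmp1m.
by apply: sheafified_trivial; exact: discrete_trivial.
Qed.

End Discrete.

Definition constant_simplicial (C : category) (A : C) : simplicial C.
Proof.
refine (@Simplicial C (fun _ => A) (fun _ _ _ => idm A) _ _) => //.
by move=> *; rewrite cmp1m.
Defined.

Lemma constant_simplicial_discrete (C : category) (A : C) : discrete (constant_simplicial A).
Proof. by move=> p n f; exists (idm A); rewrite cmp1m. Qed.

Lemma sfun_discrete (C D : category) (F : functor C D) (K : simplicial C) :
  discrete K -> discrete (sfun F K).
Proof.
move=> dK p n f; have [g [gf fg]] := dK p n f.
by exists (fmor F g); rewrite -!fmorM gf fg !fmor1.
Qed.

(** * Edges in fibrant objects without higher homotopy *)

Lemma wide_pullback (C : category) : has_wide_pullbacks C ->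
  forall (I : Type) (X : C) (Y : I -> C) (f : forall i, mor (Y i) X),
  {P : C & {w : mor P X & {p : forall i, mor P (Y i) |
    (forall i, f i ** p i = w) /\
    forall Z (v : mor Z X) (g : forall i, mor Z (Y i)), (forall i, f i ** g i = v) ->
      exists! u : mor Z P, w ** u = v /\ forall i, p i ** u = g i}}}.
Proof.
move=> wp I X Y f; have /cid[P /cid[w /cid[p pP]]] := wp I X Y f.
by exists P, w, p.
Qed.

(** The envelope of [K] over its object of components [A]: an [n]-simplex is a family
   of simplices of [K], one of dimension [p] for each operator from [p] to [n], all
   in the same component and otherwise unrelated.  It contains [K], since a simplex
   is determined by the family of its images under all operators.  Since its
   components are contractible, it is weakly equivalent to [K] as soon as the higher
   homotopy sheaves of [K] are trivial. *)
Section Envelope.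
Variables (C : category) (wp : has_wide_pullbacks C).
Variables (K : simplicial C) (A : C) (c : mor (K 0) A).
Hypothesis cc : coequalizes c.

Definition component p : mor (K p) A := c ** smor K (vertex ord0).

Lemma component_smor p n (f : delta p n) : component p ** smor K f = component n.
Proof. by rewrite /component -cmpA -smorM; exact: coequalizes_vertex. Qed.

Lemma component0 : component 0 = c.
Proof.
rewrite /component -[RHS]cmpm1 -smor1; congr (_ ** smor K _).
by apply: delta_eq => i; rewrite [LHS]ord1 [RHS]ord1.
Qed.

Definition slot n := {p : nat & delta p n}.

Definition env_limit n := wide_pullback wp (fun i : slot n => component (projT1 i)).
Definition env n : C := projT1 (env_limit n).
Definition env_out n : mor (env n) A := projT1 (projT2 (env_limit n)).
Definition env_pr n p (f : delta p n) : mor (env n) (K p) :=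
  sval (projT2 (projT2 (env_limit n))) (existT _ p f).

Lemma env_out_pr n p (f : delta p n) : component p ** env_pr f = env_out n.
Proof.
by have [prE _] := svalP (projT2 (projT2 (env_limit n))); exact: (prE (existT _ p f)).
Qed.

Lemma env_pair n Z (a : mor Z A) (g : forall p, delta p n -> mor Z (K p)) :
  (forall p (f : delta p n), component p ** g p f = a) ->
  exists2 u : mor Z (env n), env_out n ** u = a &
    forall p (f : delta p n), env_pr f ** u = g p f.
Proof.
have [_ prE] := svalP (projT2 (projT2 (env_limit n))) => gE.
have [|u [[ua ug] _]] := prE Z a (fun i => g (projT1 i) (projT2 i)).
  by case=> p f; exact: gE.
by exists u => // p f; exact: ug (existT _ p f).
Qed.

Lemma env_eq n Z (u v : mor Z (env n)) :
  (forall p (f : delta p n), env_pr f ** u = env_pr f ** v) -> u = v.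
Proof.
have [prw prE] := svalP (projT2 (projT2 (env_limit n))) => uv.
have uvw : env_out n ** u = env_out n ** v.
  by rewrite -(env_out_pr (delta_id n)) -!cmpA uv.
apply: ex_unique_eq (prE Z (env_out n ** v) (fun i => env_pr (projT2 i) ** v) _) _ _.
- by move=> [p f]; rewrite cmpA env_out_pr.
- by split=> // -[p f]; exact: uv.
- by split=> // -[p f].
Qed.

Lemma env_smor_subproof m n (f : delta m n) :
  exists u : mor (env n) (env m), forall p (g : delta p m),
    env_pr g ** u = env_pr (delta_cmp f g).
Proof.
have [|u _ uP] := @env_pair m _ (env_out n) (fun p g => env_pr (delta_cmp f g)).
  by move=> p g; rewrite env_out_pr.
by exists u.
Qed.

Definition env_smor m n (f : delta m n) := sval (cid (env_smor_subproof f)).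

Lemma env_smorE m n (f : delta m n) p (g : delta p m) :
  env_pr g ** env_smor f = env_pr (delta_cmp f g).
Proof. exact: (svalP (cid (env_smor_subproof f))). Qed.

Definition envelope : simplicial C.
Proof.
refine (@Simplicial C env env_smor _ _) => [n|p n m g f]; apply: env_eq => q h.
  by rewrite env_smorE cmpm1; congr env_pr; apply: delta_eq.
by rewrite cmpA !env_smorE; congr env_pr; apply: delta_eq.
Defined.

Lemma env_out_smor m n (f : delta m n) : env_out m ** env_smor f = env_out n.
Proof. by rewrite -(env_out_pr (delta_id m)) -cmpA env_smorE env_out_pr. Qed.

Lemma to_env_subproof n : exists u : mor (K n) (env n), forall p (f : delta p n),
  env_pr f ** u = smor K f.
Proof.
have [|u _ uP] := @env_pair n _ (component n) (fun p f => smor K f).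
  by move=> p f; exact: component_smor.
by exists u.
Qed.

Definition to_env n := sval (cid (to_env_subproof n)).

Lemma to_envE n p (f : delta p n) : env_pr f ** to_env n = smor K f.
Proof. exact: (svalP (cid (to_env_subproof n))). Qed.

Definition to_envelope : simplicial_map K envelope.
Proof.
refine (@SimplicialMap C K envelope to_env _) => p n f; apply: env_eq => q g.
by rewrite !cmpA [_ ** smor envelope f]env_smorE !to_envE smorM.
Defined.

Lemma env_out_to n : env_out n ** to_env n = component n.
Proof. by rewrite -(env_out_pr (delta_id n)) -cmpA to_envE component_smor. Qed.

Lemma to_envelope_mono : @is_mono (simplicial_cat C) _ _ to_envelope.
Proof.
move=> Z u v uv; apply: simplicial_mapP => n.
rewrite -[LHS]cmp1m -[RHS]cmp1m -smor1 -to_envE -!cmpA; congr (_ ** _).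
exact: (congr1 (fun z : simplicial_map Z envelope => z n) uv).
Qed.

(** The members of the family defining an edge are unrelated, so those over its two
   ends can be prescribed. *)
Lemma env_edge Z (s t : mor Z (env 0)) : env_out 0 ** s = env_out 0 ** t ->
  exists e : mor Z (env 1), face envelope ord_max ** e = s /\
                            face envelope (ord0 : 'I_2) ** e = t.
Proof.
move=> st.
pose g p (f : delta p 1) :=
  env_pr (collapse p) ** (if [forall i, f i == ord0] then s else t).
have [|e _ eP] := @env_pair 1 _ (env_out 0 ** s) g.
  by move=> p f; rewrite /g cmpA env_out_pr; case: ifP.
have pr0 q (f : delta q 0) : env_pr f = env_pr (collapse q).
  by congr env_pr; apply: delta_eq => i; rewrite [LHS]ord1 [RHS]ord1.
exists e; split; apply: env_eq => q f; rewrite cmpA env_smorE eP /g pr0;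
  congr (_ ** _); case: forallP => //.
- by case=> i; apply/eqP/val_inj; rewrite /= (ord1 (f i)).
- by move=> /(_ ord0)/eqP/(congr1 val); rewrite /= (ord1 (f ord0)).
Qed.

Lemma env_out_coequalizes : @coequalizes C envelope A (env_out 0).
Proof. by rewrite /coequalizes /face !env_out_smor. Qed.

Lemma envelope_sheafification :
  (forall B (d : mor (K 0) B), coequalizes d -> exists! k, k ** c = d) ->
  is_sheafification (pi0_out env_out_coequalizes).
Proof.
move=> cu; apply: pi0_sheafification => B d dc.
have dP : coequalizes (d ** to_env 0).
  rewrite /coequalizes -!cmpA -!(smap_nat to_envelope) !cmpA.
  by congr (_ ** _); exact: dc.
have [k [kc ku]] := cu _ _ dP.
have cE : env_out 0 ** to_env 0 = c by rewrite env_out_to component0.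
exists k; split=> [|k' k'd]; last by apply: ku; rewrite -k'd -cmpA cE.
(* every point of the envelope lies in the component of a point of [K] *)
pose s := to_env 0 ** env_pr (delta_id 0).
have sE : env_out 0 ** s = env_out 0 ** idm (env 0).
  by rewrite /s cmpA cE cmpm1 -component0 env_out_pr.
have [e [es et]] := env_edge sE.
have ds : d ** s = d ** idm _ by rewrite -es -et !cmpA dc.
by rewrite -[RHS]cmpm1 -ds /s cmpA -kc -cmpA -component0 env_out_pr.
Qed.

(** In the family defining a simplex of the envelope, the members whose index hits
   a vertex to be moved are replaced by those of a chosen vertex of the same component.
   The choice is made separately over each [Z]. *)
Lemma envelope_cone Z (x : mor Z (env 0)) :
  exists J, @cone_contraction (sections Z envelope) x J.
Proof.
have /choice[d dP] : forall a : mor Z A, exists y : mor Z (env 0),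
    (a = env_out 0 ** x -> y = x) /\
    ((exists y', env_out 0 ** y' = a) -> env_out 0 ** y = a).
  move=> a; have [->|ax] := pselect (a = env_out 0 ** x); first by exists x.
  have [[y yE]|ny] := pselect (exists y', env_out 0 ** y' = a); first by exists y.
  by exists x.
pose g p (t : delta p 1) (s : mor Z (env p)) q (f : delta q p) : mor Z (K q) :=
  if [forall i, t (f i) == ord0] then env_pr f ** s
  else env_pr (collapse q) ** d (env_out p ** s).
have gP p (t : delta p 1) (s : mor Z (env p)) q (f : delta q p) :
    component q ** g p t s q f = env_out p ** s.
  rewrite /g; case: ifP => _; rewrite cmpA env_out_pr //.
  apply: (proj2 (dP _)); exists (env_smor (vertex ord0) ** s).
  by rewrite cmpA env_out_smor.
have JP p t s : {u : mor Z (env p) | forall q f, env_pr f ** u = g p t s q f}.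
  by apply: cid; have [u _ uP] := env_pair (gP p t s); exists u.
have JE p t s q f : env_pr f ** sval (JP p t s) = g p t s q f.
  exact: (svalP (JP p t s)).
exists (fun p t s => sval (JP p t s)); split.
- move=> p q f t s; apply: env_eq => r h.
  rewrite JE /= cmpA env_smorE JE /g /= [env_pr h ** _]cmpA env_smorE.
  by rewrite [env_out _ ** (_ ** _)]cmpA env_out_smor.
- move=> p t s t0; apply: env_eq => r h; rewrite JE /g.
  by case: forallP => // -[] i; rewrite t0.
- move=> p t; apply: env_eq => r h; rewrite JE /g /const_at /=.
  rewrite !cmpA env_smorE env_out_smor.
  have -> : delta_cmp (collapse p) h = collapse r by apply: delta_eq.
  by rewrite (proj1 (dP _)) //; case: ifP.
- move=> p t r s rt _; apply: env_eq => q h; rewrite !JE /g /=.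
  rewrite !cmpA env_smorE env_out_smor; case: forallP => // th.
  congr (env_pr _ ** _); apply: delta_eq => i /=; apply: rt; exact/eqP/th.
- move=> p n t f h s t1; apply: env_eq => q k; rewrite !JE /g /=.
  rewrite !cmpA !env_out_smor; case: forallP => // /(_ ord0).
  by rewrite t1.
Qed.

End Envelope.

(** A fibrant object without higher homotopy is a retract of its envelope, where
   vertices in the same component are joined by a global edge.  Without fibrancy,
   they would only be joined locally. *)
Lemma fibrant_edge (C : category) (A : C) (K : simplicial C)
    (eta : presheaf_map (pi0 K) A) (Z : C) (s t : mor Z (K 0)) :
  has_wide_pullbacks C -> fibrant K -> is_sheafification eta ->
  (forall (Y : C) (x : mor Y (K 0)) m, trivial_sheaf (piS x m)) ->
  eta Z s = eta Z t ->
  exists e : mor Z (K 1), face K ord_max ** e = s /\ face K (ord0 : 'I_2) ** e = t.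
Proof.
move=> wp fK etaS triv.
pose c := eta (K 0) (idm (K 0)); have cc : coequalizes c := pi0_coequalizes eta.
rewrite (pi0_map_comp eta s) (pi0_map_comp eta t) -/c => st.
pose i := to_envelope wp cc.
have iw : weak_equivalence i.
  split=> [|Y x m].
    apply: (sheafified_iso etaS (envelope_sheafification (wp := wp) cc (pi0_universal etaS))).
    by move=> W u; rewrite (pi0_map_comp eta) /= cmpA env_out_to component0.
  apply: sheafified_trivial; first exact: triv.
  by apply: trivial_piS => W; exact: envelope_cone.
have [r ri] := fK _ _ i (@to_envelope_mono _ wp _ _ _ cc) iw (smap_id K).
have riE n : r n ** i n = idm (K n).
  exact: (congr1 (fun z : simplicial_map K K => z n) ri).
have [|e [es et]] := @env_edge _ wp _ _ c _ (i 0 ** s) (i 0 ** t).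
  by rewrite !cmpA env_out_to component0.
by exists (r 1 ** e); rewrite !cmpA !smap_nat -!cmpA es et !cmpA riE !cmp1m.
Qed.

(** * Separated coefficients and (-1)-purity *)

Definition has_images (T : category) : Prop :=
  forall (P Q : T) (f : mor P Q), exists (I : T) (p : mor P I) (m : mor I Q),
    [/\ is_mono m, m ** p = f
      & forall B (t : mor P B),
          (forall Z (x y : mor Z P), f ** x = f ** y -> t ** x = t ** y) ->
          exists k, k ** p = t].

Lemma dir_unit_eq (F E : category) (r : geometric_morphism F E) (X : E) (A : F)
    (f g : mor (inv r X) A) :
  fmor (dir r) f ** unit r X = fmor (dir r) g ** unit r X -> f = g.
Proof. by move=> fg; exact: ex_unique_eq (unit_univ (fmor (dir r) g ** unit r X)) _ _. Qed.

Lemma dir_mono (F E : category) (r : geometric_morphism F E) (A B : F) (m : mor A B) :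
  is_mono m -> is_mono (fmor (dir r) m).
Proof.
move=> mm Z u v uv.
have [u' [u'E _]] := unit_univ u; have [v' [v'E _]] := unit_univ v.
rewrite -u'E -v'E; congr (fmor _ _ ** _); apply: mm; apply: dir_unit_eq.
by rewrite !fmorM -!cmpA u'E v'E.
Qed.

Lemma unit_mono (F E : category) (r : geometric_morphism F E) (A : E) :
  (forall Z (u v : mor Z A), fmor (inv r) u = fmor (inv r) v -> u = v) ->
  is_mono (unit r A).
Proof.
move=> faith Z u v uv; apply: faith; apply: dir_unit_eq.
by rewrite !unit_nat uv.
Qed.

(** By [fibrant_edge], the sheaf [pi_0 (s e_* K)] is the image of [e_* K_0] in
   [e_* A], so it embeds in [e_* A], hence in [e_* r_* r^* A].  As [r^* A] is the
   sheaf of components of [L], this embedding factors through [pi_0 (s e_* s r_* L)]. *)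
Lemma cohomology_mono (F E T : category) (e : geometric_morphism E T)
    (r : geometric_morphism F E) (A : E) (K : simplicial E) (L : simplicial F)
    (j : simplicial_map (sfun (inv r) K) L) :
  has_wide_pullbacks E -> has_coequalizers F -> has_images T ->
  is_K0 A K -> weak_equivalence j -> is_mono (unit r A) ->
  cohomology_map e (@is_mono T) j.
Proof.
move=> wp coeq img [fK [eta etaS] triv] jw mA A' B' eta' theta' etaS' thetaS' g gE.
pose c := eta (K 0) (idm (K 0)); have cc : coequalizes c := pi0_coequalizes eta.
have [|d dc dE] := @weak_equivalence_extend _ (sfun (inv r) K) L j _ (fmor (inv r) c) coeq jw.
  by rewrite /coequalizes /face /= -!fmorM; congr fmor.
pose P := sfun (dir e) K; pose c' := eta' (P 0) (idm (P 0)).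
have [I [p [m [mm mp pu]]]] := img _ _ (fmor (dir e) c).
have [k kp] : exists k, k ** p = c'.
  apply: pu => Z x y xy; rewrite -!(pi0_map_comp eta').
  apply: (@pmap_rel _ _ _ eta').
  have [x' [x'E _]] := unit_univ x; have [y' [y'E _]] := unit_univ y.
  have [|h [hx hy]] := @fibrant_edge _ _ _ eta _ x' y' wp fK etaS triv.
    rewrite (pi0_map_comp eta x') (pi0_map_comp eta y') -/c; apply: (dir_unit_eq (r := e)).
    by rewrite !fmorM -!cmpA x'E y'E.
  exists (fmor (dir e) h ** unit e Z).
  by rewrite -x'E -y'E -hx -hy !fmorM !cmpA.
have [|l [lc _]] := pi0_universal etaS' (d := p).
  apply: mm; rewrite /coequalizes /face !cmpA mp /= -!fmorM; congr fmor; exact: cc.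
have kl : k ** l = idm A'.
  apply: (sheafification_eq etaS') => Z s.
  by rewrite (pi0_map_comp eta') cmpA -(cmpA k) lc kp cmp1m.
have [|n [nE _]] := pi0_universal thetaS' (d := fmor (dir e) (fmor (dir r) d)).
  by rewrite /coequalizes /face /= -!fmorM; congr (fmor _ (fmor _ _)).
have ng : n ** g = fmor (dir e) (unit r A) ** m ** l.
  apply: (sheafification_eq etaS') => Z s.
  rewrite -cmpA gE (pi0_map_comp theta') cmpA nE (pi0_map_comp eta' s) !cmpA.
  rewrite -(cmpA _ l) lc -(cmpA _ m) mp /pi0_map /=; congr (_ ** _).
  by rewrite -!fmorM; congr fmor; rewrite cmpA -fmorM dE unit_nat.
move=> Z u v uv; have : k ** l ** u = k ** l ** v; last by rewrite kl !cmp1m.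
rewrite -!cmpA; congr (_ ** _); apply: mm; apply: (dir_mono mA (r := e)).
by rewrite !cmpA -ng -!cmpA uv.
Qed.

Section Separated.
Variables (E T : category) (e : geometric_morphism E T) (V U : E) (i : mor V U).
Hypothesis sep : forall (B : T) (Z Z' : E) (z : mor Z U) (q : mor Z' Z) (v : mor Z' V),
  is_pullback z i q v -> forall a b : mor Z (inv e B), a ** q = b ** q -> a = b.

Lemma product_eq (C : category) (A B P : C) (p : mor P A) (q : mor P B) Z (u v : mor Z P) :
  is_product p q -> p ** u = p ** v -> q ** u = q ** v -> u = v.
Proof. by move=> pq pu qu; exact: ex_unique_eq (pq Z (p ** v) (q ** v)) _ _. Qed.

(** The localisation of [r] at [X] is the pullback along [i] on underlying objects,
   and maps to the coefficients in the slices are maps to [e^* B]. *)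
Lemma separated_unit (eU : geometric_morphism (slice E U) T)
    (r : geometric_morphism (slice E V) (slice E U)) (X : slice E U)
    (eX : geometric_morphism (slice (slice E U) X) T)
    (rX : geometric_morphism (slice (slice E V) (inv r X)) (slice (slice E U) X)) (B : T) :
  is_slice_structure e eU -> is_slice_change i r ->
  is_slice_structure eU eX -> is_localisation rX ->
  is_mono (unit rX (inv eX B)).
Proof.
move=> [q2 [_ q2P]] [q [qn qP]] [q1 [_ q1P]] loc.
apply: unit_mono => Z u v uv; rewrite loc in uv.
have {}uv : fmor (inv r) (under u) = fmor (inv r) (under v) := under_eq uv.
apply: slice_morP; apply: product_eq (q1P B) _ _; last by rewrite !underP.
apply: slice_morP; apply: product_eq (q2P B) _ _; last by rewrite !underP.
apply: sep (qP (dom Z)) _ _ _ => /=.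
by rewrite -!cmpA -!qn uv.
Qed.

Lemma separated_pure : has_wide_pullbacks E -> has_coequalizers E -> has_images T ->
  is_mono i -> pure_mono e (Negz 0) i.
Proof.
move=> wp coeq img im; split=> // eU r eUP rP X eX rX eXP rXP B K L j KP [_ jw].
apply: (cohomology_mono (A := inv eX B)) => //.
- by do 2![apply: slice_wide_pullbacks].
- by do 2![apply: slice_coequalizers].
- exact: separated_unit eUP rP eXP rXP.
Qed.

End Separated.

(** * Constructions of geometric morphisms *)

Definition has_terminal (C : category) : Prop := exists I : C, is_terminal I.

Definition has_pullbacks (C : category) : Prop :=
  forall (A B D : C) (f : mor A D) (g : mor B D),
  exists (P : C) (p : mor P A) (q : mor P B), is_pullback f g p q.

(** The right adjoint of the pullback along [i] exists at [y]: [s : R -> U] is its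
   value and [ev] the counit.  It is phrased with arbitrary pullbacks in place of a
   chosen pullback functor. *)
Definition has_dependent_products (C : category) : Prop :=
  forall (V U Y : C) (i : mor V U) (y : mor Y V),
  exists (R P : C) (s : mor R U) (p : mor P R) (v : mor P V) (ev : mor P Y),
    [/\ is_pullback s i p v, y ** ev = v
      & forall (Z Q : C) (z : mor Z U) (q : mor Q Z) (w : mor Q V) (f : mor Q Y),
          is_pullback z i q w -> y ** f = w ->
          exists! g : mor Z R, s ** g = z /\
            forall h : mor Q P, p ** h = g ** q -> v ** h = w -> ev ** h = f].

Lemma wide_pullbacks_pullbacks (C : category) : has_wide_pullbacks C -> has_pullbacks C.
Proof.
move=> wp A B D f g.
have [P [w [p [pw pu]]]] := wp bool D (fun b => if b then A else B)
  (fun b => if b return mor (if b then A else B) D then f else g).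
exists P, (p true), (p false); split=> [|Z a b ab].
  by rewrite (pw true) (pw false).
have [|u [[_ pE] uu]] := pu Z (f ** a)
    (fun b0 => if b0 return mor Z (if b0 then A else B) then a else b).
  by case.
exists u; split; first by split; [exact: (pE true)|exact: (pE false)].
move=> u' [u'a u'b]; apply: uu; split; last by case.
by rewrite -(pw true) -cmpA u'a.
Qed.

Lemma pullback_eq (C : category) (A B D P : C) (f : mor A D) (g : mor B D)
    (p : mor P A) (q : mor P B) Z (u v : mor Z P) :
  is_pullback f g p q -> p ** u = p ** v -> q ** u = q ** v -> u = v.
Proof.
move=> [fg pb] pu qu; apply: ex_unique_eq (pb Z (p ** v) (q ** v) _) _ _ => //.
by rewrite !cmpA fg.
Qed.

(** A geometric morphism with prescribed inverse image functor: only the values of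
   the direct image on objects, with their counits, have to be provided. *)
Lemma geometric_of_adjoint (F E : category) (G : functor E F) : left_exact G ->
  (forall Y : F, exists (R : E) (ev : mor (G R) Y),
     forall X (f : mor (G X) Y), exists! g : mor X R, ev ** fmor G g = f) ->
  exists gm : geometric_morphism F E, inv gm = G.
Proof.
move=> Glex adj.
have /choice[R RP] := adj.
pose ev Y := sval (cid (RP Y)).
have evP Y : forall X (f : mor (G X) Y), exists! g, ev Y ** fmor G g = f.
  exact: (svalP (cid (RP Y))).
pose tr X Y (f : mor (G X) Y) : mor X (R Y) := sval (cid (evP Y X f)).
have trE X Y (f : mor (G X) Y) : ev Y ** fmor G (tr X Y f) = f.
  exact: (proj1 (svalP (cid (evP Y X f)))).
have trU X Y (g h : mor X (R Y)) : ev Y ** fmor G g = ev Y ** fmor G h -> g = h.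
  by move=> gh; exact: ex_unique_eq (evP Y X _) gh erefl.
pose Rm Y Y' (h : mor Y Y') : mor (R Y) (R Y') := tr _ _ (h ** ev Y).
have Rm1 Y : Rm Y Y (idm Y) = idm (R Y).
  by apply: trU; rewrite trE fmor1 cmp1m cmpm1.
have RmM Y Y' Y'' (h : mor Y' Y'') (k : mor Y Y') : Rm _ _ (h ** k) = Rm _ _ h ** Rm _ _ k.
  by apply: trU; rewrite fmorM cmpA !trE -!cmpA trE.
pose D := @Functor F E R Rm Rm1 RmM.
pose un X : mor X (R (G X)) := tr X (G X) (idm (G X)).
have unE X : ev (G X) ** fmor G (un X) = idm (G X) by exact: trE.
have RmE Y Y' (h : mor Y Y') : ev Y' ** fmor G (Rm _ _ h) = h ** ev Y by exact: trE.
have unn X Y (f : mor X Y) : Rm _ _ (fmor G f) ** un X = un Y ** f.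
  by apply: trU; rewrite !fmorM !cmpA RmE unE -cmpA unE cmpm1 cmp1m.
have unu X Y (f : mor X (R Y)) : exists! g : mor (G X) Y, Rm _ _ g ** un X = f.
  exists (ev Y ** fmor G f); split.
    by apply: trU; rewrite (fmorM G (Rm _ _ _)) cmpA RmE -cmpA unE cmpm1.
  by move=> g <-; rewrite fmorM cmpA RmE -cmpA unE cmpm1.
by exists (@GeometricMorphism F E G D Glex un unn unu).
Qed.

(** The universal arrows [n] make [G] a right adjoint, so it preserves limits. *)
Lemma right_adjoint_lex (E F : category) (G : functor E F) :
  (forall Z : F, exists (L : E) (n : mor Z (G L)),
     forall Y (f : mor Z (G Y)), exists! g : mor L Y, fmor G g ** n = f) ->
  left_exact G.
Proof.
move=> adj; split=> [I It Z|A B D P f g p q pb].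
  have [L [n nP]] := adj Z; have [u _] := It L.
  exists (fmor G u ** n); split=> // v _; have [v' [<- _]] := nP _ v.
  by congr (fmor G _ ** _); exact: terminal_eq.
split=> [|Z a b ab]; first by rewrite -!fmorM pb.1.
have [L [n nP]] := adj Z.
have nU Y (h k : mor L Y) : fmor G h ** n = fmor G k ** n -> h = k.
  by move=> hk; exact: ex_unique_eq (nP _ _) hk erefl.
have [a' [aE _]] := nP _ a; have [b' [bE _]] := nP _ b.
have [|u [[pu qu] _]] := pb.2 L a' b'.
  by apply: nU; rewrite !fmorM -!cmpA aE bE.
exists (fmor G u ** n); split; first by rewrite !cmpA -!fmorM pu qu.
move=> v [pv qv]; have [v' [vE _]] := nP _ v; rewrite -vE.
congr (fmor G _ ** _); apply: pullback_eq pb _ _; apply: nU.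
  by rewrite pu aE fmorM -cmpA vE.
by rewrite qu bE fmorM -cmpA vE.
Qed.

Lemma geometric_of_equivalence (F E : category) (G : functor E F) :
  fully_faithful G -> (forall Y : F, exists (R : E) (ev : mor (G R) Y), is_iso ev) ->
  exists gm : geometric_morphism F E, inv gm = G.
Proof.
move=> ff es; apply: geometric_of_adjoint.
  apply: right_adjoint_lex => Z; have [R [ev [n [nev evn]]]] := es Z.
  exists R, n => Y f; have [g [gE gu]] := ff _ _ (f ** ev).
  exists g; split=> [|h hf]; first by rewrite gE -cmpA evn cmpm1.
  by apply: gu; rewrite -hf -cmpA nev cmpm1.
move=> Y; have [R [ev [n [nev evn]]]] := es Y.
exists R, ev => X f; have [g [gE gu]] := ff _ _ (n ** f).
exists g; split=> [|h hf]; first by rewrite gE cmpA evn cmp1m.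
by apply: gu; rewrite -hf cmpA nev cmp1m.
Qed.

Definition functor_cmp (C D E : category) (G : functor D E) (F : functor C D) :
  functor C E.
Proof.
refine (@Functor C E (fun X => G (F X)) (fun X Y f => fmor G (fmor F f)) _ _) => *.
- by rewrite !fmor1.
- by rewrite !fmorM.
Defined.

Definition geometric_cmp (F E T : category) (r : geometric_morphism F E)
  (e : geometric_morphism E T) : geometric_morphism F T.
Proof.
refine (@GeometricMorphism F T (functor_cmp (inv r) (inv e))
  (functor_cmp (dir e) (dir r)) _
  (fun X => fmor (dir e) (unit r (inv e X)) ** unit e X) _ _).
- have [et ep] := inv_lex e; have [rt rp] := inv_lex r.
  by split=> [I /et/rt//|A B D P f g p q /ep/rp].
- by move=> X Y f /=; rewrite cmpA -fmorM unit_nat fmorM -!cmpA unit_nat.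
move=> X A f; have [g [gE gu]] := unit_univ f.
have [h [hE hu]] := unit_univ g.
exists h; split=> [|h' h'f]; first by rewrite /= cmpA -fmorM hE.
by apply: hu; apply: (dir_unit_eq (r := e)); rewrite gE fmorM -cmpA.
Defined.

Lemma slice_terminalP (C : category) (X : C) (I : slice C X) :
  is_terminal I <-> is_iso (str I).
Proof.
pose one : slice C X := SliceOb (idm X).
split=> [It|[g [gs sg]] Z]; last first.
  have uP : str I ** (g ** str Z) = str Z by rewrite cmpA sg cmp1m.
  exists (@SliceMor _ _ Z I (g ** str Z) uP); split=> // u _.
  by apply: slice_morP => /=; rewrite -(underP u) cmpA gs cmp1m.
have [u _] := It one; exists (under u); split; last exact: underP u.
pose s : mor I one := @SliceMor _ _ I one (str I) (cmp1m _).
exact: (under_eq (terminal_eq (u ** s) (idm I) It)).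
Qed.

Lemma fmor_iso (C D : category) (F : functor C D) X Y (f : mor X Y) :
  is_iso f -> is_iso (fmor F f).
Proof. by move=> [g [gf fg]]; exists (fmor F g); rewrite -!fmorM gf fg !fmor1. Qed.

Lemma slice_functor_lex (C D : category) (F : functor C D) (X : C) :
  left_exact F -> left_exact (slice_functor F X).
Proof.
move=> [_ Fp]; split=> [I /slice_terminalP si|A B E P f g p q pb].
  by apply/slice_terminalP; exact: fmor_iso.
have pb' : is_pullback (under f) (under g) (under p) (under q).
  split=> [|Z a b ab]; first exact: (under_eq pb.1).
  have bP : str B ** b = str A ** a by rewrite -(underP f) -cmpA ab cmpA underP.
  pose Z' : slice C X := SliceOb (str A ** a).
  have [|u [[pu qu] uu]] := pb.2 Z' (@SliceMor _ _ Z' A a erefl) (@SliceMor _ _ Z' B b bP).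
    exact: slice_morP.
  exists (under u); split; first by split; [exact: (under_eq pu)|exact: (under_eq qu)].
  move=> v [pv qv]; have vP : str P ** v = str A ** a by rewrite -(underP p) -cmpA pv.
  have := uu (@SliceMor _ _ Z' P v vP) _; move=> /(_ _)/(congr1 (@under _ _ _ _)) -> //.
  by split; exact: slice_morP.
have [fg Fu] := Fp _ _ _ _ _ _ _ _ pb'.
split=> [|Z a b ab]; first exact: slice_morP.
have [|u [[pu qu] uu]] := Fu (dom Z) (under a) (under b); first exact: (under_eq ab).
have uP : fmor F (str P) ** u = str Z.
  by rewrite -(underP p) fmorM -cmpA pu; exact: underP a.
exists (@SliceMor _ _ Z (slice_functor F X P) u uP); split.
  by split; exact: slice_morP.
move=> v [pv qv]; apply: slice_morP => /=; apply: uu.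
by split; [exact: (under_eq pv)|exact: (under_eq qv)].
Qed.

(** The direct image of an object over [r^* X] is the pullback of its image under
   [r_*] along the unit at [X]. *)
Lemma localisation_exists (F E : category) (r : geometric_morphism F E) (X : E) :
  has_pullbacks E -> exists rX : geometric_morphism (slice F (inv r X)) (slice E X),
    is_localisation rX.
Proof.
move=> pbs; apply: geometric_of_adjoint; first exact: slice_functor_lex (inv_lex r).
move=> W; have [P [p [x pb]]] := pbs _ _ _ (fmor (dir r) (str W)) (unit r X).
have [p' [p'E _]] := unit_univ p.
have p'P : str W ** p' = fmor (inv r) x.
  by apply: (dir_unit_eq (r := r)); rewrite fmorM -cmpA p'E pb.1 unit_nat.
exists (SliceOb x), (@SliceMor _ _ (slice_functor (inv r) X (SliceOb x)) W p' p'P).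
move=> Z f; have fP : str W ** under f = fmor (inv r) (str Z) := underP f.
have [|g [[pg xg] gu]] := pb.2 (dom Z) (fmor (dir r) (under f) ** unit r (dom Z)) (str Z).
  by rewrite cmpA -fmorM fP unit_nat.
exists (@SliceMor _ _ Z (SliceOb x) g xg); split.
  apply: slice_morP => /=; apply: (dir_unit_eq (r := r)).
  by rewrite fmorM -cmpA unit_nat cmpA p'E pg.
move=> g' g'f; apply: slice_morP => /=; apply: gu; split; last exact: (underP g').
by rewrite -(under_eq g'f) /= fmorM -cmpA unit_nat cmpA p'E.
Qed.

(** * Base change and its right adjoint *)

Section BaseChange.
Variables (C : category) (pbs : has_pullbacks C) (V U : C) (i : mor V U).

Lemma base_change_pullback (Z : slice C U) :
  {P : slice C V & {q : mor (dom P) (dom Z) | is_pullback (str Z) i q (str P)}}.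
Proof.
have /cid[P /cid[p /cid[q pq]]] := pbs (str Z) i.
by exists (SliceOb q), p.
Qed.

Definition base_change_ob (Z : slice C U) : slice C V := projT1 (base_change_pullback Z).
Definition base_change_pr (Z : slice C U) : mor (dom (base_change_ob Z)) (dom Z) :=
  sval (projT2 (base_change_pullback Z)).

Lemma base_changeP (Z : slice C U) :
  is_pullback (str Z) i (base_change_pr Z) (str (base_change_ob Z)).
Proof. exact: (svalP (projT2 (base_change_pullback Z))). Qed.

Lemma base_change_mor_subproof (Y Z : slice C U) (f : mor Y Z) :
  exists g : mor (base_change_ob Y) (base_change_ob Z),
    base_change_pr Z ** under g = under f ** base_change_pr Y.
Proof.
have [|g [[g1 g2] _]] := (base_changeP Z).2 _ (under f ** base_change_pr Y)
    (str (base_change_ob Y)).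
  by rewrite cmpA underP; exact: (base_changeP Y).1.
by exists (@SliceMor _ _ (base_change_ob Y) (base_change_ob Z) g g2).
Qed.

Definition base_change_mor Y Z f := sval (cid (@base_change_mor_subproof Y Z f)).

Lemma base_change_morE Y Z (f : mor Y Z) :
  base_change_pr Z ** under (base_change_mor f) = under f ** base_change_pr Y.
Proof. exact: (svalP (cid (base_change_mor_subproof f))). Qed.

Lemma base_change_eq (Z : slice C V) (Y : slice C U) (f g : mor Z (base_change_ob Y)) :
  base_change_pr Y ** under f = base_change_pr Y ** under g -> f = g.
Proof.
by move=> fg; apply: slice_morP; apply: pullback_eq (base_changeP Y) fg _; rewrite !underP.
Qed.

Definition base_change : functor (slice C U) (slice C V).
Proof.
refine (@Functor _ _ base_change_ob base_change_mor _ _) => *; apply: base_change_eq.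
- by rewrite base_change_morE /= cmp1m cmpm1.
- by rewrite base_change_morE /= cmpA base_change_morE -!cmpA base_change_morE.
Defined.

(** Base change is right adjoint to composition with [i]. *)
Lemma base_change_lex : left_exact base_change.
Proof.
apply: right_adjoint_lex => Z; pose L : slice C U := SliceOb (i ** str Z).
have [|n [[n1 n2] _]] := (base_changeP L).2 _ (idm (dom Z)) (str Z).
  by rewrite cmpm1.
exists L, (@SliceMor _ _ Z (base_change_ob L) n n2) => Y f.
have gP : str Y ** (base_change_pr Y ** under f) = i ** str Z.
  by rewrite cmpA (base_changeP Y).1 -cmpA underP.
exists (@SliceMor _ _ L Y (base_change_pr Y ** under f) gP); split.
  by apply: base_change_eq; rewrite /= cmpA base_change_morE -cmpA n1 cmpm1.
move=> g gf; apply: slice_morP => /=; rewrite -gf /= cmpA base_change_morE.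
by rewrite -cmpA n1 cmpm1.
Qed.

Lemma base_change_geometric : has_dependent_products C ->
  exists gm : geometric_morphism (slice C V) (slice C U), inv gm = base_change.
Proof.
move=> prod; apply: geometric_of_adjoint; first exact: base_change_lex.
move=> Y; have [R [P [s [p [v [ev [pb yev Ru]]]]]]] := prod _ _ _ i (str Y).
pose R' : slice C U := SliceOb s.
have [a [[a1 a2] au]] := pb.2 _ (base_change_pr R') (str (base_change_ob R')) (base_changeP R').1.
have aP : str Y ** (ev ** a) = str (base_change_ob R') by rewrite cmpA yev a2.
exists R', (@SliceMor _ _ (base_change_ob R') Y (ev ** a) aP) => Z f.
have [g [[sg gf] gu]] := Ru _ _ _ _ _ _ (base_changeP Z) (underP f).
exists (@SliceMor _ _ Z R' g sg); split.
  apply: slice_morP => /=; rewrite -cmpA; apply: gf.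
    by rewrite cmpA a1 base_change_morE.
  by rewrite cmpA a2 underP.
move=> g' g'f; apply: slice_morP => /=; apply: gu; split; first exact: underP g'.
move=> h h1 h2; rewrite -(under_eq g'f) /= -cmpA; congr (_ ** _).
apply: pullback_eq pb _ _; first by rewrite h1 cmpA a1 base_change_morE.
by rewrite h2 cmpA a2 underP.
Qed.

End BaseChange.

(** * Coefficients are sheaves for 0-pure monomorphisms *)

Section Structure.
Variables (C : category) (pbs : has_pullbacks C) (term : has_terminal C).
Hypothesis prod : has_dependent_products C.

(** The product with [S] is base change along [S -> 1], preceded by the equivalence
   with the slice over 1. *)
Lemma product_geometric (S : C) : exists (g : geometric_morphism (slice C S) C)
    (q : forall B : C, mor (dom (inv g B)) B),
  (forall (B B' : C) (b : mor B B'), q B' ** under (fmor (inv g) b) = b ** q B) /\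
  (forall B, is_product (q B) (str (inv g B))).
Proof.
have [I It] := term.
have bang X : {u : mor X I | forall v, v = u}.
  by have [u _] := cid (It X); exists u => v; exact: terminal_eq.
pose b X := sval (bang X); have bE X (v : mor X I) : v = b X := svalP (bang X) v.
pose H (X : C) : slice C I := SliceOb (b X).
pose Hm X Y (f : mor X Y) : mor (H X) (H Y) := @SliceMor _ _ (H X) (H Y) f (bE _ _).
have Hm1 X : Hm X X (idm X) = idm (H X) by exact: slice_morP.
have HmM X Y Z (g : mor Y Z) (f : mor X Y) : Hm _ _ (g ** f) = Hm _ _ g ** Hm _ _ f.
  exact: slice_morP.
have [||g1 g1E] := @geometric_of_equivalence (slice C I) C (@Functor _ _ H Hm Hm1 HmM).
- move=> X Y g; exists (under g); split; first exact: slice_morP.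
  by move=> f <-.
- move=> Y; have eP : str Y ** idm (dom Y) = b (dom Y) := bE _ _.
  have nP : b (dom Y) ** idm (dom Y) = str Y by rewrite cmpm1 -(bE _ (str Y)).
  exists (dom Y), (@SliceMor _ _ (H (dom Y)) Y (idm _) eP).
  by exists (@SliceMor _ _ Y (H (dom Y)) (idm _) nP); split; apply: slice_morP; exact: cmp1m.
have [g2 g2E] := base_change_geometric pbs (b S) prod.
exists (geometric_cmp g2 g1); rewrite /= g1E g2E /=.
exists (fun B => base_change_pr pbs (b S) (H B)); split=> [B B' f|B Z u v].
  exact: (base_change_morE pbs (b S) (Hm _ _ f)).
have [|w [wP wu]] := (base_changeP pbs (b S) (H B)).2 Z u v.
  by rewrite [LHS]bE [RHS]bE.
by exists w.
Qed.

(** An object over [X] in the slice over [U] is an object over [dom X], its map to [U]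
   being determined. *)
Section SliceSlice.
Variables (U : C) (X : slice C U).

Definition slice_slice_ob (Y : slice C (dom X)) : slice (slice C U) X :=
  @SliceOb (slice C U) X (SliceOb (str X ** str Y))
    (@SliceMor _ _ (SliceOb (str X ** str Y)) X (str Y) erefl).

Lemma slice_slice_mor_subproof (Y Z : slice C (dom X)) (f : mor Y Z) :
  str X ** str Z ** under f = str X ** str Y.
Proof. by rewrite -cmpA underP. Qed.

Definition slice_slice_mor1 (Y Z : slice C (dom X)) (f : mor Y Z) :
  mor (dom (slice_slice_ob Y)) (dom (slice_slice_ob Z)) :=
  @SliceMor _ _ (dom (slice_slice_ob Y)) (dom (slice_slice_ob Z)) (under f)
    (slice_slice_mor_subproof f).

Lemma slice_slice_mor_over (Y Z : slice C (dom X)) (f : mor Y Z) :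
  str (slice_slice_ob Z) ** slice_slice_mor1 f = str (slice_slice_ob Y).
Proof. by apply: slice_morP; exact: (underP f). Qed.

Definition slice_slice_mor (Y Z : slice C (dom X)) (f : mor Y Z) :
  mor (slice_slice_ob Y) (slice_slice_ob Z) :=
  @SliceMor _ _ (slice_slice_ob Y) (slice_slice_ob Z) (slice_slice_mor1 f)
    (slice_slice_mor_over f).

Definition slice_slice : functor (slice C (dom X)) (slice (slice C U) X).
Proof.
by refine (@Functor _ _ slice_slice_ob slice_slice_mor _ _) => *;
  do 2![apply: slice_morP].
Defined.

Lemma slice_slice_geometric :
  exists gm : geometric_morphism (slice (slice C U) X) (slice C (dom X)),
    inv gm = slice_slice.
Proof.
apply: geometric_of_equivalence => [Y Z g|Y].
  have gP : str Z ** under (under g) = str Y := under_eq (underP g).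
  exists (@SliceMor _ _ Y Z (under (under g)) gP); split.
    by do 2![apply: slice_morP].
  by move=> f fg; apply: slice_morP => /=; rewrite -(under_eq (under_eq fg)).
pose R : slice C (dom X) := SliceOb (under (str Y)).
have p1 : str (dom Y) ** idm (dom (dom Y)) = str X ** under (str Y).
  by rewrite cmpm1 underP.
have p2 : str X ** under (str Y) ** idm (dom (dom Y)) = str (dom Y).
  by rewrite cmpm1 underP.
pose v : mor (dom (slice_slice R)) (dom Y) :=
  @SliceMor _ _ (dom (slice_slice R)) (dom Y) (idm (dom (dom Y))) p1.
pose w : mor (dom Y) (dom (slice_slice R)) :=
  @SliceMor _ _ (dom Y) (dom (slice_slice R)) (idm (dom (dom Y))) p2.
have vP : str Y ** v = str (slice_slice R) by apply: slice_morP; exact: cmpm1.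
have wP : str (slice_slice R) ** w = str Y by apply: slice_morP; exact: cmpm1.
exists R, (@SliceMor _ _ (slice_slice R) Y v vP), (@SliceMor _ _ Y (slice_slice R) w wP).
by split; do 2![apply: slice_morP]; exact: cmp1m.
Qed.

End SliceSlice.

Variables (T : category) (e : geometric_morphism C T).

Lemma slice_structure_exists (U : C) :
  exists eU : geometric_morphism (slice C U) T, is_slice_structure e eU.
Proof.
have [g [q [qn qP]]] := product_geometric U.
by exists (geometric_cmp g e), (fun B => q (inv e B)); split=> *; [exact: qn|exact: qP].
Qed.

Lemma slice_slice_structure_exists (U : C) (eU : geometric_morphism (slice C U) T)
    (X : slice C U) : is_slice_structure e eU ->
  exists eX : geometric_morphism (slice (slice C U) X) T, is_slice_structure eU eX.
Proof.
move=> [qU [qUn qUP]].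
have [g [q [qn qP]]] := product_geometric (dom X).
have [h hE] := slice_slice_geometric X.
exists (geometric_cmp h (geometric_cmp g e)); rewrite /is_slice_structure /= hE /=.
pose D B : slice C U := SliceOb (str X ** str (inv g (inv e B))).
have wP B : {w : mor (D B) (inv eU B) | qU B ** under w = q (inv e B)}.
  have /cid[w [[w1 w2] _]] := qUP B (dom (D B)) (q (inv e B)) (str (D B)).
  by exists (@SliceMor _ _ (D B) (inv eU B) w w2).
pose w B := sval (wP B); have wE B : qU B ** under (w B) = q (inv e B) := svalP (wP B).
exists w; split=> [B B' b|B Z a x].
  apply: slice_morP; apply: product_eq (qUP B') _ _; last by rewrite !underP.
  rewrite /= [RHS]cmpA qUn -[RHS]cmpA wE.
  by rewrite [LHS]cmpA wE qn.
have [u [[u1 u2] uu]] := qP (inv e B) (dom Z) (qU B ** under a) (under x).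
have uP : str X ** str (inv g (inv e B)) ** u = str Z.
  by rewrite -cmpA u2 underP.
exists (@SliceMor _ _ Z (D B) u uP); split.
  split; apply: slice_morP => //=.
  apply: product_eq (qUP B) _ _; first by rewrite cmpA wE.
  by rewrite cmpA (underP (w B)) (underP a).
move=> v [va vx]; apply: slice_morP => /=; apply: uu; split; last exact: (under_eq vx).
by rewrite -(under_eq va) /= cmpA wE.
Qed.

End Structure.

Section Orthogonal.
Variables (C T : category) (e : geometric_morphism C T).
Hypotheses (wp : has_wide_pullbacks C) (term : has_terminal C).
Hypotheses (coeq : has_coequalizers C) (prod : has_dependent_products C).
Hypothesis termT : has_terminal T.

(** Transposed along [r] and then along [d], the action of [r^*] on maps from [d^* Z]
   to [A] becomes the composition with the image of the unit under [d_*]. *)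
Lemma iso_unit_full (F E : category) (r : geometric_morphism F E)
    (d : geometric_morphism E T) (A : E) (Z : T) :
  is_iso (fmor (dir d) (unit r A)) ->
  forall h : mor (inv r (inv d Z)) (inv r A), exists! k, fmor (inv r) k = h.
Proof.
move=> [g [gu ug]] h.
pose h1 := fmor (dir r) h ** unit r (inv d Z).
have [k [kE ku]] := unit_univ (g ** (fmor (dir d) h1 ** unit d Z)).
have h1E : unit r A ** k = h1.
  by apply: (dir_unit_eq (r := d)); rewrite fmorM -cmpA kE cmpA ug cmp1m.
exists k; split; first by apply: (dir_unit_eq (r := r)); rewrite unit_nat h1E.
move=> k' k'h; apply: ku.
by rewrite /h1 -k'h unit_nat fmorM -cmpA [RHS]cmpA gu cmp1m.
Qed.

Lemma full_iso (F E : category) (G : functor E F) (A X Y : E) (a : mor X Y) :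
  is_iso a ->
  (forall h : mor (G Y) (G A), exists! k, fmor G k = h) ->
  forall h : mor (G X) (G A), exists! k, fmor G k = h.
Proof.
move=> [b [ba ab]] full h; have [k [kE ku]] := full (h ** fmor G b).
exists (k ** a); split; first by rewrite fmorM kE -cmpA -fmorM ba fmor1 cmpm1.
move=> k' k'h; have -> : k = k' ** b by apply: ku; rewrite fmorM k'h.
by rewrite -cmpA ba cmpm1.
Qed.

(** The constant simplicial object at [A] is a [K(A, 0)], and so is its inverse
   image; the map between their cohomologies in degree 0 is the direct image of the
   unit at [A]. *)
Lemma pure0_iso_unit (F E : category) (r : geometric_morphism F E)
    (d : geometric_morphism E T) (A : E) : has_coequalizers E -> has_coequalizers F ->
  (forall (K : simplicial E) (L : simplicial F) (j : simplicial_map (sfun (inv r) K) L),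
    is_K0 A K -> fibrant_replacement j -> cohomology_map d (@is_iso T) j) ->
  is_iso (fmor (dir d) (unit r A)).
Proof.
move=> coE coF pure; pose K := constant_simplicial A.
have dK : discrete K := @constant_simplicial_discrete E A.
have dL : discrete (sfun (inv r) K) := sfun_discrete (inv r) dK.
have iso := pure K _ (smap_id (sfun (inv r) K)) (discrete_is_K0 dK coE)
  (conj (discrete_fibrant dL coF) (discrete_id_weq dL)).
have d1 : discrete (sfun (dir d) K) := sfun_discrete _ dK.
have d2 : discrete (sfun (dir d) (sfun (dir r) (sfun (inv r) K))).
  by do 2![apply: sfun_discrete].
apply: iso (discrete_sheafification d1) (discrete_sheafification d2) _ _ => Z s /=.
by rewrite /pi0_map /= fmor1 !cmp1m.
Qed.

(** Purity is used at the object [X] of the slice given by [z].  The terminal object of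
   the slice over [X] is the inverse image of that of [T], so that the restriction of
   maps from it to the coefficients is bijective by [iso_unit_full]; such maps and
   their restrictions are maps from [Z] and [Z'] to [e^* B]. *)
Lemma pure_orthogonal (V U : C) (i : mor V U) : pure_mono e 0 i ->
  forall (B : T) (Z Z' : C) (z : mor Z U) (q : mor Z' Z) (v : mor Z' V),
  is_pullback z i q v ->
  forall f : mor Z' (inv e B), exists! g : mor Z (inv e B), g ** q = f.
Proof.
move=> [_ pure] B Z Z' z q v pb f.
have pbs := wide_pullbacks_pullbacks wp.
have [eU eUP] := slice_structure_exists pbs term prod e U.
have [r rE] := base_change_geometric pbs i prod.
have rP : is_slice_change i r.
  rewrite /is_slice_change rE; exists (base_change_pr pbs i); split=> [Y Y' h|Y].
    exact: base_change_morE.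
  exact: base_changeP.
pose X : slice C U := SliceOb z.
have [eX eXP] := slice_slice_structure_exists pbs term prod X eUP.
have [rX rXP] := localisation_exists r X (wide_pullbacks_pullbacks (slice_wide_pullbacks wp)).
have [p0 _] := pure eU r eUP rP.
have [I It] := termT.
have tI : is_terminal (inv eX I) by exact: (inv_lex eX).1.
pose X1 : slice (slice C U) X := SliceOb (idm X).
have X1t : is_terminal X1.
  by apply/slice_terminalP; exists (idm X); rewrite cmp1m.
have [a _] := tI X1.
have full := full_iso (terminal_iso a X1t tI) (iso_unit_full (pure0_iso_unit
  (slice_coequalizers (slice_coequalizers coeq)) (slice_coequalizers (slice_coequalizers coeq))
  (fun K L j => p0 X eX rX eXP rXP B K L j))).
rewrite rXP in full.
have [qU [_ qUP]] := eUP; have [qr [qrn qrP]] := rP; have [qX [_ qXP]] := eXP.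
pose A := inv eX B; pose F0 N (n : mor N (dom A)) : mor (dom N) (inv e B) :=
  qU B ** under (qX B ** n).
have pairing (N : slice C U) (g : mor (dom N) (inv e B)) (x : mor N X) :
    exists! n : mor N (dom A), F0 N n = g /\ str A ** n = x.
  have [n1 [[n1g n1s] _]] := qUP B (dom N) g (str N).
  have [n [[n2 n3] nu]] := qXP B N (@SliceMor _ _ N (inv eU B) n1 n1s) x.
  exists n; split; first by rewrite /F0 n2.
  move=> m [mg mx]; apply: nu; split=> //.
  apply: slice_morP => /=; apply: product_eq (qUP B) _ _; first by rewrite n1g.
  by rewrite n1s (underP (qX B ** m)).
have F0M N N' (n : mor N (dom A)) (h : mor N' N) : F0 _ (n ** h) = F0 _ n ** under h.
  by rewrite /F0 /= !cmpA.
(* [Z'] is identified with the pullback chosen by [r] through [al] and [be] *)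
pose Y' : C := dom (inv r X).
have [be [[qbe vbe] _]] := pb.2 Y' (qr X) (str (inv r X)) (qrP X).1.
have [al [[qal val_] _]] := (qrP X).2 Z' q v pb.1.
have beal : be ** al = idm Z'.
  by apply: pullback_eq pb _ _; rewrite cmpA cmpm1 ?qbe ?vbe.
pose N : slice C U := SliceOb (z ** qr X).
pose x : mor N X := @SliceMor _ _ N X (qr X) erefl.
have [n [[nF nx] nu]] := pairing N (f ** be) x.
have sn : str (dom A) ** under n = i ** str (inv r X).
  by rewrite (underP n) -(qrP X).1.
have [h0 [[h1 h2] _]] := (qrP (dom A)).2 Y' (under n) (str (inv r X)) sn.
pose h : mor (inv r X) (inv r (dom A)) := @SliceMor _ _ (inv r X) (inv r (dom A)) h0 h2.
have hP : fmor (inv r) (str A) ** h = fmor (inv r) (idm X).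
  rewrite fmor1; apply: slice_morP; apply: pullback_eq (qrP X) _ _; last by rewrite !underP.
  have nx1 : under (str A) ** under n = qr X := under_eq nx.
  by rewrite /= cmpA qrn -cmpA h1 cmpm1 nx1.
have [k [kE ku]] := full (@SliceMor _ _ (slice_functor (inv r) X X1)
  (slice_functor (inv r) X A) h hP).
have kX (l : mor X1 A) : str A ** under l = idm X := underP l.
have lq (l : mor X1 A) : F0 _ (under l) ** q = F0 _ (under l ** x) ** al.
  by rewrite F0M -cmpA qal.
have kn : under k ** x = n.
  apply: (ex_unique_eq (pairing N (f ** be) x)) => //; split.
    rewrite -nF /F0; congr (_ ** _); rewrite /=; congr (_ ** _).
    have k0 : under (fmor (inv r) (under k)) = h0 := under_eq (under_eq kE).
    by rewrite -[RHS]h1 -k0 qrn.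
  by rewrite cmpA kX cmp1m.
exists (F0 _ (under k)); split; first by rewrite lq kn nF -cmpA beal cmpm1.
move=> g gq; have [l0 [[l0g l0x] _]] := pairing X g (idm X).
pose l : mor X1 A := @SliceMor _ _ X1 A l0 l0x.
have ln : under l ** x = n.
  apply: (ex_unique_eq (pairing N (f ** be) x)) => //; split; last by rewrite cmpA kX cmp1m.
  by rewrite F0M /= l0g -gq -cmpA qbe.
rewrite (ku l) //; do 2![apply: slice_morP].
apply: pullback_eq (qrP (dom A)) _ _; last by rewrite h2; exact: underP.
by rewrite /= h1 qrn -ln.
Qed.

End Orthogonal.

(** * Limits, quotients and dependent products of sheaves *)

Section Sheaves.
Variable X : topologicalType.

Definition shm (A B : Sh X) (f : mor A B) : sheaf_map A B := f.

Lemma sheaf_eq_local (A : sheaf X) (U : opens X) (D : opens X -> Prop) (s t : A U) :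
  (forall x, U x -> exists2 V, D V & V x) ->
  (forall (V : opens X) (h : V `<=` U), D V -> rst A h s = rst A h t) ->
  (forall V, D V -> V `<=` U) -> s = t.
Proof.
move=> cov st DU; apply: sheaf_separated => x /cov[V dV Vx].
by exists V, (DU V dV); split=> //; exact: st.
Qed.

Lemma Sh_terminal : has_terminal (Sh X).
Proof.
pose T := sheaf_of_open (@Opens X setT openT).
exists (T : Sh X) => Z.
have top (U : opens X) : U `<=` @Opens X setT openT by [].
have nat (U V : opens X) (h : V `<=` U) (s : (Z : sheaf X) U) :
    rst T h (top U : T U) = top V.
  exact: (@Prop_irrelevance (V `<=` @Opens X setT openT)).
exists (@SheafMap X Z T (fun U _ => top U) nat); split=> // u _.
by apply: sheaf_mapP => U s; exact: (@Prop_irrelevance (U `<=` @Opens X setT openT)).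
Qed.

Section WidePullback.
Variables (I : Type) (B : sheaf X) (Y : I -> sheaf X) (f : forall i, sheaf_map (Y i) B).

Record fibre_sec (U : opens X) := FibreSec {
  fbase : B U;
  ffam : forall i, Y i U;
  ffamP : forall i, f i U (ffam i) = fbase
}.

Lemma fibre_sec_eq U (s t : fibre_sec U) :
  fbase s = fbase t -> (forall i, ffam s i = ffam t i) -> s = t.
Proof.
case: s t => b s sP [b' t tP] /= e st; case: b' / e tP => tP.
have e : s = t := functional_extensionality_dep st.
by case: t / e tP {st} => tP; congr FibreSec; exact: Prop_irrelevance.
Qed.

Definition fibre_rst (U V : opens X) (h : V `<=` U) (s : fibre_sec U) : fibre_sec V.
Proof.
refine (@FibreSec V (rst B h (fbase s)) (fun i => rst (Y i) h (ffam s i)) _).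
by move=> i; rewrite -shf_nat ffamP.
Defined.

Definition fibre_sheaf : sheaf X.
Proof.
refine (@Sheaf X fibre_sec fibre_rst _ _ _).
- by move=> U h s; apply: fibre_sec_eq => [|i]; exact: rst_id.
- by move=> U V W h k l s; apply: fibre_sec_eq => [|i]; exact: rst_rst.
move=> U D s DU cov comp.
have [|b [bP bu]] := @sheaf_glue X B U D (fun V d => fbase (s V d)) DU cov.
  by move=> V V' d d' W h h'; exact: (congr1 (@fbase W) (comp V V' d d' W h h')).
have gl i : exists! t : Y i U, forall V (d : D V) (h : V `<=` U), rst (Y i) h t = ffam (s V d) i.
  apply: sheaf_glue => // V V' d d' W h h'.
  exact: (congr1 (fun z : fibre_sec W => ffam z i) (comp V V' d d' W h h')).
pose t i := sval (cid (gl i)); have [tP tu] := all_and2 (fun i => svalP (cid (gl i))).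
have ft i : f i U (t i) = b.
  apply: (sheaf_eq_local cov _ DU) => V h d.
  by rewrite shf_nat (tP i V d h) ffamP bP.
exists (FibreSec ft); split=> [V d h|t' t'P].
  by apply: fibre_sec_eq => [|i]; [exact: bP|exact: tP].
apply: fibre_sec_eq => [|i] /=.
  by apply: bu => V d h; rewrite -(t'P V d h).
by apply: tu => V d h; rewrite -(t'P V d h).
Defined.

End WidePullback.

Lemma Sh_wide_pullbacks : has_wide_pullbacks (Sh X).
Proof.
move=> I B Y f; pose P := @fibre_sheaf I B Y f.
exists (P : Sh X), (@SheafMap X P B (fun U s => fbase s) (fun _ _ _ _ => erefl)),
  (fun i => @SheafMap X P (Y i) (fun U s => ffam s i) (fun _ _ _ _ => erefl)).
split=> [i|Z w g fg]; first by apply: sheaf_mapP => U s /=; exact: ffamP.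
have uP (U : opens X) (s : (Z : sheaf X) U) i :
    shm (f i) U (shm (g i) U s) = shm w U s.
  exact: (@sheaf_map_eq X Z B _ _ U s (fg i)).
pose u (U : opens X) (s : (Z : sheaf X) U) : P U := @FibreSec I B Y f U _ _ (uP U s).
have un (U V : opens X) (h : V `<=` U) (s : (Z : sheaf X) U) :
    rst P h (u U s) = u V (rst Z h s).
  by apply: fibre_sec_eq => [|i] /=; exact: shf_nat.
exists (@SheafMap X Z P u un); split; first by split=> [|i]; exact: sheaf_mapP.
move=> v [vw vg]; apply: sheaf_mapP => U s; apply: fibre_sec_eq => [|i] /=.
  by rewrite -vw.
by rewrite -(vg i).
Qed.

(** The sections of the quotient of [P] by [E] are the families of classes of germs
   which locally come from a section of [P]. *)
Section Quotient.
Variables (P : sheaf X) (E : forall U : opens X, P U -> P U -> Prop).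
Hypothesis Erefl : forall U (a : P U), E a a.
Hypothesis Esym : forall U (a b : P U), E a b -> E b a.
Hypothesis Etrans : forall U (a b c : P U), E a b -> E b c -> E a c.
Hypothesis Erst : forall (U V : opens X) (h : V `<=` U) a b,
  E a b -> E (rst P h a) (rst P h b).

Definition near_eq (x : X) (V W : opens X) (b : P V) (c : P W) : Prop :=
  exists (O : opens X) (h : O `<=` V) (k : O `<=` W), O x /\ E (rst P h b) (rst P k c).

Definition germ_class (x : X) (V : opens X) (b : P V) : set {W : opens X & P W} :=
  [set c | near_eq x b (projT2 c)].

Lemma near_eq_trans x (U V W : opens X) (a : P U) (b : P V) (c : P W) :
  near_eq x a b -> near_eq x b c -> near_eq x a c.
Proof.
move=> [O [h [k [Ox e]]]] [O' [h' [k' [Ox' e']]]].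
have l : open_cap O O' `<=` O by move=> z [].
have l' : open_cap O O' `<=` O' by move=> z [].
exists (open_cap O O'), (subset_trans l h), (subset_trans l' k'); split=> //.
rewrite -(rst_rst h l) -(rst_rst k' l').
apply: (Etrans (Erst l e)); apply: Esym; apply: (Etrans (Erst l' (Esym e'))).
by rewrite (rst_rst h' l' (subset_trans l k)) (rst_rst k l (subset_trans l k)).
Qed.

Lemma near_eq_sym x (V W : opens X) (b : P V) (c : P W) : near_eq x b c -> near_eq x c b.
Proof. by move=> [O [h [k [Ox e]]]]; exists O, k, h; split=> //; exact: Esym. Qed.

Lemma germ_classP x (V W : opens X) (b : P V) (c : P W) : W x ->
  germ_class x b = germ_class x c <-> near_eq x b c.
Proof.
move=> Wx; split=> [e|bc].
  have : germ_class x c (existT _ W c).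
    by exists W, (@subset_refl _ W), (@subset_refl _ W); split=> //; exact: Erefl.
  by rewrite -e.
apply/seteqP; split=> d; rewrite /germ_class /=; last exact: near_eq_trans.
by apply: near_eq_trans; exact: near_eq_sym.
Qed.

Record quot_sec (U : opens X) := QuotSec {
  qval : forall x, U x -> set {W : opens X & P W};
  qvalP : forall x, U x -> exists (V : opens X) (b : P V),
    V x /\ forall z (Uz : U z), V z -> qval Uz = germ_class z b
}.

Lemma quot_sec_eq U (s t : quot_sec U) :
  (forall x (Ux : U x), qval s Ux = qval t Ux) -> s = t.
Proof.
case: s t => s sP [t tP] /= st.
have e : s = t by apply: functional_extensionality_dep => x; apply/funext => Ux.
by case: t / e tP {st} => tP; congr QuotSec; exact: Prop_irrelevance.
Qed.

Definition quot_rst (U V : opens X) (h : V `<=` U) (s : quot_sec U) : quot_sec V.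
Proof.
refine (@QuotSec V (fun x Vx => qval s (h x Vx)) _) => x Vx.
by have [W [b [Wx e]]] := qvalP s (h x Vx); exists W, b; split=> // z Vz; exact: e.
Defined.

Definition quotient : sheaf X.
Proof.
refine (@Sheaf X quot_sec quot_rst _ _ _).
- move=> U h s; apply: quot_sec_eq => x Ux /=; congr qval; exact: Prop_irrelevance.
- move=> U V W h k l s; apply: quot_sec_eq => x Ux /=; congr qval.
  exact: Prop_irrelevance.
move=> U D s DU cov comp.
have comp' V V' (d : D V) (d' : D V') x (Vx : V x) (V'x : V' x) :
    qval (s V d) Vx = qval (s V' d') V'x.
  have h : open_cap V V' `<=` V by move=> z [].
  have h' : open_cap V V' `<=` V' by move=> z [].
  have /(congr1 (fun t => qval t (conj Vx V'x : open_cap V V' x))) /= e :=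
    comp V V' d d' _ h h'.
  by apply: (etrans (etrans _ e)); congr qval; exact: Prop_irrelevance.
have ch x (Ux : U x) : {g | forall V (d : D V) (Vx : V x), qval (s V d) Vx = g}.
  have [V d Vx] := cid2 (cov x Ux).
  by exists (qval (s V d) Vx) => V' d' V'x; exact: comp'.
pose v x Ux := sval (ch x Ux).
have vE V (d : D V) x (Ux : U x) (Vx : V x) : v x Ux = qval (s V d) Vx.
  by rewrite (svalP (ch x Ux) V d Vx).
have vP x : U x -> exists (V : opens X) (b : P V),
    V x /\ forall z (Uz : U z), V z -> v z Uz = germ_class z b.
  move=> Ux; have [V d Vx] := cov x Ux; have [W [b [Wx e]]] := qvalP (s V d) Vx.
  have h : open_cap W V `<=` W by move=> z [].
  exists (open_cap W V), (rst P h b); split=> // z Uz [Wz Vz].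
  rewrite (vE V d z Uz Vz) e //; apply/germ_classP => //.
  exists (open_cap W V), h, (@subset_refl _ _); split=> //.
  by rewrite rst_id; exact: Erefl.
exists (QuotSec vP); split.
  by move=> V d h; apply: quot_sec_eq => x Vx /=; exact: vE.
move=> t tP; apply: quot_sec_eq => x Ux /=; have [V d Vx] := cov x Ux.
rewrite (vE V d x Ux Vx) -(tP V d (DU V d)) /=; congr qval.
exact: Prop_irrelevance.
Defined.

Lemma quot_of_subproof (U : opens X) (a : P U) x : U x ->
  exists (V : opens X) (b : P V), V x /\ forall z, U z -> V z -> germ_class z a = germ_class z b.
Proof. by move=> Ux; exists U, a. Qed.

Definition quot_map : sheaf_map P quotient.
Proof.
refine (@SheafMap X P quotient (fun U a => QuotSec (quot_of_subproof a)) _).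
move=> U V h a; apply: quot_sec_eq => x Vx /=; apply/germ_classP => //.
exists V, h, (@subset_refl _ _); split=> //; rewrite rst_id; exact: Erefl.
Defined.

Lemma quot_map_eq (U : opens X) (a b : P U) : E a b -> quot_map U a = quot_map U b.
Proof.
move=> ab; apply: quot_sec_eq => x Ux /=; apply/germ_classP => //.
by exists U, (@subset_refl _ _), (@subset_refl _ _); rewrite !rst_id.
Qed.

Lemma quot_map_local (U : opens X) (a b : P U) x :
  quot_map U a = quot_map U b -> U x ->
  exists (V : opens X) (h : V `<=` U), V x /\ E (rst P h a) (rst P h b).
Proof.
move=> /(congr1 (fun q : quot_sec U => @qval U q)) ab Ux.
have /germ_classP : germ_class x a = germ_class x b.
  exact: (congr1 (fun g : (forall z, U z -> _) => g x Ux) ab).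
move=> /(_ Ux)[O [h [k [Ox e]]]]; exists O, h; split=> //.
by rewrite (Prop_irrelevance k h) in e.
Qed.

Lemma quot_map_surj (U : opens X) (s : quotient U) x : U x ->
  exists (V : opens X) (h : V `<=` U) (a : P V), V x /\ rst quotient h s = quot_map V a.
Proof.
move=> Ux; have [V [b [Vx e]]] := qvalP s Ux.
have h : open_cap V U `<=` U by move=> z [].
have k : open_cap V U `<=` V by move=> z [].
exists (open_cap V U), h, (rst P k b); split=> //.
apply: quot_sec_eq => z [Vz Uz] /=; rewrite e //; apply/germ_classP => //.
by exists (open_cap V U), k, (@subset_refl _ _); split=> //; rewrite rst_id; exact: Erefl.
Qed.

(** A section of the quotient locally lifts to [P]; the images of the local lifts
   in [B] do not depend on the lifts, hence glue. *)
Lemma quotient_factor (B : sheaf X) (t : sheaf_map P B) :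
  (forall U (a b : P U), E a b -> t U a = t U b) ->
  exists k : sheaf_map quotient B, forall U a, k U (quot_map U a) = t U a.
Proof.
move=> tE.
have tq (U : opens X) (a b : P U) : quot_map U a = quot_map U b -> t U a = t U b.
  move=> ab; apply: sheaf_separated => x /(quot_map_local ab)[V [h [Vx e]]].
  by exists V, h; split=> //; rewrite !shf_nat; exact: tE.
pose R (U : opens X) (s : quotient U) (O : opens X) (r : B O) :=
  exists (h : O `<=` U) (a : P O), rst quotient h s = quot_map O a /\ r = t O a.
have ex U (s : quotient U) : exists r : B U,
    forall (O : opens X) (h : O `<=` U) r', R U s O r' -> rst B h r = r'.
  apply: sheaf_local_glue.
  - move=> O O' h _ [k [a [e ->]]]; exists (subset_trans h k), (rst P h a).
    split; last exact: shf_nat.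
    by rewrite -shf_nat -e; apply/esym/rst_rst.
  - move=> O _ _ [k [a [e ->]]] [k' [a' [e' ->]]]; apply: tq.
    by rewrite -e -e' (Prop_irrelevance k k').
  - move=> x Ux; have [V [h [a [Vx e]]]] := quot_map_surj s Ux.
    by exists V, (t V a); split=> //; exists h, a.
pose k U s := sval (cid (ex U s)); have kP U s := svalP (cid (ex U s)).
have kE U a : k U (quot_map U a) = t U a.
  rewrite -[LHS](rst_id (@subset_refl _ U)); apply: kP.
  by exists (@subset_refl _ U), a; rewrite rst_id.
have kn (U V : opens X) (h : V `<=` U) (s : quotient U) :
    rst B h (k U s) = k V (rst quotient h s).
  apply: sheaf_separated => x Vx.
  have [W [l [a [Wx e]]]] := quot_map_surj (rst quotient h s) Vx.
  have e' : rst quotient (subset_trans l h) s = quot_map W a.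
    by rewrite -e; apply/esym/rst_rst.
  exists W, l; split=> //; rewrite (rst_rst h l (subset_trans l h)).
  rewrite (kP U s W _ (t W a)); last by exists (subset_trans l h), a.
  by apply/esym/kP; exists l, a.
by exists (SheafMap kn).
Qed.

Lemma quotient_epi (B : sheaf X) (k k' : sheaf_map quotient B) :
  (forall U a, k U (quot_map U a) = k' U (quot_map U a)) -> k = k'.
Proof.
move=> kk; apply: sheaf_mapP => U s; apply: sheaf_separated => x Ux.
have [V [h [a [Vx e]]]] := quot_map_surj s Ux.
by exists V, h; split=> //; rewrite !shf_nat e.
Qed.

End Quotient.

Lemma Sh_coequalizers : has_coequalizers (Sh X).
Proof.
move=> A B f g.
(* the equivalence relation generated by [f] and [g] relates the sections which all
   maps coequalizing [f] and [g] identify *)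
pose E (U : opens X) (a b : (B : sheaf X) U) := forall (D : sheaf X) (h : sheaf_map B D),
  (forall V s, h V (shm f V s) = h V (shm g V s)) -> h U a = h U b.
have Er U a : E U a a by [].
have Es U a b : E U a b -> E U b a by move=> ab D h hfg; apply/esym/ab.
have Et U a b c : E U a b -> E U b c -> E U a c.
  by move=> ab bc D h hfg; apply: (etrans (ab D h hfg)); exact: bc.
have Eh (U V : opens X) (h : V `<=` U) a b : E U a b -> E V (rst B h a) (rst B h b).
  by move=> ab D k kfg; rewrite -!shf_nat (ab D k).
pose q := @quot_map B E Er Es Et Eh.
exists (@quotient B E Er Es Et Eh : Sh X), q; split.
  by apply: sheaf_mapP => U s; apply: quot_map_eq => D h hfg; exact: hfg.
move=> D h hfg; have [|k kE] := @quotient_factor B E Er Es Et Eh D h.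
  by move=> U a b; apply => V s; exact: (sheaf_map_eq s hfg).
exists k; split; first exact: sheaf_mapP.
by move=> k' k'h; apply: quotient_epi => U a; rewrite kE; apply/esym/(sheaf_map_eq a k'h).
Qed.

Lemma Sh_images : has_images (Sh X).
Proof.
move=> P Q f.
pose E (U : opens X) (a b : (P : sheaf X) U) := shm f U a = shm f U b.
have Er U a : E U a a by [].
have Es U a b : E U a b -> E U b a by [].
have Et U a b c : E U a b -> E U b c -> E U a c by exact: etrans.
have Eh (U V : opens X) (h : V `<=` U) a b : E U a b -> E V (rst P h a) (rst P h b).
  by rewrite /E -!shf_nat => ->.
have [m mE] := @quotient_factor P E Er Es Et Eh Q f (fun U a b ab => ab).
pose q := @quot_map P E Er Es Et Eh.
exists (@quotient P E Er Es Et Eh : Sh X), q, m; split.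
- move=> Z u v uv; apply: sheaf_mapP => U s; apply: sheaf_separated => x Ux.
  have [V [h [a [Vx ua]]]] := quot_map_surj (shm u U s) Ux.
  have [W [l [b [Wx vb]]]] := quot_map_surj (rst _ h (shm v U s)) Vx.
  exists W, (subset_trans l h); split=> //.
  rewrite -!(rst_rst h l) ua vb shf_nat; apply: quot_map_eq; rewrite /E -!mE.
  have /(congr1 (rst Q h))/(congr1 (rst Q l)) e :
    m U (shm u U s) = m U (shm v U s) := sheaf_map_eq s uv.
  by move: e; rewrite !(shf_nat m) ua vb shf_nat.
- exact: sheaf_mapP.
move=> B t tf; have [|k kE] := @quotient_factor P E Er Es Et Eh B t.
  move=> U a b ab.
  have := tf (sheaf_of_open U : Sh X) (sheaf_yoneda a : @mor (Sh X) _ _)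
    (sheaf_yoneda b : @mor (Sh X) _ _) _.
  move=> /(_ _)/(sheaf_map_eq (@subset_refl _ U : sheaf_of_open U U)) /=.
  rewrite !rst_id; apply.
  by apply: sheaf_mapP => V h /=; rewrite -!shf_nat; congr (rst _ _ _).
by exists k; exact: sheaf_mapP.
Qed.

End Sheaves.

Section DependentProduct.
Variables (X : topologicalType) (V U Y : sheaf X).
Variables (i : sheaf_map V U) (y : sheaf_map Y V).

(** A section over [O] of the dependent product of [Y -> V] along [V -> U] is a section
   of [U] together with a lift to [Y] of the part of [V] above it. *)
Record prod_sec (O : opens X) := ProdSec {
  pbase : U O;
  psec : forall (W : opens X) (h : W `<=` O) (v : V W), i W v = rst U h pbase -> Y W;
  psecP : forall W h v e, y W (@psec W h v e) = v;
  psec_nat : forall (W W' : opens X) (h : W `<=` O) (h' : W' `<=` O) (k : W' `<=` W) v e e',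
    rst Y k (@psec W h v e) = @psec W' h' (rst V k v) e'
}.
Arguments psec {O} _ {W}.

Lemma prod_sec_eq O (s t : prod_sec O) : pbase s = pbase t ->
  (forall (W : opens X) (h : W `<=` O) v e e', psec s h v e = psec t h v e') -> s = t.
Proof.
case: s t => b s sP sn [b' t tP tn] /= e; case: b' / e t tP tn => t tP tn st.
have e : s = t.
  do 4![apply: functional_extensionality_dep => ?]; exact: st.
by case: t / e tP tn {st} => tP tn; congr ProdSec; exact: Prop_irrelevance.
Qed.

Lemma psec_eq O (s t : prod_sec O) (W : opens X) (h h' : W `<=` O) v w e e' :
  s = t -> v = w -> psec s h v e = psec t h' w e'.
Proof.
move=> st vw; case: t / st e'; case: w / vw => e'.
by rewrite (Prop_irrelevance h' h) in e' *; congr psec; exact: Prop_irrelevance.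
Qed.

Lemma prod_rst_subproof (O O' : opens X) (k : O' `<=` O) (s : prod_sec O)
    (W : opens X) (h : W `<=` O') (v : V W) :
  i W v = rst U h (rst U k (pbase s)) -> i W v = rst U (subset_trans h k) (pbase s).
Proof. by move->; exact: rst_rst. Qed.

Definition prod_rst (O O' : opens X) (k : O' `<=` O) (s : prod_sec O) : prod_sec O'.
Proof.
refine (@ProdSec O' (rst U k (pbase s))
  (fun W h v e => psec s (subset_trans h k) v (prod_rst_subproof e)) _ _).
- by move=> W h v e; exact: psecP.
- by move=> W W' h h' l v e e'; exact: psec_nat.
Defined.

Lemma psec_rst (O O' : opens X) (k : O' `<=` O) (s : prod_sec O) (W : opens X)
    (h : W `<=` O') (h' : W `<=` O) v w e e' : v = w ->
  psec (prod_rst k s) h v e = psec s h' w e'.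
Proof. by move=> vw; rewrite /=; exact: psec_eq. Qed.

Definition prod_sheaf : sheaf X.
Proof.
refine (@Sheaf X prod_sec prod_rst _ _ _).
- move=> O h s; apply: prod_sec_eq => [|W k v e e'] /=; first exact: rst_id.
  exact: psec_eq.
- move=> O O' O'' h k l s; apply: prod_sec_eq => [|W m v e e'] /=; first exact: rst_rst.
  exact: psec_eq.
move=> O D s DO cov comp.
have [|b [bP bu]] := @sheaf_glue X U O D (fun N d => pbase (s N d)) DO cov.
  by move=> N N' d d' W h h'; exact: (congr1 (@pbase W) (comp N N' d d' W h h')).
(* the local values of the glued section at [v] *)
pose R (W : opens X) (v : V W) (Q : opens X) (r : Y Q) :=
  exists N (d : D N) (k : Q `<=` N) (l : Q `<=` W) e,
    r = psec (s N d) k (rst V l v) e.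
have gl (W : opens X) (h : W `<=` O) (v : V W) : i W v = rst U h b ->
    exists t : Y W, forall (Q : opens X) (l : Q `<=` W) r, R W v Q r -> rst Y l t = r.
  move=> e; apply: sheaf_local_glue.
  - move=> Q Q' m _ [N [d [k [l [e' ->]]]]].
    have e2 : i Q' (rst V (subset_trans m l) v) = rst U (subset_trans m k) (pbase (s N d)).
      by rewrite -(rst_rst l m) -shf_nat e'; exact: rst_rst.
    exists N, d, (subset_trans m k), (subset_trans m l), e2.
    have e3 : i Q' (rst V m (rst V l v)) = rst U (subset_trans m k) (pbase (s N d)).
      by rewrite (rst_rst _ _ (subset_trans m l)).
    by rewrite (psec_nat _ e3); apply: psec_eq => //; exact: rst_rst.
  - move=> Q _ _ [N [d [k [l [e1 ->]]]]] [N' [d' [k' [l' [e2 ->]]]]].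
    have c := comp N N' d d' Q k k'.
    have e1' : i Q (rst V l v) = rst U (@subset_refl _ Q) (rst U k (pbase (s N d))).
      by rewrite rst_id.
    have e2' : i Q (rst V l' v) = rst U (@subset_refl _ Q) (rst U k' (pbase (s N' d'))).
      by rewrite rst_id.
    transitivity (psec (prod_rst k (s N d)) (@subset_refl _ Q) (rst V l v) e1').
      exact/esym/psec_rst.
    transitivity (psec (prod_rst k' (s N' d')) (@subset_refl _ Q) (rst V l' v) e2').
      by apply: psec_eq => //; rewrite (Prop_irrelevance l l').
    exact: psec_rst.
  - move=> x Wx; have [N d Nx] := cov x (h x Wx).
    have k : open_cap W N `<=` N by move=> z [].
    have l : open_cap W N `<=` W by move=> z [].
    have e' : i _ (rst V l v) = rst U k (pbase (s N d)).
      by rewrite -shf_nat e -(bP N d (DO N d)) !(rst_rst _ _ (subset_trans l h)).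
    exists (open_cap W N), (psec (s N d) k (rst V l v) e'); split=> //.
    by exists N, d, k, l, e'.
pose t (W : opens X) h v e := sval (cid (gl W h v e)).
have tP (W : opens X) h v e : forall (Q : opens X) (l : Q `<=` W) r,
    R W v Q r -> rst Y l (t W h v e) = r.
  exact: (svalP (cid (gl W h v e))).
have loc (W : opens X) (h : W `<=` O) (v : V W) (e : i W v = rst U h b) x : W x ->
    exists (Q : opens X) (l : Q `<=` W) N (d : D N) (k : Q `<=` N) e',
    [/\ Q x, rst Y l (t W h v e) = psec (s N d) k (rst V l v) e' & Q `<=` N].
  move=> Wx; have [N d Nx] := cov x (h x Wx).
  have k : open_cap W N `<=` N by move=> z [].
  have l : open_cap W N `<=` W by move=> z [].
  have e' : i _ (rst V l v) = rst U k (pbase (s N d)).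
    by rewrite -shf_nat e -(bP N d (DO N d)) !(rst_rst _ _ (subset_trans l h)).
  exists (open_cap W N), l, N, d, k, e'; split=> //.
  by apply: tP; exists N, d, k, l, e'.
have ty W h v e : y W (t W h v e) = v.
  apply: sheaf_separated => x Wx; have [Q [l [N [d [k [e' [Qx te _]]]]]]] := loc W h v e x Wx.
  by exists Q, l; split=> //; rewrite shf_nat te psecP.
have tn (W W' : opens X) (h : W `<=` O) (h' : W' `<=` O) (k : W' `<=` W) v e e' :
    rst Y k (t W h v e) = t W' h' (rst V k v) e'.
  apply: sheaf_separated => x Wx.
  have [Q [l [N [d [m [e2 [Qx te QN]]]]]]] := loc W' h' (rst V k v) e' x Wx.
  exists Q, l; split=> //; rewrite te (rst_rst k l (subset_trans l k)).
  have e3 : i Q (rst V (subset_trans l k) v) = rst U m (pbase (s N d)).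
    by rewrite -e2 (rst_rst k l (subset_trans l k)).
  rewrite (tP _ _ _ _ _ _ (psec (s N d) m (rst V (subset_trans l k) v) e3)).
    by apply: psec_eq => //; apply/esym/rst_rst.
  by exists N, d, m, (subset_trans l k), e3.
exists (ProdSec ty tn); split=> [N d h|t' t'P].
  apply: prod_sec_eq => [|W k v e e'] /=; first exact: bP.
  rewrite -[LHS](rst_id (@subset_refl _ W)); apply: tP.
  have e2 : i W (rst V (@subset_refl _ W) v) = rst U k (pbase (s N d)) by rewrite rst_id.
  exists N, d, k, (@subset_refl _ W), e2; apply: psec_eq => //.
  by rewrite rst_id.
have bE : b = pbase t'.
  by apply: bu => N d h; rewrite -(t'P N d h).
apply: prod_sec_eq => //= W h v e e'; apply: sheaf_separated => x Wx.
have [Q [l [N [d [m [e2 [Qx te QN]]]]]]] := loc W h v e x Wx.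
exists Q, l; split=> //; rewrite te.
have e3 : i Q (rst V l v) = rst U (subset_trans l h) (pbase t').
  by rewrite -shf_nat e'; exact: rst_rst.
rewrite (psec_nat e' e3).
have e4 : i Q (rst V l v) = rst U m (pbase (prod_rst (DO N d) t')).
  by rewrite e2 (t'P N d).
transitivity (psec (prod_rst (DO N d) t') m (rst V l v) e4).
  by apply: psec_eq => //; apply/esym/t'P.
exact: psec_rst.
Defined.

End DependentProduct.
Arguments psec {X V U Y i y O} _ {W}.

Lemma Sh_dependent_products (X : topologicalType) : has_dependent_products (Sh X).
Proof.
move=> V U Y i y; pose R := @prod_sheaf X V U Y i y.
pose s : @mor (Sh X) R U := @SheafMap X R U (fun O t => pbase t) (fun _ _ _ _ => erefl).
have [P [p [v pb]]] := wide_pullbacks_pullbacks (@Sh_wide_pullbacks X) s i.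
have evE (O : opens X) (c : (P : sheaf X) O) :
    shm i O (shm v O c) = rst U (@subset_refl _ O) (pbase (shm p O c)).
  by rewrite rst_id; apply/esym; exact: (sheaf_map_eq c pb.1).
pose ev0 (O : opens X) (c : (P : sheaf X) O) : (Y : sheaf X) O :=
  psec (shm p O c) (@subset_refl _ O) (shm v O c) (evE O c).
have evn (O O' : opens X) (h : O' `<=` O) (c : (P : sheaf X) O) :
    rst Y h (ev0 O c) = ev0 O' (rst P h c).
  have e1 : shm i O' (rst V h (shm v O c)) = rst U h (pbase (shm p O c)).
    by rewrite -shf_nat evE rst_id.
  rewrite /ev0 (psec_nat _ e1).
  have e2 : shm i O' (shm v O' (rst P h c)) =
      rst U (@subset_refl _ O') (pbase (rst R h (shm p O c))).
    by rewrite -shf_nat e1 rst_id.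
  transitivity (psec (rst R h (shm p O c) : prod_sec i y O') (@subset_refl _ O')
    (shm v O' (rst P h c)) e2).
    by apply/esym/psec_rst/esym/shf_nat.
  by apply: psec_eq => //; exact: (shf_nat (shm p) h c).
exists (R : Sh X), P, s, p, v, (@SheafMap X P Y ev0 evn); split=> //.
  by apply: sheaf_mapP => O c /=; exact: psecP.
move=> Z Q z q w f zq yf.
have cP (W : opens X) (a : (Z : sheaf X) W) (b : (V : sheaf X) W) :
    shm i W b = shm z W a -> {c : (Q : sheaf X) W | shm q W c = a /\ shm w W c = b}.
  move=> e; have /cid[c [c1 _]] := pullback_sheafP zq (esym e : shm z W a = shm i W b).
  by exists c.
have cU (W : opens X) (c c' : (Q : sheaf X) W) :
    shm q W c = shm q W c' -> shm w W c = shm w W c' -> c = c'.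
  move=> qc wc; apply: (ex_unique_eq (pullback_sheafP (V := W)
    (a := shm q W c') (b := shm w W c') zq _)) => //.
  exact: (sheaf_map_eq c' zq.1).
have fy (W : opens X) (c : (Q : sheaf X) W) : shm y W (shm f W c) = shm w W c.
  exact: (sheaf_map_eq c yf).
have gE (O W : opens X) (a : (Z : sheaf X) O) (h : W `<=` O) (b : (V : sheaf X) W) :
    shm i W b = rst U h (shm z O a) -> shm i W b = shm z W (rst Z h a).
  by rewrite shf_nat.
pose g1 (O : opens X) (a : (Z : sheaf X) O) (W : opens X) (h : W `<=` O) b
  (e : shm i W b = rst U h (shm z O a)) : (Y : sheaf X) W :=
  shm f W (sval (cP W (rst Z h a) b (gE O W a h b e))).
have g1E (O : opens X) (a : (Z : sheaf X) O) (W : opens X) (h : W `<=` O) b e c :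
    shm q W c = rst Z h a -> shm w W c = b -> @g1 O a W h b e = shm f W c.
  move=> c1 c2; rewrite /g1; case: (cP _ _ _ _) => c' [c1' c2'] /=.
  by congr (shf _ _); apply: cU; rewrite ?c1 ?c2.
have g1y (O : opens X) (a : (Z : sheaf X) O) (W : opens X) (h : W `<=` O) b e :
    shm y W (@g1 O a W h b e) = b.
  by rewrite /g1; case: (cP _ _ _ _) => c' [c1' c2'] /=; rewrite fy.
have g1n (O : opens X) (a : (Z : sheaf X) O) (W W' : opens X) (h : W `<=` O)
    (h' : W' `<=` O) (k : W' `<=` W) b e e' :
    rst Y k (@g1 O a W h b e) = @g1 O a W' h' (rst V k b) e'.
  have [c [c1 c2]] := cP _ _ _ (gE O W a h b e).
  rewrite (@g1E O a W h b e c c1 c2) shf_nat.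
  apply/esym/g1E; rewrite -shf_nat ?c1 ?c2 //.
  by rewrite (rst_rst h k h').
pose g0 (O : opens X) (a : (Z : sheaf X) O) : R O :=
  @ProdSec X V U Y i y O (shm z O a) (@g1 O a) (@g1y O a) (@g1n O a).
have g0n (O O' : opens X) (h : O' `<=` O) (a : (Z : sheaf X) O) :
    rst R h (g0 O a) = g0 O' (rst Z h a).
  apply: prod_sec_eq => [|W k b e e'] /=; first exact: shf_nat.
  have [c [c1 c2]] := cP _ _ _ (gE _ _ _ _ _ e').
  rewrite (g1E _ _ _ _ _ _ c) ?(g1E _ _ _ _ _ _ c) // c1.
  exact: rst_rst.
exists (@SheafMap X Z R g0 g0n); split.
  split; first exact: sheaf_mapP.
  move=> h ph vh; apply: sheaf_mapP => O c /=.
  have phE : shm p O (shm h O c) = g0 O (shm q O c) := sheaf_map_eq c ph.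
  have vhE : shm v O (shm h O c) = shm w O c := sheaf_map_eq c vh.
  have e : shm i O (shm w O c) = rst U (@subset_refl _ O) (shm z O (shm q O c)).
    by rewrite rst_id; apply/esym; exact: (sheaf_map_eq c zq.1).
  transitivity (@g1 O (shm q O c) O (@subset_refl _ O) (shm w O c) e).
    exact: (psec_eq (evE _ _) (e : shm i O _ = rst U _ (pbase (g0 O (shm q O c)))) phE vhE).
  by apply: g1E => //; rewrite rst_id.
move=> g [sg gf]; apply: sheaf_mapP => O a.
have bE : pbase (shm g O a) = shm z O a := sheaf_map_eq a sg.
apply: prod_sec_eq => [|W k b e e'] /=; first by rewrite bE.
have [c [c1 c2]] := cP _ _ _ (gE _ _ _ _ _ e).
rewrite (g1E _ _ _ _ _ _ c) //.
have [|h [[ph vh] _]] := pb.2 Q (g ** q) w.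
  by rewrite cmpA sg; exact: zq.1.
have -> : shm f W c = ev0 W (shm h W c) := esym (sheaf_map_eq c (gf h ph vh)).
have phE : shm p W (shm h W c) = rst R k (shm g O a).
  by rewrite shf_nat -c1; exact: (sheaf_map_eq c ph).
have vhE : shm v W (shm h W c) = b by rewrite -c2; exact: (sheaf_map_eq c vh).
have e2 : shm i W b = rst U (@subset_refl _ W) (pbase (rst R k (shm g O a))).
  by rewrite rst_id e'.
transitivity (psec (rst R k (shm g O a) : prod_sec i y W) (@subset_refl _ W) b e2).
  exact: psec_eq.
exact: psec_rst.
Qed.

Lemma sheaf_mono_inj (X : topologicalType) (V U : sheaf X) (i : @mor (Sh X) V U) :
  is_mono i -> forall Q (a b : V Q), shm i Q a = shm i Q b -> a = b.
Proof.
move=> mi Q a b ab.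
have := mi (sheaf_of_open Q : Sh X) (sheaf_yoneda a) (sheaf_yoneda b).
move=> /(_ _)/(sheaf_map_eq (@subset_refl _ Q : sheaf_of_open Q Q)) /=.
rewrite !rst_id; apply; apply: sheaf_mapP => W h /=.
by rewrite -!shf_nat; congr (rst _ _ _).
Qed.

(** The pullback of a subsheaf [V] of [U] along a section [u] of [U] is the largest
   open where [u] belongs to [V]. *)
Lemma section_pullback (X : topologicalType) (V U : sheaf X) (i : @mor (Sh X) V U)
    (O W : opens X) (h : W `<=` O) (u : U O) (v : V W) :
  (forall Q (a b : V Q), shm i Q a = shm i Q b -> a = b) ->
  shm i W v = rst U h u ->
  (forall (Q : opens X) (k : Q `<=` O) (a : V Q), shm i Q a = rst U k u -> Q `<=` W) ->
  @is_pullback (Sh X) (sheaf_of_open O) V U (sheaf_of_open W)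
    (sheaf_yoneda u) i
    (@sheaf_yoneda X W (sheaf_of_open O) h) (sheaf_yoneda v).
Proof.
move=> inj iv max; split.
  apply: sheaf_mapP => Q k /=; rewrite -[RHS]shf_nat; apply: esym.
  by rewrite (iv : i W v = _); exact: rst_rst.
move=> Z a b ab.
have abE (Q : opens X) (s : (Z : sheaf X) Q) : shm i Q (shm b Q s) = rst U (shm a Q s) u.
  exact: esym (sheaf_map_eq s ab).
have QW (Q : opens X) (s : (Z : sheaf X) Q) : Q `<=` W := max Q _ _ (abE Q s).
have nat (Q Q' : opens X) (k : Q' `<=` Q) (s : (Z : sheaf X) Q) :
    rst (sheaf_of_open W) k (QW Q s : sheaf_of_open W Q) = QW Q' (rst Z k s).
  exact: (@Prop_irrelevance (Q' `<=` W)).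
exists (@SheafMap X Z (sheaf_of_open W) QW nat); split.
  split; apply: sheaf_mapP => Q s /=; first exact: (@Prop_irrelevance (Q `<=` O)).
  apply: inj; rewrite abE -shf_nat (iv : i W v = _).
  exact: rst_rst.
by move=> w _; apply: sheaf_mapP => Q s; exact: (@Prop_irrelevance (Q `<=` W)).
Qed.

Lemma germ_neq_open (X : topologicalType) (B : sheaf X) x (O V W : opens X) (b : B V) (c : B W) :
  O x -> V x -> W x ->
  (forall (Q : opens X) (h : Q `<=` V) (k : Q `<=` W), Q `<=` O -> rst B h b = rst B k c) ->
  germ x b = germ x c.
Proof.
move=> Ox Vx Wx bc; apply/germP => //.
have h : open_cap (open_cap V W) O `<=` V by move=> z [[]].
have k : open_cap (open_cap V W) O `<=` W by move=> z [[]].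
exists (open_cap (open_cap V W) O), h, k; split; first by [].
by apply: bc => z [].
Qed.

Import Order.TTheory GRing.Theory Num.Theory.

(** * The plane over the line *)

(** Treats both projections of the plane at once: [p] is the given one, [q] is the
   other one and [mk] builds a point from its images under [p] and [q]. *)
Record coordinates (R : realType) (p q : R * R -> R) (mk : R -> R -> R * R) := Coordinates {
  coord_p : forall x y, p (mk x y) = x;
  coord_q : forall x y, q (mk x y) = y;
  coord_mk : forall w, mk (p w) (q w) = w;
  coord_cq : continuous q;
  coord_cmk : forall x, continuous (mk x);
  coord_box : forall (O : set (R * R)) w, open O -> O w ->
    exists2 d : R, (0 < d)%R & forall w', (`|p w - p w'| < d)%R -> (`|q w - q w'| < d)%R -> O w'
}.

Lemma box_in_open (R : realType) (O : set (R * R)) w : open O -> O w ->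
  exists2 d : R, (0 < d)%R &
    forall w', (`|w.1 - w'.1| < d)%R -> (`|w.2 - w'.2| < d)%R -> O w'.
Proof.
move=> oO Ow; have /nbhs_ballP[d /= d0 dO] := open_nbhs_nbhs (conj oO Ow).
by exists d => // w' h1 h2; apply: dO; split; rewrite /= -ball_normE.
Qed.

Lemma coordinates_exist (R : realType) (p : R * R -> R) : p = fst \/ p = snd ->
  exists q mk, coordinates p q mk.
Proof.
case=> ->; [exists snd, (fun x y => (x, y))|exists fst, (fun x y => (y, x))]; split=> //.
- by case.
- by move=> w; exact: cvg_snd.
- move=> x y; apply: (@cvg_pair _ _ _ (nbhs y) (nbhs x) (nbhs y) _ _ _ (fun=> x) id).
    exact: cvg_cst.
  exact: cvg_id.
- exact: box_in_open.
- by case.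
- by move=> w; exact: cvg_fst.
- move=> x y; apply: (@cvg_pair _ _ _ (nbhs y) (nbhs y) (nbhs x) _ _ _ id (fun=> x)).
    exact: cvg_id.
  exact: cvg_cst.
- move=> O w oO Ow; have [d d0 dO] := box_in_open oO Ow.
  by exists d => // w' h1 h2; exact: dO.
Qed.

Section Plane.
Variables (R : realType) (p q : R * R -> R) (mk : R -> R -> R * R).
Hypothesis (cp : continuous p) (pq : coordinates p q mk).

Lemma openq (A : set R) : open A -> open [set w | A (q w)].
Proof. by move=> oA; apply: open_comp oA => w _; exact: coord_cq pq w. Qed.

Lemma openp (A : set R) : open A -> open [set w | A (p w)].
Proof. by move=> oA; apply: open_comp oA => w _; exact: cp. Qed.

(** Intervals are connected; this is for the intervals in the fibres of [p]. *)
Lemma fibre_constant (a b : R) (P : R -> Prop) :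
  (forall y, (a < y < b)%R -> exists2 O, open O & O y /\
     forall z, O z -> (a < z < b)%R -> (P z <-> P y)) ->
  forall y z, (a < y < b)%R -> (a < z < b)%R -> P y -> P z.
Proof.
move=> loc y z yab zab Py; pose J := [set x | a < x < b]%R.
have oJ : open J.
  have -> : J = [set x | a < x]%R `&` [set x | x < b]%R.
    by apply/seteqP; split=> x /=; [move=> /andP|move=> /andP].
  by apply: openI; [exact: open_gt|exact: open_lt].
have cJ : connected J.
  apply/connected_intervalP => u v /andP[au ub] /andP[av vb] w /andP[uw wv].
  by apply/andP; split; [exact: lt_le_trans au uw|exact: le_lt_trans wv vb].
have oP (Q : R -> Prop) : (forall y, J y -> exists2 O, open O & O y /\
     forall z, O z -> J z -> (Q z <-> Q y)) -> open [set x | J x /\ Q x].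
  move=> locQ; rewrite openE => x [Jx Qx]; have [O oO [Ox OP]] := locQ x Jx.
  have oOJ : open (O `&` J) by exact: openI.
  have : nbhs x (O `&` J) by exact: open_nbhs_nbhs.
  by apply: filterS => w [Ow Jw]; split=> //; apply/(OP w Ow Jw).
have oP1 := oP P loc.
have oP2 : open [set x | J x /\ ~ P x].
  apply: oP => w /loc[O oO [Ow OP]]; exists O => //; split=> // u Ou Ju.
  by have := OP u Ou Ju; tauto.
suff : J `&` P = J by move=> e; have : J z by []; rewrite -e => -[].
apply: cJ.
- by exists y.
- by exists [set x | J x /\ P x] => //; apply/seteqP; split=> x [? //]; case.
- exists (~` [set x | J x /\ ~ P x]); first exact: open_closedC.
  apply/seteqP; split=> x [Jx Px]; split=> //; first by move=> [].
  by apply: contrapT => nP; apply: Px.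
Qed.

(** Sections of [p^* B] are locally constant along the fibres of [p], hence determined
   by their values on a fibrewise dense set. *)
Lemma pull_dense (B : sheaf R) (O : opens (R * R)%type) (s t : pull_sec cp B O)
    (D : set (R * R)) :
  (forall w (Ow : O w) (Q : opens (R * R)%type), Q w -> exists w', [/\ Q w', p w' = p w & D w']) ->
  (forall w (Ow : O w), D w -> pval s Ow = pval t Ow) -> s = t.
Proof.
move=> dense st; apply: pull_secP => w Ow.
have [V [b [Q [Qw QV sb]]]] := pvalP s Ow.
have [V' [b' [Q' [Qw' QV' tb]]]] := pvalP t Ow.
have [|w' [[[Qw1 Qw2] Ow'] pw Dw]] := dense w Ow (open_cap (open_cap Q Q') O) => //.
by rewrite sb // tb // -pw -sb // -tb // st.
Qed.

End Plane.

(** * Extending sections across a point *)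

(** Functions on the part of the point [x0] in an open set: the direct image of a
   two-element set along [x0]. *)
Definition skyscraper (X : topologicalType) (x0 : X) : sheaf X.
Proof.
refine (@Sheaf X (fun V => V x0 -> bool) (fun U V h s Vx => s (h x0 Vx)) _ _ _).
- by move=> U h s; apply/funext => Ux; congr s; exact: Prop_irrelevance.
- by move=> U V W h k l s; apply/funext => Ux; congr s; exact: Prop_irrelevance.
move=> U D s DU cov comp.
have sE V V' (d : D V) (d' : D V') (Vx : V x0) (Vx' : V' x0) : s V d Vx = s V' d' Vx'.
  have h : open_cap V V' `<=` V by move=> z [].
  have h' : open_cap V V' `<=` V' by move=> z [].
  have /(congr1 (fun g : open_cap V V' x0 -> bool => g (conj Vx Vx'))) :=
    comp V V' d d' _ h h'.
  by rewrite (Prop_irrelevance (h x0 _) Vx) (Prop_irrelevance (h' x0 _) Vx').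
have ch (Ux : U x0) : {b | forall V (d : D V) (Vx : V x0), s V d Vx = b}.
  by have [V d Vx] := cid2 (cov x0 Ux); exists (s V d Vx) => V' d' Vx'; exact: sE.
exists (fun Ux => sval (ch Ux)); split=> [V d h|t tP]; apply/funext => Vx.
  exact: esym (svalP (ch (h x0 Vx)) V d Vx).
have [V d Vx'] := cov x0 Vx.
rewrite -(svalP (ch Vx) V d Vx') -(tP V d (DU V d)); congr t; exact: Prop_irrelevance.
Defined.

Section Plane.
Variables (R : realType) (p q : R * R -> R) (mk : R -> R -> R * R).
Hypothesis (cp : continuous p) (pq : coordinates p q mk).
Local Notation P := (R * R)%type.
Local Open Scope ring_scope.

Section Jump.
Variables x0 y0 : R.
Local Notation B := (skyscraper x0).

Definition sky (c : bool) : B (@Opens R setT openT) := fun=> c.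

Lemma sky_germ_away x (V W : opens R) (b : B V) (c : B W) :
  x != x0 -> V x -> W x -> germ x b = germ x c.
Proof.
move=> xx Vx Wx; have oO : open [set z : R | z != x0] by exact: open_neq.
apply: (@germ_neq_open _ _ _ (Opens oO)) => // Q h k Qn.
apply/funext => Qx; have := Qn x0 Qx.
by rewrite /opens_pred /= eqxx.
Qed.

Lemma sky_germ (V : opens R) (b : B V) (Vx : V x0) : germ x0 b = germ x0 (sky (b Vx)).
Proof.
apply/germP => //.
have h : V `<=` @Opens R setT openT by [].
exists V, (@subset_refl _ V), h; split=> //.
by apply/funext => Vx'; rewrite /sky /=; congr b; exact: Prop_irrelevance.
Qed.

Lemma sky_germ_inj c c' : germ x0 (sky c) = germ x0 (sky c') -> c = c'.
Proof.
move=> /germP -/(_ I) [O [h [k [Ox]]]] /(congr1 (@^~ Ox)).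
by [].
Qed.

Lemma open_side (c : bool) : open [set w : P | if c then y0 < q w else q w < y0].
Proof.
case: c.
  by apply: (openq pq (A := [set x | y0 < x])); exact: open_gt.
by apply: (openq pq (A := [set x | x < y0])); exact: open_lt.
Qed.

Definition side c : opens P := Opens (@open_side c).

Definition const_sec (O : opens P) (c : bool) : pull_sec cp B O.
Proof.
refine (@PullSec P R p cp B O (fun w _ => germ (p w) (sky c)) _) => w Ow.
by exists (@Opens R setT openT), (sky c), O; split.
Defined.

(** A section with value [true] above the point [(x0, y0)] and [false] below it on its
   fibre.  It exists over opens avoiding this point, because away from the fibre all
   germs of the skyscraper agree. *)
Lemma jump_subproof (O : opens P) : (forall w, O w -> q w = y0 -> p w != x0) ->
  forall w, O w -> exists (V : opens R) (b : B V) (Q : opens P),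
    [/\ Q w, Q `<=` Defs.preim cp V &
        forall z (Oz : O z), Q z -> germ (p z) (sky (y0 < q z)) = germ (p z) b].
Proof.
move=> Ox w Ow; pose T := @Opens R setT openT.
have [qw|qw|qw] := ltgtP (q w) y0.
- exists T, (sky false), (side false); split=> // z _ qz.
  by have := qz : q z < y0 => zy; rewrite lt_gtF.
- exists T, (sky true), (side true); split=> // z _ qz.
  by have := qz : y0 < q z => ->.
have pw := Ox w Ow qw.
have oN : open [set z : P | p z != x0].
  by apply: (openp cp (A := [set x | x != x0])); exact: open_neq.
exists T, (sky true), (Opens oN); split=> // z _ pz.
exact: sky_germ_away.
Qed.

Definition jump (O : opens P) (Ox : forall w, O w -> q w = y0 -> p w != x0) :
  pull_sec cp B O := PullSec (jump_subproof Ox).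

End Jump.

Lemma boxP x0 y0 d : open [set w : P | `|x0 - p w| < d /\ `|y0 - q w| < d].
Proof.
have -> : [set w : P | `|x0 - p w| < d /\ `|y0 - q w| < d] =
    [set w | ball x0 d (p w)] `&` [set w | ball y0 d (q w)].
  by rewrite -ball_normE.
apply: openI.
  by apply: (openp cp (A := ball x0 d)); exact: ball_open.
by apply: (openq pq (A := ball y0 d)); exact: ball_open.
Qed.

Lemma mk_near x y (O : opens P) : O (mk x y) ->
  exists2 N : set R, open N & N y /\ forall z, N z -> O (mk x z).
Proof.
move=> Oxy; exists (mk x @^-1` O); last by split.
by apply: open_comp (osetP O) => z _; exact: coord_cmk pq x z.
Qed.

Definition extends_uniquely (O W : opens P) (h : W `<=` O) : Prop :=
  forall (B : sheaf R) (s : pull_sec cp B W),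
    exists! t : pull_sec cp B O, pull_rst h t = s.

(** If sections of all inverse images extend uniquely from [Q] cut with [W] to [Q], for
   each open [Q] of [O], then [W] contains [O].  If [w] were missing, the jump at [w]
   would extend to a box around [w], where it is constant on the fibre.  It differs
   from the original jump on one of the two sides of [w], so that [W] does not meet
   the fibre on this side.  But then the two constant sections of the skyscraper over
   this side of the box agree on [W]. *)
Lemma extension_point (O W : opens P) w : W `<=` O -> O w ->
  (forall (Q : opens P) (h : open_cap Q W `<=` Q), Q `<=` O -> extends_uniquely h) ->
  W w.
Proof.
move=> WO Ow ext; apply: contrapT => nW.
pose x0 := p w; pose y0 := q w.
have [d d0 dO] := coord_box pq (osetP O) Ow.
pose Q := Opens (@boxP x0 y0 d).
have QO : Q `<=` O by move=> z [z1 z2]; exact: dO.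
have h : open_cap Q W `<=` Q by move=> z [].
have off z : open_cap Q W z -> q z = y0 -> p z != x0.
  move=> [_ Wz] qz; apply/eqP => pz; apply: nW.
  by rewrite -(coord_mk pq w) -/x0 -/y0 -pz -qz (coord_mk pq).
have [t [ts _]] := ext Q h QO _ (jump off).
have Qmk y : y0 - d < y < y0 + d -> Q (mk x0 y).
  move=> yd; rewrite /Q /= /opens_pred /= (coord_p pq) (coord_q pq) subrr normr0.
  by split=> //; rewrite distrC ltr_distl.
pose tr := germ x0 (@sky x0 true).
pose Phi y := forall Qy : Q (mk x0 y), pval t Qy = tr.
have valP y (Qy : Q (mk x0 y)) : exists c, pval t Qy = germ x0 (@sky x0 c).
  have [V [b [N [Ny NV tb]]]] := pvalP t Qy.
  have Vx : V x0 by have := NV _ Ny; rewrite /Defs.preim /opens_pred /= (coord_p pq).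
  by exists (b Vx); rewrite tb // (coord_p pq) (sky_germ b Vx).
have PhiP c y (Qy : Q (mk x0 y)) : pval t Qy = germ x0 (@sky x0 c) -> (Phi y <-> c).
  move=> tc; split=> [/(_ Qy)|ct Qy']; first by rewrite tc => /sky_germ_inj.
  by rewrite (Prop_irrelevance Qy' Qy) tc ct.
have PhiW c y (yd : y0 - d < y < y0 + d) : W (mk x0 y) -> (y0 < y) = c -> (Phi y <-> c).
  move=> Wy yc; have Qy := Qmk y yd.
  apply: (PhiP c y Qy).
  have /(congr1 (fun u : pull_sec cp _ _ => pval u (conj Qy Wy : open_cap Q W _))) /= := ts.
  by rewrite (Prop_irrelevance (h _ _) Qy) (coord_p pq) (coord_q pq) yc.
have const := @fibre_constant R (y0 - d) (y0 + d) Phi _.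
have {}const : forall y z, y0 - d < y < y0 + d -> y0 - d < z < y0 + d -> Phi y -> Phi z.
  apply: const => y yd; have Qy := Qmk y yd.
  have [V [b [N [Ny NV tb]]]] := pvalP t Qy.
  have [M oM [My MN]] := mk_near Ny.
  exists M => //; split=> // z Mz zd; have Qz := Qmk z zd.
  have [c tc] := valP y Qy.
  have tz : pval t Qz = germ x0 (@sky x0 c).
    by rewrite tb; [rewrite -tc tb // !(coord_p pq)|exact: MN].
  by rewrite (PhiP c z Qz tz) (PhiP c y Qy tc).
have y0d : y0 - d < y0 < y0 + d by rewrite ltrBlDr ltrDl d0.
have [c cP] : exists c : bool, forall y, y0 - d < y < y0 + d -> (Phi y <-> c).
  have [c tc] := valP y0 (Qmk y0 y0d); exists c => y yd.
  rewrite -(PhiP c y0 _ tc); split; exact: const.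
(* on the side where the jump disagrees with the constant value, no point of the
   fibre lies in [W] *)
pose S := open_cap Q (side y0 (~~ c)).
have k : open_cap S W `<=` S by move=> z [].
have SO : S `<=` O by move=> z [/QO].
have far z : S z -> W z -> p z != x0.
  move=> [Qz sz] Wz; apply/eqP => pz.
  have zE : z = mk x0 (q z) by rewrite -pz (coord_mk pq).
  have qd : y0 - d < q z < y0 + d by case: Qz => _; rewrite distrC ltr_distl.
  have qs : (y0 < q z) = ~~ c.
    move: sz; rewrite /side /opens_pred /=; case: (c) => //= qz.
    by rewrite lt_gtF.
  have := PhiW _ _ qd _ qs; rewrite -zE => /(_ Wz).
  by rewrite (cP _ qd); case: (c) => -[h1 h2]; [have := h1 isT|have := h2 isT].
have [u [_ uu]] := ext S k SO _ (pull_rst k (const_sec x0 S true)).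
have e1 := uu _ (erefl _).
have e2 : u = const_sec x0 S false.
  apply: uu; apply: pull_secP => z [Sz Wz] /=.
  by apply: sky_germ_away => //; exact: far.
pose y1 := if c then y0 - d / 2 else y0 + d / 2.
have d20 : 0 < d / 2 by rewrite divr_gt0.
have d2d : d / 2 < d by rewrite ltr_pdivrMr // ltr_pMr // ltr1n.
have y1d : y0 - d < y1 < y0 + d.
  rewrite /y1; case: (c); apply/andP; split.
  - by rewrite ltrD2l ltrN2.
  - by rewrite (lt_trans _ (_ : y0 < _)) ?ltrBlDr ?ltrDl.
  - by rewrite (lt_trans (_ : _ < y0)) ?ltrBlDr ?ltrDl.
  - by rewrite ltrD2l.
have S1 : S (mk x0 y1).
  split; first exact: Qmk.
  rewrite /side /opens_pred /= (coord_q pq) /y1; case: (c) => /=.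
    by rewrite ltrBlDr ltrDl.
  by rewrite ltrDl.
have := congr1 (fun u : pull_sec cp _ _ => pval u S1) (etrans (esym e1) e2).
by rewrite /= (coord_p pq) => /sky_germ_inj.
Qed.

End Plane.

(** * Dimension *)

Section Dimension.
Variables (R : realType) (p q : R * R -> R) (mk : R -> R -> R * R).
Hypothesis (cp : continuous p) (pq : coordinates p q mk).
Local Notation P := (R * R)%type.

(** Over an open [O], a section [u] of [U] pulls the 0-pure monomorphism back to the
   inclusion in [O] of the largest open [W] where [u] comes from [V]. *)
Lemma pure_surjective (V U : sheaf P) (i : @mor (Sh P) V U) :
  pure_mono (Sh_map cp) 0 i -> forall (O : opens P) (u : U O), exists v, shm i O v = u.
Proof.
move=> pi O u; have inj := sheaf_mono_inj pi.1.
pose D (Q : opens P) := exists (h : Q `<=` O) (v : V Q), shm i Q v = rst U h u.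
have oW : open (\bigcup_(Q in D) oset Q) by apply: bigcup_open => Q _; exact: osetP.
pose W := Opens oW.
have WO : W `<=` O by move=> x [Q [h _] /h].
have [|||v0 v0P] := @sheaf_local_glue P V W (fun Q v => exists h : Q `<=` O, shm i Q v = rst U h u).
- move=> Q Q' k s [h e]; exists (subset_trans k h).
  by rewrite -shf_nat e; exact: rst_rst.
- move=> Q s t [h e] [h' e']; apply: inj; rewrite e e'; congr rst; exact: Prop_irrelevance.
- move=> x [Q [h [v e]] Qx]; exists Q, v; split=> //; last by exists h.
  by move=> z Qz; exists Q => //; exists h, v.
have v0E : shm i W v0 = rst U WO u.
  apply: sheaf_separated => x [Q [h [v e]] Qx].
  have k : Q `<=` W by move=> z Qz; exists Q => //; exists h, v.
  exists Q, k; split=> //; rewrite (rst_rst WO k h) -e shf_nat; congr (shf _ _).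
  by apply: v0P; exists h.
suff OW : O `<=` W.
  exists (rst V OW v0); rewrite -shf_nat v0E (rst_rst _ _ (@subset_refl _ O)).
  exact: rst_id.
move=> w Ow; have := @extension_point R p q mk cp pq O W w WO Ow.
apply => Q h QO B s.
have k : open_cap Q W `<=` W by move=> z [].
pose u' := rst U QO u; pose v' := rst V k v0.
have iv : shm i _ v' = rst U h u'.
  by rewrite -shf_nat v0E (rst_rst _ _ (subset_trans h QO)); apply/esym/rst_rst.
have max (Q' : opens P) (l : Q' `<=` Q) (a : V Q') :
    shm i Q' a = rst U l u' -> Q' `<=` open_cap Q W.
  move=> e z Q'z; split; first exact: (l z Q'z).
  exists Q' => //; exists (subset_trans l QO), a.
  by rewrite e; exact: rst_rst.
have pb := section_pullback inj iv max.
have [g [gs gu]] := pure_orthogonal (@Sh_wide_pullbacks P) (@Sh_terminal P)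
  (@Sh_coequalizers P) (@Sh_dependent_products P) (@Sh_terminal R) pi pb
  (sheaf_yoneda (s : pull_ob cp B (open_cap Q W)) : @mor (Sh P) _ (pull_ob cp B)).
have key (t : pull_sec cp B Q) : pull_rst h t = s ->
    (sheaf_yoneda (t : pull_ob cp B Q) : @mor (Sh P) _ (pull_ob cp B)) **
    @sheaf_yoneda P (open_cap Q W) (sheaf_of_open Q) h =
    (sheaf_yoneda (s : pull_ob cp B (open_cap Q W)) : @mor (Sh P) _ (pull_ob cp B)).
  move=> <-; apply: sheaf_mapP => Q' l /=.
  exact: esym (@rst_rst _ (pull_ob cp B) _ _ _ _ _ _ t).
exists (shm g Q (@subset_refl _ Q)); split.
  have /= := sheaf_map_eq (@subset_refl _ _ : sheaf_of_open (open_cap Q W) _) gs.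
  rewrite [RHS](@rst_id _ (pull_ob cp B)) => <-.
  apply: (etrans (shf_nat (shm g) h (@subset_refl _ Q : sheaf_of_open Q Q))).
  by congr (shf _ _); exact: (@Prop_irrelevance (open_cap Q W `<=` Q)).
move=> t /key/gu ->.
exact: (@rst_id _ (pull_ob cp B)).
Qed.

(** The 0-pure monomorphisms are isomorphisms. *)
Lemma E_le1 (X : Sh P) : E_le (Sh_map cp) 1 X.
Proof.
move=> V U i pi f.
have surj := pure_surjective (pi : pure_mono (Sh_map cp) 0 i).
have inj := sheaf_mono_inj pi.1.
pose g0 (O : opens P) (u : (U : sheaf P) O) : (X : sheaf P) O :=
  shm f O (sval (cid (surj O u))).
have g0E (O : opens P) v : g0 O (shm i O v) = shm f O v.
  by rewrite /g0; case: (cid _) => v' /= /inj ->.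
have g0n (O O' : opens P) (h : O' `<=` O) (u : (U : sheaf P) O) :
    rst X h (g0 O u) = g0 O' (rst U h u).
  by have [v <-] := surj O u; rewrite g0E (shf_nat (shm i)) g0E shf_nat.
exists (@SheafMap P U X g0 g0n); split; first by apply: sheaf_mapP => O v; exact: g0E.
move=> g gf; apply: sheaf_mapP => O u; have [v <-] := surj O u.
by rewrite /= g0E -gf.
Qed.

Lemma off_axis_open : open [set w : P | q w != 0%R].
Proof. by apply: (openq pq (A := [set y | y != 0%R])); exact: open_neq. Qed.

(** The inclusion of the complement of the axis [q = 0] is not an isomorphism, but
   this open is dense in each fibre of [p]. *)
Definition plane : opens P := @Opens P setT openT.
Definition off_axis : opens P := Opens off_axis_open.

Lemma off_axis_sub : off_axis `<=` plane. Proof. by []. Qed.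

Definition off_axis_map : @mor (Sh P) (sheaf_of_open off_axis) (sheaf_of_open plane) :=
  @sheaf_yoneda P off_axis (sheaf_of_open plane) off_axis_sub.

Lemma off_axis_mono : is_mono off_axis_map.
Proof.
move=> Z u v _; apply: sheaf_mapP => O s.
exact: (@Prop_irrelevance (O `<=` off_axis)).
Qed.

(** Any point of the axis is a limit of points of the same fibre off the axis. *)
Lemma off_axis_pure : pure_mono (Sh_map cp) (Negz 0) off_axis_map.
Proof.
apply: separated_pure (@Sh_wide_pullbacks P) (@Sh_coequalizers P) (@Sh_images R) off_axis_mono.
move=> B Z Z' z k v pb a b ab; apply: sheaf_mapP => O s.
have h : open_cap O off_axis `<=` O by move=> w [].
have l : open_cap O off_axis `<=` off_axis by move=> w [].
have e : shm z _ (rst Z h s) = shm off_axis_map _ (l : sheaf_of_open off_axis _).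
  exact: (@Prop_irrelevance (open_cap O off_axis `<=` plane)).
have [c [[cs _] _]] := pullback_sheafP pb e.
have abc : pull_rst h (shm a O s) = pull_rst h (shm b O s).
  apply: (etrans (shf_nat (shm a) h s)); apply/esym.
  apply: (etrans (shf_nat (shm b) h s)); apply/esym.
  by rewrite -[rst Z h s]cs; exact: (sheaf_map_eq c ab).
apply: (@pull_dense _ _ cp B O _ _ [set w | q w != 0%R]) => [w Ow Q Qw|w Ow qw].
  have [N oN [Nw NQ]] : exists2 N : set R, open N & N (q w) /\ forall y, N y -> Q (mk (p w) y).
    by apply: (mk_near pq); rewrite (coord_mk pq).
  have [qw|qw] := eqVneq (q w) 0%R; last by exists w.
  have /nbhs_ballP[d /= d0 dN] := open_nbhs_nbhs (conj oN Nw).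
  exists (mk (p w) (d / 2)%R); rewrite (coord_p pq) /= (coord_q pq).
  split=> //; last by rewrite gt_eqF // divr_gt0.
  apply/NQ/dN; rewrite -ball_normE /= qw sub0r normrN gtr0_norm ?divr_gt0 //.
  by rewrite ltr_pdivrMr // ltr_pMr // ltr1n.
have Cw : open_cap O off_axis w by [].
have := congr1 (fun t : pull_sec cp _ _ => pval t Cw) abc.
by rewrite /= (Prop_irrelevance (h w Cw) Ow).
Qed.

(** If the complement of the axis were a sheaf for a topology in which its
   inclusion is dense, this inclusion would be an isomorphism. *)
Lemma E_le_not_all (n : int) :
  pure_mono (Sh_map cp) (n - 1)%R off_axis_map -> exists X, ~ E_le (Sh_map cp) n X.
Proof.
move=> pi; exists (sheaf_of_open off_axis : Sh P) => /(_ _ _ _ pi (idm _))[g _].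
have := shm g plane (@subset_refl _ plane) => /(_ (mk 0%R 0%R) Logic.I).
by rewrite /off_axis /opens_pred /= (coord_q pq) eqxx.
Qed.

End Dimension.

Theorem mainTheorem10 (R : realType) (p : (R * R)%type -> R)
    (cp : continuous p) (hp : p = fst \/ p = snd) :
  n_dimensional (Sh_map cp) 1 /\ without_boundary (Sh_map cp).
Proof.
have [q [mk pq]] := coordinates_exist hp.
have le1 X : E_le (Sh_map cp) 1 X := @E_le1 R p q mk cp pq X.
have fin X : E_finite (Sh_map cp) X by move=> S _ SE; exact: (SE 1%R) (le1 X).
split; last by move=> X; exact: fin.
split; first by [].
  by move=> X; split=> _; [exact: fin|exact: le1].
move=> m m1 mE.
have allm X : E_le (Sh_map cp) m X by apply/mE.
case: m m1 mE allm => [[|m]|[|m]] // _ _ all.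
- have [X []] := @E_le_not_all _ _ _ _ cp pq 0 (off_axis_pure cp pq).
  exact: all.
- have [X []] : exists X, ~ E_le (Sh_map cp) (Negz 0) X; last exact: all.
  by apply: (@E_le_not_all _ _ _ _ cp pq (Negz 0)); split; first exact: off_axis_mono.
Qed.
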